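(* Assume that $\hat G \to^p G$ as $T\to\infty$ for some positive definite symmetric random matrix $G$, and that $r_T^{-1}(\tilde\theta-\theta^* )=O_p(1)$. Let $\mathfrak G=\begin{bmatrix} I_{\mathsf p^0} & (G_{\mathcal J^{11}})^{-1}G_{\mathcal J^{10}}\end{bmatrix}$, where $I_{\mathsf p^0}$ is the $\mathsf p^0\times\mathsf p^0$ identity matrix. If $r_T^{-1}a_T=o_p(1)$ and $r_T^{-(2-q)}b_T\to^p\infty$, then $$r_T^{-1}(\hat\theta^{(q)}-\theta^* )_{\mathcal J^1}-\mathfrak G\{r_T^{-1}(\tilde\theta-\theta^* )\}\to^p0 .$$ In particular, if moreover $r_T^{-1}(\tilde\theta-\theta^* )\to^{d_s}\Gamma^{-1/2}\zeta$, where $\Gamma$ is a $\mathsf p\times\mathsf p$ positive definite symmetric (possibly random) matrix, $\to^{d_s}$ denotes $\mathcal G$-stable convergence in distribution for some $\sigma$-field $\mathcal G$ with $\sigma(\Gamma)\subset\mathcal G\subset\mathcal F$, and $\zeta$ is a $\mathsf p$-dimensional standard Gaussian random vector defined on an extension of $(\Omega,\mathcal F,P)$ and independent of $\mathcal G$, and if $G=\Gamma$, then $$r_T^{-1}(\hat\theta^{(q)}-\theta^* )_{\mathcal J^1}\to^{d_s}\mathfrak G\,\Gamma^{-1/2}\zeta\sim \mathrm{MN}_{\mathsf p^0}\big(0,(\Gamma_{\mathcal J^{11}})^{-1}\big).$$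
   Context: Let $(\Omega,\mathcal F,P)$ be a probability space, $\mathsf p$ a positive integer, $0<q\le 1$, and $(r_T)_T$ a sequence of positive numbers tending to $0$ as $T\to\infty$. All limits are as $T\to\infty$. The parameter is $\theta\in\mathbb R^{\mathsf p}$ with true value $\theta^*=[\theta_1^*,\dots,\theta_{\mathsf p}^*]'$ (prime denotes transpose), ordered so that $\theta_1^*\neq0,\dots,\theta^*_{\mathsf p^0}\neq 0$ and $\theta^*_{\mathsf p^0+1}=\dots=\theta^*_{\mathsf p}=0$. For each $T$, $\tilde\theta=\tilde\theta_T$ is an $\mathbb R^{\mathsf p}$-valued random vector (initial estimator), $\hat G=\hat G_T$ is a $\mathsf p\times\mathsf p$ almost surely positive definite symmetric random matrix, and $\kappa_T^j$ ($1\le j\le\mathsf p$) are nonnegative random variables. Define $$Q_T^{(q)}(\theta)=(\theta-\tilde\theta)'\hat G(\theta-\tilde\theta)+\sum_{j=1}^{\mathsf p}\kappa_T^j|\theta_j|^q,$$ and let $\hat\theta^{(q)}$ (the penalized LSA estimator, depending on $T$) be a random vector minimizing $Q_T^{(q)}$ over $\mathbb R^{\mathsf p}$. Put $a_T=\max\{\kappa_T^j: j\le\mathsf p^0\}$ and $b_T=\min\{\kappa_T^j:j>\mathsf p^0\}$ (with $\max\emptyset=0$, $\min\emptyset=+\infty$). For $v\in\mathbb R^{\mathsf p}$, $v_{\mathcal J^1}=[v_1,\dots,v_{\mathsf p^0}]'$. For a $\mathsf p\times\mathsf p$ matrix $M=[m_{ij}]$, $M_{\mathcal J^{11}}=[m_{ij}]_{i\le\mathsf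 p^0,\,j\le\mathsf p^0}$ and $M_{\mathcal J^{10}}=[m_{ij}]_{i\le\mathsf p^0,\,j>\mathsf p^0}$. $\mathrm{MN}_{k}(0,V)$ denotes the $k$-dimensional mixed normal distribution with (random) conditional covariance $V$, i.e. the law of $V^{1/2}\xi$ with $\xi$ a $k$-dimensional standard normal vector independent of $V$. *)

(* Defs.v *)
From HB Require Import structures.
From mathcomp Require Import all_boot all_order all_algebra.
From mathcomp Require Import all_classical all_reals all_analysis.

Set Implicit Arguments.
Unset Strict Implicit.
Unset Printing Implicit Defensive.

Import Order.TTheory GRing.Theory Num.Theory.
Import numFieldTopology.Exports numFieldNormedType.Exports.

Local Open Scope classical_set_scope.
Local Open Scope ring_scope.

(* Vectors of R^k are column vectors 'cV[R]_k, and `|M| on matrices is the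
   sup norm of the entries. *)

Section Matrices.
Context {R : realType}.

Definition qform k (A : 'M[R]_k) (x : 'cV[R]_k) : R := (x^T *m A *m x) 0 0.

Definition sym_posdef k (A : 'M[R]_k) : Prop :=
  A^T = A /\ forall x : 'cV[R]_k, x != 0 -> 0 < qform A x.

Definition sym_possemidef k (A : 'M[R]_k) : Prop :=
  A^T = A /\ forall x : 'cV[R]_k, 0 <= qform A x.

(* The unique symmetric positive semidefinite square root of A when A is itself
   symmetric positive semidefinite; 0 otherwise. *)
Definition sqrtmx k (A : 'M[R]_k) : 'M[R]_k :=
  xget 0 [set S : 'M[R]_k | sym_possemidef S /\ S *m S = A].

Definition invsqrtmx k (A : 'M[R]_k) : 'M[R]_k := sqrtmx (invmx A).

(* With p = p0 + p1, the index set J^1 is the first p0 indices, so that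
   v_{J^1} = usubmx v, M_{J^11} = ulsubmx M and M_{J^10} = ursubmx M. *)
Definition frakG (p0 p1 : nat) (M : 'M[R]_(p0 + p1)) : 'M[R]_(p0, p0 + p1) :=
  row_mx 1%:M (invmx (ulsubmx M) *m ursubmx M).

Definition borel_mx m n : set_system 'M[R]_(m, n) := <<s open >>.

End Matrices.

Section Probability.
Context {R : realType}.

Definition random_mx d (Omega : measurableType d) m n
    (X : Omega -> 'M[R]_(m, n)) : Prop :=
  forall B, borel_mx B -> measurable (X @^-1` B).

Definition sigma_mx (Omega : Type) m n (X : Omega -> 'M[R]_(m, n)) :
    set_system Omega :=
  preimage_set_system setT X (@borel_mx R m n).

Definition indep_sigma d (Omega : measurableType d) (P : probability Omega R)
    (A B : set_system Omega) : Prop :=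
  forall a b, A a -> B b -> P (a `&` b) = (P a * P b)%E.

Definition same_law d1 (Omega1 : measurableType d1) (P1 : probability Omega1 R)
    d2 (Omega2 : measurableType d2) (P2 : probability Omega2 R) m n
    (X1 : Omega1 -> 'M[R]_(m, n)) (X2 : Omega2 -> 'M[R]_(m, n)) : Prop :=
  forall B, borel_mx B -> P1 (X1 @^-1` B) = P2 (X2 @^-1` B).

(* standard Gaussian vector: mutually independent N(0,1) coordinates *)
Definition std_gaussian d (Omega : measurableType d) (P : probability Omega R) k
    (xi : Omega -> 'cV[R]_k) : Prop :=
  [/\ random_mx xi,
      forall i (B : set R), measurable B ->
        P [set w | B (xi w i 0)] = normal_prob (0 : R) 1 B
    & forall (J : {set 'I_k}) (B : 'I_k -> set R),
        (forall i, measurable (B i)) ->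
        P [set w | forall i, i \in J -> B i (xi w i 0)] =
        (\prod_(i in J) P [set w | B i (xi w i 0%R)])%E].

(* X, on (Omega1, P1), has distribution MN_k(0, V), where V is a random matrix
   on (Omega2, P2): X has the law of V'^{1/2} xi, where V' is a copy of V and
   xi is standard Gaussian and independent of V'. That law depends only on the
   law of V, not on the space carrying V' and xi. *)
Definition mixed_normal d1 (Omega1 : measurableType d1)
    (P1 : probability Omega1 R) d2 (Omega2 : measurableType d2)
    (P2 : probability Omega2 R) k
    (X : Omega1 -> 'cV[R]_k) (V : Omega2 -> 'M[R]_k) : Prop :=
  random_mx X /\ random_mx V /\
  exists (d : measure_display) (Omega' : measurableType d)
    (P' : probability Omega' R) (V' : Omega' -> 'M[R]_k)
    (xi : Omega' -> 'cV[R]_k),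
    [/\ random_mx V', same_law P' P2 V' V, std_gaussian P' xi,
        indep_sigma P' (sigma_mx xi) (sigma_mx V')
      & same_law P1 P' X (fun w => sqrtmx (V' w) *m xi w)].

(* (Omega', P') is an extension of (Omega, P) through proj; a random element X of
   Omega is identified with X \o proj, a sigma-field G with its preimage. *)
Definition prob_extension d (Omega : measurableType d) (P : probability Omega R)
    d' (Omega' : measurableType d') (P' : probability Omega' R)
    (proj : Omega' -> Omega) : Prop :=
  measurable_fun setT proj /\
  forall A, measurable A -> P' (proj @^-1` A) = P A.

End Probability.

(* The limit T --> oo is taken along a filter F on the index type I, e.g. \oo on
   nat for sequences or +oo on R for a continuous parameter. *)
Section Convergence.
Context {R : realType} {I : Type} (F : set_system I).
Context {d : measure_display} {Omega : measurableType d}.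
Variable P : probability Omega R.

Definition cvg_prob m n (X : I -> Omega -> 'M[R]_(m, n))
    (Y : Omega -> 'M[R]_(m, n)) : Prop :=
  forall e : R, 0 < e ->
    (fun T => P [set w | e < `|X T w - Y w|]) @ F --> 0%E.

Definition Op1 m n (X : I -> Omega -> 'M[R]_(m, n)) : Prop :=
  forall e : R, 0 < e -> exists M : R,
    \forall T \near F, (P [set w | (M < `|X T w|)%R] <= e%:E)%E.

Definition op1 (X : I -> Omega -> R) : Prop :=
  forall e : R, 0 < e -> (fun T => P [set w | e < `|X T w|]) @ F --> 0%E.

Definition cvg_prob_pinfty (X : I -> Omega -> \bar R) : Prop :=
  forall M : R, (fun T => P [set w | (X T w <= M%:E)%E]) @ F --> 0%E.

(* G-stable convergence of X T (on Omega) to Z, defined on an extension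
   (Omega', P', proj): E[Y f(X T)] --> E'[(Y \o proj) f(Z)] for every bounded
   continuous f and every bounded G-measurable Y. *)
Definition stable_cvg (G : set_system Omega)
    d' (Omega' : measurableType d') (P' : probability Omega' R)
    (proj : Omega' -> Omega) k
    (X : I -> Omega -> 'cV[R]_k) (Z : Omega' -> 'cV[R]_k) : Prop :=
  forall (f : 'cV[R]_k -> R) (Y : Omega -> R),
    continuous f -> (exists M, forall x, `|f x| <= M) ->
    (forall B : set R, measurable B -> G (Y @^-1` B)) ->
    (exists M, forall w, `|Y w| <= M) ->
    (fun T => \int[P]_w (Y w * f (X T w))%:E)%E @ F -->
    (\int[P']_w (Y (proj w) * f (Z w))%:E)%E.

End Convergence.

Section PenalizedLSA.
Context {R : realType}.

Definition QLSA p (q : R) (Ghat : 'M[R]_p) (thetat : 'cV[R]_p)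
    (kappa : 'I_p -> R) (theta : 'cV[R]_p) : R :=
  qform Ghat (theta - thetat) + \sum_(j < p) kappa j * `|theta j 0| `^ q.

Definition amax p0 p1 (kappa : 'I_(p0 + p1) -> R) : R :=
  \big[Num.max/0]_(j < p0) kappa (lshift p1 j).

Definition bmin p0 p1 (kappa : 'I_(p0 + p1) -> R) : \bar R :=
  \big[Order.min/+oo%E]_(j < p1) (kappa (rshift p0 j))%:E.

End PenalizedLSA.

(* Main.v *)
(** Let [u] and [ut] be the errors of the two estimators divided by [r]. Comparing the
    objective at the minimizer with its value at the true parameter shows that [u] stays
    bounded and, since [b] dominates [r^(2-q)], that the components of [u] in [J^0] tend
    to 0; exact sparsity is not used. Comparing then with the point whose [J^1]-block is
    [frakG G *m ut] and whose [J^0]-block is that of [u], the quadratic form dominates the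
    penalty increment, which is of order [a / r], and the two [J^1]-blocks are close. All
    this is deterministic on an event of probability close to 1.

    For the stable limit, [frakG Gamma] is approximated by a random matrix with countably
    many values, measurable for the sigma-field. For the mixed normal law, the limit is
    [V^1/2 *m xi] with [V = Gamma_11^-1] and [xi = W *m zeta], where the rows of [W] are
    orthonormal and [W] is independent of [zeta]; by rotation invariance of the Gaussian
    law, [xi] is standard Gaussian and independent of the sigma-field. *)
Require Import Defs.
From HB Require Import structures.
From mathcomp Require Import all_boot all_order all_algebra.
From mathcomp Require Import all_classical all_reals all_analysis.
From mathcomp Require Import measurable_realfun.
From mathcomp Require Import ring lra.

Set Implicit Arguments.
Unset Strict Implicit.
Unset Printing Implicit Defensive.

Import Order.TTheory GRing.Theory Num.Theory.
Import numFieldTopology.Exports numFieldNormedType.Exports.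

Local Open Scope classical_set_scope.
Local Open Scope ring_scope.

(** * Positive semidefinite matrices *)

Section MatrixAlgebra.
Context {R : realType}.

(** The penalty is not convex for [q < 1] and not differentiable at 0, so no stationarity condition
    is available and only values of the objective are compared. In the second comparison the two
    points share their J^0 block, so the penalties on J^0, possibly huge, cancel exactly. On J^1 the
    increment of a power is bounded by a slope taken at the comparison point, which stays away from
    0 by construction; the minimizer itself may come close to 0. [frakG G *m ut] minimizes the
    limiting quadratic form when the J^0 block is 0, and this makes the linear term of the
    comparison small. Stable convergence tests a fixed bounded variable times a function of the
    sequence alone, so a random factor cannot enter that function. On an event where the factor is
    constant it can, and the indicator of the event joins the fixed variable. Matrix square roots
    are defined by choice, so existence, uniqueness and Borel measurability of the psd root have to
    be established before the limit law makes sense. *)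

Definition dotc k (x y : 'cV[R]_k) : R := (x^T *m y) 0 0.

Lemma dotcE k (x y : 'cV[R]_k) : dotc x y = \sum_i x i 0 * y i 0.
Proof. by rewrite /dotc mxE; apply: eq_bigr => i _; rewrite mxE. Qed.

Lemma dotcC k (x y : 'cV[R]_k) : dotc x y = dotc y x.
Proof. by rewrite !dotcE; apply: eq_bigr => i _; rewrite mulrC. Qed.

Lemma dotcDr k (x y z : 'cV[R]_k) : dotc x (y + z) = dotc x y + dotc x z.
Proof. by rewrite /dotc mulmxDr mxE. Qed.

Lemma dotcZr k a (x y : 'cV[R]_k) : dotc x (a *: y) = a * dotc x y.
Proof. by rewrite /dotc -scalemxAr mxE. Qed.

Lemma dotcDl k (x y z : 'cV[R]_k) : dotc (x + y) z = dotc x z + dotc y z.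
Proof. by rewrite dotcC dotcDr !(dotcC z). Qed.

Lemma dotcZl k a (x y : 'cV[R]_k) : dotc (a *: x) y = a * dotc x y.
Proof. by rewrite dotcC dotcZr dotcC. Qed.

Lemma dotc_mull m k (A : 'M[R]_(m, k)) x y : dotc (A *m x) y = dotc x (A^T *m y).
Proof. by rewrite /dotc trmx_mul mulmxA. Qed.

Lemma dotcxx_ge0 k (x : 'cV[R]_k) : 0 <= dotc x x.
Proof. by rewrite dotcE sumr_ge0// => i _; rewrite -expr2 sqr_ge0. Qed.

Lemma dotcxx_eq0 k (x : 'cV[R]_k) : dotc x x = 0 -> x = 0.
Proof.
rewrite dotcE => /eqP; rewrite psumr_eq0; last by move=> i _; rewrite -expr2 sqr_ge0.
move=> /allP h; apply/colP => i; rewrite mxE; apply/eqP.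
by have := h i (mem_index_enum i); rewrite -expr2 sqrf_eq0.
Qed.

Lemma dotcxx_gt0 k (x : 'cV[R]_k) : x != 0 -> 0 < dotc x x.
Proof.
move=> x0; rewrite lt_def dotcxx_ge0 andbT; apply: contra x0 => /eqP/dotcxx_eq0 ->.
by [].
Qed.

Lemma qformE k (A : 'M[R]_k) x : qform A x = dotc x (A *m x).
Proof. by rewrite /qform /dotc mulmxA. Qed.

Lemma qformD k (A : 'M[R]_k) x y : A^T = A ->
  qform A (x + y) = qform A x + 2 * dotc y (A *m x) + qform A y.
Proof.
move=> As; rewrite !qformE mulmxDr !(dotcDl, dotcDr).
have -> : dotc x (A *m y) = dotc y (A *m x) by rewrite dotcC dotc_mull As.
by ring.
Qed.

Lemma qformZ k (A : 'M[R]_k) a x : qform A (a *: x) = a ^+ 2 * qform A x.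
Proof. by rewrite !qformE -scalemxAr dotcZl dotcZr; ring. Qed.

Lemma qform_tr_mul m k (A : 'M[R]_m) (B : 'M[R]_(m, k)) x :
  qform (B^T *m A *m B) x = qform A (B *m x).
Proof. by rewrite !qformE dotc_mull !mulmxA. Qed.

Lemma posdef_psd k (A : 'M[R]_k) : sym_posdef A -> sym_possemidef A.
Proof.
move=> [As Ap]; split => // x; have [->|x0] := eqVneq x 0; last exact/ltW/Ap.
by rewrite qformE mulmx0 /dotc mulmx0 mxE.
Qed.

(** A nonnegative form has a minimum at each of its zeros, so its gradient [2 *: (A *m x)] vanishes
    there. *)
Lemma psd_ker k (A : 'M[R]_k) x : sym_possemidef A -> qform A x = 0 -> A *m x = 0.
Proof.
move=> [As Ap] Ax0; apply: dotcxx_eq0; set n := dotc _ _.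
have n0 : 0 <= n := dotcxx_ge0 _.
have m0 := Ap (A *m x); set m := qform _ _ in m0.
(* Along [x - t *: (A *m x)] the form is [- 2 * t * n + t ^+ 2 * m]. The step [t = n / (m + 1)]
   makes this negative unless [n = 0]; the 1 covers the case [m = 0]. *)
have := Ap (x + (- (n / (m + 1))) *: (A *m x)).
rewrite qformD// Ax0 dotcZl -/n qformZ -/m add0r => h.
have m1 : 0 < m + 1 by lra.
have : 0 <= (2 * (- (n / (m + 1)) * n) + (- (n / (m + 1))) ^+ 2 * m) * (m + 1) ^+ 2.
  by rewrite mulr_ge0// sqr_ge0.
have -> : (2 * (- (n / (m + 1)) * n) + (- (n / (m + 1))) ^+ 2 * m) * (m + 1) ^+ 2
  = - (n ^+ 2 * (m + 2)) by field; rewrite gt_eqF.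
rewrite oppr_ge0 => h2; apply/eqP; rewrite -sqrf_eq0 eq_le sqr_ge0 andbT.
by move: h2; rewrite pmulr_lle0//; lra.
Qed.

Lemma posdef_unit k (A : 'M[R]_k) : sym_posdef A -> A \in unitmx.
Proof.
move=> [As Ap]; rewrite -unitmx_tr -row_free_unit -kermx_eq0; apply/negPn/negP.
move=> /rowV0Pn[v /sub_kermxP vA v0].
have := Ap v^T; rewrite trmx_eq0 => /(_ v0); rewrite qformE.
have -> : A *m v^T = 0 by apply: trmx_inj; rewrite trmx_mul trmxK vA trmx0.
by rewrite /dotc mulmx0 mxE ltxx.
Qed.

Lemma posdef_inv k (A : 'M[R]_k) : sym_posdef A -> sym_posdef (invmx A).
Proof.
move=> Apd; have Au := posdef_unit Apd; have [As Ap] := Apd.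
have Ais : (invmx A)^T = invmx A by rewrite trmx_inv As.
split=> // x x0.
rewrite (_ : invmx A = (invmx A)^T *m A *m invmx A); last by rewrite Ais mulVmx// mul1mx.
rewrite qform_tr_mul; apply: Ap; apply: contra x0 => /eqP Ax.
by rewrite -[x]mul1mx -(mulmxV Au) -mulmxA Ax mulmx0.
Qed.

Lemma psd_unit_posdef k (A : 'M[R]_k) :
  sym_possemidef A -> A \in unitmx -> sym_posdef A.
Proof.
move=> [As Ap] Au; split=> // x x0; rewrite lt_def Ap andbT.
apply: contra x0 => /eqP /psd_ker Ax; rewrite -[x]mul1mx -(mulVmx Au) -mulmxA.
by rewrite Ax ?mulmx0//; split.
Qed.

Lemma tr_ulsub p0 p1 (A : 'M[R]_(p0 + p1)) : A^T = A ->
  (ulsubmx A)^T = ulsubmx A.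
Proof. by move=> As; rewrite trmx_ulsub As. Qed.

Lemma ulsubmxE p0 p1 (A : 'M[R]_(p0 + p1)) :
  ulsubmx A = (col_mx 1%:M 0 : 'M[R]_(p0 + p1, p0))^T *m A *m col_mx 1%:M 0.
Proof.
rewrite tr_col_mx trmx1 trmx0 -{2}[A]submxK mul_row_block !mul1mx !mul0mx !addr0.
by rewrite mul_row_col mulmx1 mulmx0 addr0.
Qed.

Lemma posdef_ulsub p0 p1 (A : 'M[R]_(p0 + p1)) :
  sym_posdef A -> sym_posdef (ulsubmx A).
Proof.
move=> [As Ap]; split; first exact: tr_ulsub.
move=> x x0; rewrite ulsubmxE qform_tr_mul; apply: Ap.
by rewrite mul_col_mx mul1mx mul0mx col_mx_eq0 negb_and x0.
Qed.

Lemma frakGE p0 p1 (A : 'M[R]_(p0 + p1)) : sym_posdef A ->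
  frakG A = invmx (ulsubmx A) *m usubmx A.
Proof.
move=> Apd; have /posdef_unit Au := posdef_ulsub Apd.
by rewrite /frakG -[usubmx A]hsubmxK mul_mx_row mulVmx.
Qed.

(** [frakG A] is [invmx (ulsubmx A)] times the first block row of [A], so [invmx A] cancels and only
    the identity block of the other factor survives. This is where the covariance of the limit comes
    from. *)
Lemma frakG_cov p0 p1 (A : 'M[R]_(p0 + p1)) : sym_posdef A ->
  frakG A *m invmx A *m (frakG A)^T = invmx (ulsubmx A).
Proof.
move=> Apd; have Au := posdef_unit Apd.
rewrite {1}frakGE// -!mulmxA mulmxA (_ : usubmx A = row_mx 1%:M 0 *m A); last first.
  by rewrite -{2}[A]vsubmxK mul_row_col mul1mx mul0mx addr0.
rewrite -!mulmxA mulKVmx// /frakG tr_row_mx mul_row_col trmx1 mulmx1 mul0mx addr0.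
by rewrite mulmx1.
Qed.

(* For [D = S - T] and [K = S + T], the hypothesis says that [D] and [K] anticommute;
   hence [D *m K *m D] has trace 0, and being psd it vanishes on the diagonal. *)
Lemma psd_sqrt_uniq k (S T : 'M[R]_k) :
  sym_possemidef S -> sym_possemidef T -> S *m S = T *m T -> S = T.
Proof.
move=> Sp Tp ST; pose D := S - T; pose K := S + T.
have [[Ss S0] [Ts T0]] := (Sp, Tp).
have Kp : sym_possemidef K.
  split; first by rewrite linearD /= Ss Ts.
  by move=> x; rewrite qformE mulmxDl dotcDr -!qformE addr_ge0.
have Ds : D^T = D by rewrite linearB /= Ss Ts.
have DK : D *m K = - (K *m D).
  rewrite /D /K !(mulmxDl, mulmxDr, mulmxN, mulNmx) ST.
  by apply/matrixP => i j; rewrite !mxE; ring.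
have tr0 : \tr (D^T *m K *m D) = 0.
  have h1 : \tr (D *m K *m D) = \tr (K *m D *m D).
    by rewrite -mulmxA mxtrace_mulC.
  have h2 : \tr (D *m K *m D) = - \tr (K *m D *m D).
    by rewrite DK mulNmx linearN.
  by rewrite Ds; lra.
have qDe i : qform K (D *m delta_mx i 0) = 0.
  have dE j : (D^T *m K *m D) j j = qform K (D *m delta_mx j 0).
    rewrite -qform_tr_mul qformE dotcE (bigD1 j)//= big1; last first.
      by move=> l /negbTE lj; rewrite !mxE lj mul0r.
    by rewrite addr0 [delta_mx _ _ _ _]mxE !eqxx mul1r -colE [RHS]mxE.
  move: tr0; rewrite /mxtrace => /eqP; rewrite psumr_eq0; last first.
    by move=> j _; rewrite dE; apply: Kp.2.
  by move=> /allP /(_ i (mem_index_enum i)) /eqP; rewrite dE.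
(* The forms of [S] and [T] are nonnegative with sum 0 at [D *m delta_mx i 0], so both vanish there.
   By [psd_ker] both matrices annihilate this vector, and so does their difference. *)
have DD i : D *m (D *m (delta_mx i 0 : 'cV_k)) = 0.
  have := qDe i; rewrite {1}qformE (mulmxDl S T) dotcDr -!qformE => h.
  have := S0 (D *m delta_mx i 0); have := T0 (D *m delta_mx i 0) => hT hS.
  have hS0 : S *m (D *m (delta_mx i 0 : 'cV_k)) = 0 by apply: psd_ker => //; lra.
  have hT0 : T *m (D *m (delta_mx i 0 : 'cV_k)) = 0 by apply: psd_ker => //; lra.
  by rewrite {1}/D (mulmxBl S T) hS0 hT0 subr0.
have De i : D *m (delta_mx i 0 : 'cV_k) = 0.
  by apply: dotcxx_eq0; rewrite dotc_mull Ds DD /dotc mulmx0 mxE.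
have : D = 0.
  apply/matrixP => i j; have /colP /(_ i) := De j.
  by rewrite -colE !mxE.
by move/eqP; rewrite subr_eq0 => /eqP.
Qed.

(** The set given to [xget] is a singleton, so the choice is determined: on psd matrices [sqrtmx] is
    a left inverse of squaring. *)
Lemma sqrtmx_uniq k (S : 'M[R]_k) : sym_possemidef S -> sqrtmx (S *m S) = S.
Proof.
move=> Sp; rewrite /sqrtmx; case: xgetP => [T _ [Tp TS]|/(_ S) []//].
exact: psd_sqrt_uniq.
Qed.

End MatrixAlgebra.

(** * Sup norm, continuity and compactness for matrices *)

Section MatrixTopology.
Context {R : realType}.

Lemma mx_entry_le m n (x : 'M[R]_(m, n)) i j : `|x i j| <= `|x|.
Proof.
by rewrite [leRHS]/Num.norm /= mx_normrE; apply/bigmax_geP; right; exists (i, j).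
Qed.

Lemma mx_norm_leP m n (x : 'M[R]_(m, n)) (c : R) : 0 <= c ->
  (forall i j, `|x i j| <= c) -> `|x| <= c.
Proof.
move=> c0 h; rewrite [leLHS]/Num.norm /= mx_normrE; apply/bigmax_leP.
by split=> // -[i j] _; apply: h.
Qed.

Lemma mx_norm_mul m n p (A : 'M[R]_(m, n)) (B : 'M[R]_(n, p)) :
  `|A *m B| <= n%:R * `|A| * `|B|.
Proof.
apply: mx_norm_leP => [|i j]; first by rewrite !mulr_ge0.
rewrite mxE (le_trans (ler_norm_sum _ _ _))//.
rewrite (@le_trans _ _ (\sum_(k < n) `|A| * `|B|))//.
  by apply: ler_sum => k _; rewrite normrM ler_pM ?mx_entry_le.
by rewrite sumr_const card_ord -mulrA mulr_natl.
Qed.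

Lemma mx_norm_tr m n (A : 'M[R]_(m, n)) : `|A^T| = `|A|.
Proof.
apply/eqP; rewrite eq_le; apply/andP; split; apply: mx_norm_leP => // i j.
  by rewrite mxE mx_entry_le.
by rewrite -[A]trmxK mxE trmxK mx_entry_le.
Qed.

Lemma dotc_le k (x y : 'cV[R]_k) : `|dotc x y| <= k%:R * `|x| * `|y|.
Proof. by rewrite -(mx_norm_tr x) (le_trans (mx_entry_le _ _ _))// mx_norm_mul. Qed.

Lemma dotcxx_norm k (x : 'cV[R]_k) : `|x| ^+ 2 <= dotc x x.
Proof.
have h : `|x| <= Num.sqrt (dotc x x).
  apply: mx_norm_leP => [|i j]; first exact: sqrtr_ge0.
  rewrite ord1 -sqrtr_sqr ler_wsqrtr// dotcE (bigD1 i)//= -expr2 lerDl.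
  by apply: sumr_ge0 => l _; rewrite -expr2 sqr_ge0.
rewrite -[leRHS]sqr_sqrtr ?dotcxx_ge0// ler_pXn2r//; rewrite ?nnegrE ?sqrtr_ge0//.
Qed.

Lemma mx_cvgP m n (T : Type) (F : set_system T) {FF : Filter F}
    (f : T -> 'M[R]_(m, n)) (M : 'M[R]_(m, n)) :
  (forall i j, f x i j @[x --> F] --> M i j) -> f x @[x --> F] --> M.
Proof.
move=> h A [P MP PA].
have /= : \forall x \near F, forall i j, P i j (f x i j).
  by apply: filter_forall => i; apply: filter_forall => j; exact: h (MP i j).
by apply: filterS => x Px; apply: PA => i j /=; exact: Px.
Qed.

Lemma mx_continuousP m n (T : topologicalType) (f : T -> 'M[R]_(m, n)) :
  (forall i j, continuous (fun x => f x i j)) -> continuous f.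
Proof. by move=> h x; apply: mx_cvgP => i j; apply: h. Qed.

Lemma mx_entry_continuous m n (T : topologicalType) (f : T -> 'M[R]_(m, n)) i j :
  continuous f -> continuous (fun x => f x i j).
Proof.
move=> h x; apply: (@cvg_comp _ _ _ f (fun M : 'M[R]_(m, n) => M i j)).
  exact: h.
exact: coord_continuous.
Qed.

Lemma mulmx_continuous m n p (T : topologicalType) (f : T -> 'M[R]_(m, n))
    (g : T -> 'M[R]_(n, p)) :
  continuous f -> continuous g -> continuous (fun x => f x *m g x).
Proof.
move=> cf cg; apply: mx_continuousP => i j x.
rewrite (_ : (fun x => _) = fun x => \sum_k f x i k * g x k j); last first.
  by apply/funext => y; rewrite mxE.
apply: cvg_big => [|k _]; first by move=> ?; apply: add_continuous.
rewrite /GRing.mul /=.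
by apply: cvgM; [apply: mx_entry_continuous | apply: mx_entry_continuous].
Qed.

Lemma trmx_continuous m n : continuous (@trmx R m n).
Proof.
apply: mx_continuousP => i j; have -> : (fun x : 'M[R]_(m, n) => x^T i j) = fun x => x j i.
  by apply/funext => y; rewrite mxE.
exact: coord_continuous.
Qed.

(** Heine-Borel for row vectors, transported by the continuous bijection [vec_mx]. *)
Lemma closed_bounded_compact m n (A : set 'M[R]_(m, n)) :
  bounded_set A -> closed A -> compact A.
Proof.
move=> bA clA.
have cvec : continuous (@vec_mx R m n).
  apply: mx_continuousP => i j; have -> : (fun x : 'rV[R]_(m * n) => (vec_mx x : 'M[R]_(m, n)) i j) =
      fun x => x 0 (mxvec_index i j) by apply/funext => x; rewrite mxE.
  exact: coord_continuous.
have -> : A = vec_mx @` (vec_mx @^-1` A).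
  apply/seteqP; split=> [x Ax|x [y Ay <-]]//; exists (mxvec x); rewrite /= ?mxvecK//.
apply: continuous_compact; first exact: continuous_subspaceT.
apply: bounded_closed_compact; last first.
  by apply: closed_comp => // x _; exact: cvec.
have [M [Mr AM]] := bA; exists (Num.max 0 M); split; first by rewrite realE le_max lexx.
move=> x; rewrite gt_max => /andP[x0 /AM h] v Av.
apply: mx_norm_leP => [|i j]; first exact: ltW.
rewrite ord1; case/mxvec_indexP: j => k l; rewrite -[v]vec_mxK mxvecE.
by apply: le_trans (mx_entry_le _ _ _) _; apply: h.
Qed.

End MatrixTopology.

(** * Existence of psd square roots *)

Section SquareRoot.
Context {R : realType}.

Lemma dotc_continuous k (A : 'M[R]_k) : continuous (fun x : 'cV[R]_k => dotc x (A *m x)).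
Proof.
apply: (@mx_entry_continuous _ 1 1 _ (fun x : 'cV[R]_k => x^T *m (A *m x))).
apply: mulmx_continuous; first exact: trmx_continuous.
apply: (@mulmx_continuous _ _ _ _ _ (fun=> A) id); first exact: cst_continuous.
by move=> x.
Qed.

Lemma sphere_compact k : compact [set x : 'cV[R]_k | dotc x x = 1].
Proof.
apply: closed_bounded_compact.
  exists 1; split; first exact: real1.
  move=> M M1 x /= x1; apply: le_trans (ltW M1).
  have := dotcxx_norm x; rewrite x1 => h.
  by rewrite -(@ler_pXn2r _ 2)// ?nnegrE// expr1n.
rewrite (_ : mkset _ = (fun x : 'cV[R]_k => dotc x (1%:M *m x)) @^-1` [set 1]).
  apply: closed_comp => [x _|]; first exact: dotc_continuous.
  exact: closed_eq.
by apply/seteqP; split=> x /=; rewrite mul1mx.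
Qed.

(** If [x] maximizes the form on the unit sphere and [l] is the maximum, then [l%:M - A] is psd with
    a zero at [x], and [psd_ker] gives the eigenvalue equation without any differentiation. The
    dimension is a successor so that the sphere is inhabited. *)
Lemma sym_eigenvector k (A : 'M[R]_k.+1) : A^T = A ->
  exists (x : 'cV[R]_k.+1) (l : R), dotc x x = 1 /\ A *m x = l *: x.
Proof.
move=> As.
have e1 : dotc (delta_mx 0 0 : 'cV[R]_k.+1) (delta_mx 0 0) = 1.
  rewrite dotcE (bigD1 0)//= big1 => [|i /negbTE i0]; last by rewrite mxE i0 mul0r.
  by rewrite !mxE !eqxx mulr1 addr0.
have [||x xS xmax] := @compact_EVT_max _ R (fun x => dotc x (A *m x)) _ _ (@sphere_compact k.+1).
- by exists (delta_mx 0 0).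
- by apply: continuous_subspaceT; exact: dotc_continuous.
rewrite inE /= in xS; exists x, (dotc x (A *m x)); split=> //; set l := dotc x _.
have lE (y : 'cV[R]_k.+1) : qform (l%:M - A) y = l * dotc y y - dotc y (A *m y).
  by rewrite qformE mulmxBl mul_scalar_mx dotcDr dotcZr -scaleN1r dotcZr mulN1r.
have : (l%:M - A) *m x = 0.
  apply: psd_ker; last by rewrite lE xS mulr1 subrr.
  split; first by rewrite linearB /= tr_scalar_mx As.
  move=> y; rewrite lE; have [->|y0] := eqVneq y 0.
    by rewrite mulmx0 /dotc mulmx0 mxE mulr0 subrr.
  have yy := dotcxx_gt0 y0; rewrite subr_ge0 -ler_pdivrMr//.
  have s0 : 0 < Num.sqrt (dotc y y) by rewrite sqrtr_gt0.
  have := xmax ((Num.sqrt (dotc y y))^-1 *: y).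
  rewrite inE /= -!scalemxAr !(dotcZl, dotcZr) => h.
  have s2 z : (Num.sqrt (dotc y y))^-1 * ((Num.sqrt (dotc y y))^-1 * z) = z / dotc y y.
    by rewrite mulrA -expr2 exprVn sqr_sqrtr ?ltW// mulrC.
  by rewrite !s2 divff ?gt_eqF// in h; exact: h.
by rewrite mulmxBl mul_scalar_mx => /eqP; rewrite subr_eq0 => /eqP.
Qed.

(** [H] is the reflection along [v = x - e], which exchanges the unit vectors [x] and [e]. For
    [x = e] the direction degenerates and the identity is taken. *)
Lemma householder k (x : 'cV[R]_(1 + k)) : dotc x x = 1 ->
  exists H : 'M[R]_(1 + k), [/\ H^T = H, H *m H = 1%:M & col 0 H = x].
Proof.
move=> x1; pose e : 'cV[R]_(1 + k) := delta_mx 0 0.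
have ye (y : 'cV[R]_(1 + k)) : dotc y e = y 0 0.
  rewrite dotcE (bigD1 0)//= big1 => [|i /negbTE i0]; last by rewrite !mxE i0 mulr0.
  by rewrite !mxE !eqxx mulr1 addr0.
have [->|xe] := eqVneq x e.
  by exists 1%:M; rewrite trmx1 mul1mx colE mul1mx.
pose v := x - e; have v0 : v != 0 by rewrite subr_eq0.
have := dotcxx_gt0 v0; set c := dotc v v => c0.
have cE : c = 2 - 2 * x 0 0.
  rewrite /c /v -scaleN1r !(dotcDl, dotcDr, dotcZl, dotcZr) (dotcC e x) !ye x1.
  by rewrite /e !mxE !eqxx /=; ring.
pose H := 1%:M - (2 / c) *: (v *m v^T).
have vv : v^T *m v = c%:M by apply/matrixP => i j; rewrite !ord1 [RHS]mxE.
exists H; split.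
- by rewrite linearB linearZ /= trmx1 trmx_mul trmxK.
- rewrite /H mulmxBl mul1mx mulmxBr mulmx1 -scalemxAl -scalemxAr.
  rewrite -!mulmxA (mulmxA v^T) vv mul_scalar_mx -scalemxAr !scalerA.
  apply/matrixP => i j; rewrite !mxE; field; rewrite gt_eqF//.
- rewrite colE -/e /H mulmxBl mul1mx -scalemxAl -mulmxA.
  have -> : v^T *m e = (- (c / 2))%:M.
    apply/matrixP => i j; rewrite !ord1 [RHS]mxE -[LHS]/(dotc v e) ye cE /v /e !mxE !eqxx /=.
    by rewrite mulr1n; field.
  rewrite mul_mx_scalar scalerA (_ : 2 / c * - (c / 2) = -1); last by field; rewrite gt_eqF//.
  by rewrite scaleN1r opprK /v addrC subrK.
Qed.

(* A Householder reflection moves a unit eigenvector to the first basis vector and thus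
   splits off its eigenvalue. *)
Lemma psd_sqrt_exists k (A : 'M[R]_k) : sym_possemidef A ->
  exists2 S : 'M[R]_k, sym_possemidef S & S *m S = A.
Proof.
elim: k A => [|k IH] A Ap; first by exists A => //; rewrite [LHS]flatmx0 [RHS]flatmx0.
have [As A0] := Ap.
have [x [l [x1 Ax]]] := sym_eigenvector As.
have [H [Hs HH He]] := @householder k x x1.
pose B : 'M[R]_(1 + k) := H *m A *m H.
have Bs : B^T = B by rewrite /B !trmx_mul Hs As mulmxA.
have B0 y : 0 <= qform B y by rewrite /B -{1}Hs qform_tr_mul.
(* [H] maps the first basis vector to [x] and, being an involution, maps [x] back. *)
have Be : col 0 B = l *: delta_mx 0 0.
  by rewrite colE /B -!mulmxA -colE He Ax -scalemxAr -He colE mulmxA HH mul1mx.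
have BE : B = block_mx l%:M 0 0 (drsubmx B).
  have Bl : lsubmx B = col_mx l%:M 0.
    apply/matrixP => i j; rewrite ord1.
    have /colP /(_ i) := Be; rewrite !mxE (_ : lshift k 0 = 0) => [->|]; last exact: val_inj.
    case: (split_ordP i) => i' ->; rewrite ?col_mxEu ?col_mxEd !mxE ?ord1.
      by rewrite (_ : lshift k 0 = 0) ?eqxx ?mulr1//; exact: val_inj.
    by rewrite mulr0.
  have h1 : ulsubmx B = l%:M 
    by apply/matrixP => i j; have /matrixP /(_ (lshift _ i) j) := Bl; rewrite col_mxEu !mxE.
  have h2 : dlsubmx B = 0 
    by apply/matrixP => i j; have /matrixP /(_ (rshift _ i) j) := Bl; rewrite col_mxEd !mxE.
  by rewrite -[LHS]submxK h1 h2 -[ursubmx B]trmxK trmx_ursub Bs h2 trmx0.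
have l0 : 0 <= l.
  have := B0 (delta_mx 0 0); rewrite qformE -colE Be dotcZr dotcE (bigD1 0)//=.
  by rewrite big1 => [|i /negbTE i0]; rewrite !mxE ?i0 ?mul0r// !eqxx mul1r addr0 mulr1.
have [|S [Ss S0] SS] := IH (drsubmx B).
  split; first by rewrite trmx_drsub Bs.
  move=> y; have := B0 (col_mx 0 y); rewrite !qformE {1}BE mul_block_col !mul0mx.
  by rewrite mulmx0 !add0r /dotc tr_col_mx mul_row_col trmx0 mul0mx add0r.
pose T : 'M[R]_(1 + k) := block_mx (Num.sqrt l)%:M 0 0 S.
have TT : T *m T = B.
  rewrite [RHS]BE mulmx_block !(mulmx0, mul0mx, addr0, add0r) SS.
  by rewrite -scalar_mxM -expr2 sqr_sqrtr.
exists (H *m T *m H); last first.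
  rewrite !mulmxA -(mulmxA (H *m T)) HH mulmx1 -(mulmxA H T) TT /B !mulmxA HH mul1mx.
  by rewrite -mulmxA HH mulmx1.
split.
  by rewrite !trmx_mul Hs mulmxA tr_block_mx tr_scalar_mx Ss !trmx0.
move=> y; rewrite -{1}Hs qform_tr_mul; move: (H *m y) => z.
rewrite qformE -[z]vsubmxK mul_block_col !mul0mx addr0 add0r.
rewrite /dotc tr_col_mx mul_row_col mxE addr_ge0//.
  by rewrite mul_scalar_mx -scalemxAr mxE mulr_ge0 ?sqrtr_ge0// dotcxx_ge0.
by have := S0 (dsubmx z); rewrite qformE.
Qed.

Lemma sqrtmxP k (A : 'M[R]_k) : sym_possemidef A ->
  sym_possemidef (sqrtmx A) /\ sqrtmx A *m sqrtmx A = A.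
Proof. by move=> /psd_sqrt_exists[S Sp <-]; rewrite sqrtmx_uniq. Qed.

Lemma sqrtmx_posdef k (A : 'M[R]_k) : sym_posdef A -> sym_posdef (sqrtmx A).
Proof.
move=> Ap; have [Sp SS] := sqrtmxP (posdef_psd Ap).
apply: psd_unit_posdef => //; have := posdef_unit Ap.
by rewrite -{1}SS unitmx_mul => /andP[].
Qed.

(* Given [Gamma], the conditional covariance of [frakG Gamma *m Gamma^-1/2 *m zeta]
   is [V = Gamma_11^-1], so this matrix maps [zeta] to the Gaussian vector [xi]
   such that [V^1/2 *m xi] is the limit. *)
Definition whitening p0 p1 (A : 'M[R]_(p0 + p1)) : 'M[R]_(p0, p0 + p1) :=
  invmx (sqrtmx (invmx (ulsubmx A))) *m (frakG A *m invsqrtmx A).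

(** By [frakG_cov] the product is [V^-1/2 *m V *m V^-1/2] with [V = invmx (ulsubmx A)]. *)
Lemma whitening_unitary p0 p1 (A : 'M[R]_(p0 + p1)) : sym_posdef A ->
  whitening A *m (whitening A)^T = 1%:M.
Proof.
move=> Ap; have Vp := posdef_inv (posdef_ulsub Ap).
have [[Ts _] TT] := sqrtmxP (posdef_psd Vp).
have /posdef_unit Tu := sqrtmx_posdef Vp.
have [[Ss _] SS] := sqrtmxP (posdef_psd (posdef_inv Ap)).
rewrite /whitening !trmx_mul /invsqrtmx Ss trmx_inv Ts.
set T := sqrtmx (invmx (ulsubmx A)); set S := sqrtmx (invmx A).
rewrite (_ : _ *m _ = invmx T *m (frakG A *m (S *m S) *m (frakG A)^T) *m invmx T).
  by rewrite SS frakG_cov// -TT -/T mulKmx// mulmxV.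
by rewrite !mulmxA.
Qed.

Lemma whiteningK p0 p1 (A : 'M[R]_(p0 + p1)) : sym_posdef A ->
  sqrtmx (invmx (ulsubmx A)) *m whitening A = frakG A *m invsqrtmx A.
Proof.
move=> Ap; rewrite /whitening mulKVmx//.
exact/posdef_unit/sqrtmx_posdef/posdef_inv/posdef_ulsub.
Qed.

(** A default with orthonormal rows, for the sample points where [whitening] does not have them. *)
Lemma row_mx10_unitary p0 p1 :
  (row_mx 1%:M 0 : 'M[R]_(p0, p0 + p1)) *m (row_mx 1%:M 0)^T = 1%:M.
Proof. by rewrite tr_row_mx mul_row_col trmx1 mulmx1 trmx0 mulmx0 addr0. Qed.

End SquareRoot.

(** * Random matrices *)

Notation borelM R m n := (g_sigma_algebraType (@open 'M[R]_(m, n))).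

Section RandomMatrices.
Context {R : realType} {d : measure_display} {Omega : measurableType d}.

Lemma random_mx_open m n (X : Omega -> 'M[R]_(m, n)) :
  (forall U, open U -> measurable (X @^-1` U)) -> random_mx X.
Proof.
move=> h B BB; rewrite -[X in measurable X]setTI.
have /(_ measurableT B BB) // : measurable_fun setT (X : Omega -> borelM R m n).
apply: (@measurability _ _ Omega (borelM R m n) setT X (@open 'M[R]_(m, n))) => //.
by move=> _ [U oU <-]; rewrite setTI; exact: h.
Qed.

Lemma random_mx_fun m n (X : Omega -> 'M[R]_(m, n)) :
  random_mx X -> measurable_fun setT (X : Omega -> borelM R m n).
Proof. by move=> h _ B BB; rewrite setTI; exact: h. Qed.

Lemma continuous_random_mx m n (X : Omega -> 'M[R]_(m, n)) (f : 'M[R]_(m, n) -> R) :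
  continuous f -> random_mx X -> measurable_fun setT (f \o X).
Proof.
move=> cf rX; apply: (measurability _ (RGenOpens.measurableE R)).
move=> _ [_ [a [b ->] <-]]; rewrite setTI comp_preimage; apply: rX.
by apply: sub_sigma_algebra; move/continuousP : cf; apply; exact: interval_open.
Qed.

Lemma random_mx_entry m n (X : Omega -> 'M[R]_(m, n)) i j :
  random_mx X -> measurable_fun setT (fun w => X w i j).
Proof. exact: (continuous_random_mx (@coord_continuous R m n i j)). Qed.

Lemma measurable_bigmaxr (I : Type) (s : seq I) (x0 : R) (f : I -> Omega -> R) :
  (forall i, measurable_fun setT (f i)) ->
  measurable_fun setT (fun w => \big[Num.max/x0]_(i <- s) f i w).
Proof.
move=> mf; elim: s => [|i s IH].
  by under eq_fun do rewrite big_nil; exact: measurable_cst.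
by under eq_fun do rewrite big_cons; exact: measurable_maxr.
Qed.

Lemma measurable_mx_norm m n (X : Omega -> 'M[R]_(m, n)) :
  (forall i j, measurable_fun setT (fun w => X w i j)) ->
  measurable_fun setT (fun w => `|X w|).
Proof.
move=> mX; rewrite /Num.norm /=; under eq_fun do rewrite mx_normrE.
apply: measurable_bigmaxr => -[i j] /=.
by apply: measurableT_comp => //; exact: mX.
Qed.

(** Borel sets are generated by open sets, whereas matrix operations are measurable entry by entry.
    Second countability links the two: an open set is a countable union of sup-norm balls with
    rational centers and radii [k.+1%:R^-1], whose preimages only involve the entries. *)
Lemma random_mxP m n (X : Omega -> 'M[R]_(m, n)) :
  (forall i j, measurable_fun setT (fun w => X w i j)) -> random_mx X.
Proof.
move=> mX; apply: random_mx_open => U oU.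
pose q (z : 'M[rat]_(m, n) * nat) : 'M[R]_(m, n) := map_mx ratr z.1.
pose D := [set z | ball (q z) z.2.+1%:R^-1 `<=` U].
have UE : U = \bigcup_(z in D) ball (q z) z.2.+1%:R^-1.
  apply/seteqP; split=> [x Ux|x [z Dz zx]]; last exact: Dz.
  have /nbhs_ballP[e /= e0 eU] := open_nbhs_nbhs (conj oU Ux).
  have [k ke] : exists k, (k.+1%:R^-1 : R) < e / 2.
    have e2 : 0 < e / 2 by rewrite divr_gt0.
    have [k _ /(_ k (leqnn k)) h] := near_infty_natSinv_lt (PosNum e2).
    by exists k.
  have k0 : 0 < (k.+1%:R^-1 : R) by rewrite invr_gt0.
  have hq (z : R) : exists r : rat, `|z - ratr r| < k.+1%:R^-1.
    have /rat_in_itvoo[r] : z - k.+1%:R^-1 < z + k.+1%:R^-1 by rewrite ltrBlDr -addrA ltrDl addr_gt0.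
    rewrite in_itv /= => /andP[r1 r2]; exists r.
    by rewrite distrC ltr_distl r1 r2.
  pose M := \matrix_(i, j) (xchoose (hq (x i j))).
  have Mx : ball (q (M, k)) k.+1%:R^-1 x.
    by split=> // i j; rewrite !mxE /ball /= distrC; exact: xchooseP (hq (x i j)).
  exists (M, k) => // y [_ My]; apply: eU; split=> // i j.
  have [_ /(_ i j)] := Mx; have /= := My i j; rewrite /ball /= => h1 h2.
  rewrite -(subrKA (q (M, k) i j)) (le_lt_trans (ler_normD _ _))// distrC.
  by rewrite (splitr e) ltrD// (lt_trans _ ke).
rewrite UE preimage_bigcup bigcup_mkcond; apply: countable_bigcupT_measurable => //.
move=> z; case: ifP => // _.
rewrite (_ : _ @^-1` _ = (fun w => `|q z - X w|) @^-1` `]-oo, z.2.+1%:R^-1[%classic); last first.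
  by apply/seteqP; split=> w /=; rewrite in_itv /= -[ball _ _ _]/(ball (q z) _ _) -ball_normE.
rewrite -[X in measurable X]setTI; apply: measurable_mx_norm => // i j.
under eq_fun do rewrite !mxE; apply: measurable_funD => //.
by apply: measurable_funN.
Qed.

Lemma random_mx_norm m n (X : Omega -> 'M[R]_(m, n)) :
  random_mx X -> measurable_fun setT (fun w => `|X w|).
Proof. by move=> rX; apply: measurable_mx_norm => i j; exact: random_mx_entry. Qed.

Lemma random_mx_cst m n (A : 'M[R]_(m, n)) : random_mx (fun _ : Omega => A).
Proof. by apply: random_mxP => i j; exact: measurable_cst. Qed.

Lemma random_mxB m n (X Y : Omega -> 'M[R]_(m, n)) :
  random_mx X -> random_mx Y -> random_mx (fun w => X w - Y w).
Proof.
move=> rX rY; apply: random_mxP => i j; under eq_fun do rewrite !mxE.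
by apply: measurable_funB; exact: random_mx_entry.
Qed.

Lemma random_mxZ m n (a : R) (X : Omega -> 'M[R]_(m, n)) :
  random_mx X -> random_mx (fun w => a *: X w).
Proof.
move=> rX; apply: random_mxP => i j; under eq_fun do rewrite !mxE.
by apply: measurable_funM => //; exact: random_mx_entry.
Qed.

Lemma random_mxM m n p (X : Omega -> 'M[R]_(m, n)) (Y : Omega -> 'M[R]_(n, p)) :
  random_mx X -> random_mx Y -> random_mx (fun w => X w *m Y w).
Proof.
move=> rX rY; apply: random_mxP => i j; under eq_fun do rewrite !mxE.
by apply: measurable_sum => k; apply: measurable_funM; exact: random_mx_entry.
Qed.

Lemma random_mxsub m n m' n' (f : 'I_m' -> 'I_m) (g : 'I_n' -> 'I_n)
    (X : Omega -> 'M[R]_(m, n)) :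
  random_mx X -> random_mx (fun w => mxsub f g (X w)).
Proof.
move=> rX; apply: random_mxP => i j; under eq_fun do rewrite !mxE.
exact: random_mx_entry.
Qed.

Lemma random_row_mx m n p (X : Omega -> 'M[R]_(m, n)) (Y : Omega -> 'M[R]_(m, p)) :
  random_mx X -> random_mx Y -> random_mx (fun w => row_mx (X w) (Y w)).
Proof.
move=> rX rY; apply: random_mxP => i j; case: (split_ordP j) => k ->.
  by under eq_fun do rewrite row_mxEl; exact: random_mx_entry.
by under eq_fun do rewrite row_mxEr; exact: random_mx_entry.
Qed.

Lemma measurable_det n (X : Omega -> 'M[R]_n) :
  random_mx X -> measurable_fun setT (fun w => \det (X w)).
Proof.
move=> rX; apply: measurable_sum => s; apply: measurable_funM => //.
by apply: measurable_prod => i _; exact: random_mx_entry.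
Qed.

Lemma measurable_invr (f : Omega -> R) :
  measurable_fun setT f -> measurable_fun setT (fun w => (f w)^-1).
Proof.
(* The identity also holds where [f w = 0], both sides being 0 there, and reduces inversion to the
   measurable real power. *)
move=> mf; rewrite (_ : (fun w => _) = fun w => f w * (f w ^+ 2) `^ (-1)); last first.
  apply/funext => w; rewrite powR_inv1 ?sqr_ge0//.
  have [->|f0] := eqVneq (f w) 0; first by rewrite invr0 mul0r.
  by rewrite expr2 invfM mulrA divff// mul1r.
apply: measurable_funM => //.
by apply: (measurableT_comp (f := fun x : R => x `^ (-1))); [exact: measurable_powR | exact: measurable_funX].
Qed.

Lemma random_invmx n (X : Omega -> 'M[R]_n) :
  random_mx X -> random_mx (fun w => invmx (X w)).
Proof.
move=> rX; have mdet := measurable_det rX; apply: random_mxP => i j.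
(* [invmx] returns a singular matrix unchanged; elsewhere this is Cramer's formula. *)
rewrite (_ : (fun w => _) = fun w => if \det (X w) == 0 then X w i j else
   (\det (X w))^-1 * \adj (X w) i j); last first.
  apply/funext => w; rewrite /invmx unitmxE unitfE.
  by case: eqVneq => //= _; rewrite mxE.
apply: measurable_fun_ifT; [exact: measurable_fun_eqr | exact: random_mx_entry |].
apply: measurable_funM; first exact: measurable_invr.
under eq_fun do rewrite mxE; apply: measurable_funM => //; apply: measurable_det.
by apply: (random_mxsub (lift j) id); apply: (random_mxsub id (lift i)).
Qed.

Lemma random_usubmx m1 m2 n (X : Omega -> 'M[R]_(m1 + m2, n)) :
  random_mx X -> random_mx (fun w => usubmx (X w)).
Proof.
move=> rX; apply: random_mxP => i j; under eq_fun do rewrite !mxE.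
exact: random_mx_entry.
Qed.

Lemma random_trmx m n (X : Omega -> 'M[R]_(m, n)) :
  random_mx X -> random_mx (fun w => (X w)^T).
Proof.
move=> rX; apply: random_mxP => i j; under eq_fun do rewrite mxE.
exact: random_mx_entry.
Qed.

Lemma random_mx_ifT m n (X Y : Omega -> 'M[R]_(m, n)) (b : Omega -> bool) :
  measurable_fun setT b -> random_mx X -> random_mx Y ->
  random_mx (fun w => if b w then X w else Y w).
Proof.
move=> mb rX rY; apply: random_mxP => i j.
rewrite (_ : (fun w => _) = fun w => if b w then X w i j else Y w i j).
  by apply: measurable_fun_ifT => //; exact: random_mx_entry.
by apply/funext => w; case: (b w).
Qed.

Lemma random_ulsubmx p0 p1 (X : Omega -> 'M[R]_(p0 + p1)) :
  random_mx X -> random_mx (fun w => ulsubmx (X w)).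
Proof.
move=> rX; apply: random_mxP => i j; under eq_fun do rewrite !mxE.
exact: random_mx_entry.
Qed.

Lemma random_frakG p0 p1 (X : Omega -> 'M[R]_(p0 + p1)) :
  random_mx X -> random_mx (fun w => frakG (X w)).
Proof.
move=> rX; apply: random_row_mx; first exact: random_mx_cst.
apply: random_mxM; first by apply: random_invmx; exact: random_ulsubmx.
apply: random_mxP => i j; under eq_fun do rewrite !mxE.
exact: random_mx_entry.
Qed.

End RandomMatrices.

(** * Borel measurability of the square root and of the maps built on it *)

Section BorelMaps.
Context {R : realType}.

Lemma random_mx_comp d (Omega : measurableType d) m n m' n'
    (g : 'M[R]_(m, n) -> 'M[R]_(m', n')) (X : Omega -> 'M[R]_(m, n)) :
  random_mx (g : borelM R m n -> _) -> random_mx X -> random_mx (fun w => g (X w)).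
Proof. by move=> rg rX B BB; apply: (rX (g @^-1` B)); exact: rg. Qed.

Lemma random_mx_id m n : random_mx (id : borelM R m n -> 'M[R]_(m, n)).
Proof. by []. Qed.

Lemma closed_sym_possemidef n : closed [set S : 'M[R]_n | sym_possemidef S].
Proof.
rewrite (_ : mkset _ = (fun S : 'M[R]_n => S^T - S) @^-1` [set 0] `&`
  \bigcap_(x in [set: 'cV[R]_n]) (fun S : 'M[R]_n => qform S x) @^-1` [set t | 0 <= t]); last first.
  apply/seteqP; split=> [S [Ss S0]|S [/= /eqP Ss S0]] /=.
    by split; [rewrite Ss subrr | move=> x _ /=].
  by split; [apply/eqP; rewrite -subr_eq0 | move=> x; apply: S0].
apply: closedI.
  apply: closed_comp => [S _|].
    apply: (@cvgB _ 'M[R]_n _ _ _ (fun S => S^T) id); [exact: (nbhs_filter S)|exact: (@trmx_continuous R n n S)|exact: cvg_id].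
  by apply: accessible_closed_set1; apply: hausdorff_accessible; exact: norm_hausdorff.
apply: closed_bigI => x _; apply: closed_comp; last exact: closed_ge.
move=> S _; apply: (@mx_entry_continuous _ 1 1 _ (fun S : 'M[R]_n => x^T *m S *m x)).
apply: mulmx_continuous; last exact: cst_continuous.
by apply: mulmx_continuous; [exact: cst_continuous | move=> ?].
Qed.

(* Squaring is continuous and proper on the closed cone of psd matrices, hence maps
   closed sets to closed sets; there [sqrtmx] is its inverse. *)
Lemma random_sqrtmx n : random_mx (@sqrtmx R n : borelM R n n -> 'M[R]_n).
Proof.
pose sq (S : 'M[R]_n) := S *m S.
pose psd : set 'M[R]_n := [set S | sym_possemidef S].
have csq : continuous sq by apply: mulmx_continuous => ?.
have mclosed (C : set 'M[R]_n) : closed C -> @measurable _ (borelM R n n) (sq @` (C `&` psd)).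
  move=> clC.
  (* Each truncation is compact, so its image is compact and hence closed; the whole image is a
     countable union of these. *)
  have -> : sq @` (C `&` psd) =
      \bigcup_k (sq @` (C `&` psd `&` [set S | `|S| <= k%:R])).
    apply/seteqP; split=> [_ [S [CS pS] <-]|_ [k _ [S [CS _] <-]]]; last by exists S.
    have [k kS] : exists k : nat, `|S| <= k%:R.
      by exists (Num.trunc `|S|).+1; rewrite ltW// truncnS_gt.
    by exists k => //; exists S.
  apply: bigcup_measurable => k _; rewrite -[X in measurable X]setCK.
  apply: measurableC; apply: sub_sigma_algebra; rewrite /= openC.
  apply: compact_closed; first exact: norm_hausdorff.
  apply: continuous_compact; first exact: continuous_subspaceT.
  apply: closed_bounded_compact.
    exists k%:R; split; first exact: realn.
    by move=> M kM S [_ /= Sk]; rewrite (le_trans Sk)// ltW.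
  apply: closedI; first by apply: closedI => //; exact: closed_sym_possemidef.
  apply: (@closed_comp _ _ (fun S : 'M[R]_n => `|S|) [set t | t <= k%:R]); last exact: closed_le.
  by move=> S _; exact: (@norm_continuous R 'M[R]_n S).
apply: random_mx_open => U oU; rewrite -[X in measurable X]setCK preimage_setC.
apply: measurableC.
have mU : @measurable _ (borelM R n n) (sq @` (~` U `&` psd)).
  by apply: mclosed; exact: open_closedC.
have sqrt_root S : psd S -> sqrtmx (sq S) = S := @sqrtmx_uniq R n S.
have sqrt_noroot A : ~ (sq @` (setT `&` psd)) A -> sqrtmx A = 0.
  move=> nA; rewrite /sqrtmx; case: xgetP => // S _ [pS SA].
  by case: nA; exists S.
have subU : sq @` (~` U `&` psd) `<=` @sqrtmx R n @^-1` (~` U).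
  by move=> _ [S [US pS] <-] /=; rewrite sqrt_root.
(* Matrices without a psd root are sent to the default 0, so all of them lie in the preimage of [U]
   or none does. *)
have [U0|U0] := pselect (U 0).
  rewrite (_ : _ @^-1` _ = sq @` (~` U `&` psd))//; apply/seteqP; split=> // A /= UA.
  have [[S [_ pS] SA]|/sqrt_noroot A0] := pselect ((sq @` (setT `&` psd)) A).
    by exists S => //; split=> //; rewrite -SA sqrt_root in UA.
  by rewrite A0 in UA.
rewrite (_ : _ @^-1` _ = sq @` (~` U `&` psd) `|` ~` (sq @` (setT `&` psd))).
  by apply: measurableU => //; apply: measurableC; apply: mclosed; exact: closedT.
apply/seteqP; split=> [A /= UA|A /= [/subU //|/sqrt_noroot ->//]].
have [[S [_ pS] SA]|nA] := pselect ((sq @` (setT `&` psd)) A); last by right.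
by left; exists S => //; split=> //; rewrite -SA sqrt_root in UA.
Qed.

Lemma random_invsqrtmx n : random_mx (@invsqrtmx R n : borelM R n n -> 'M[R]_n).
Proof.
apply: (random_mx_comp (g := @sqrtmx R n) (X := fun A : borelM R n n => invmx A)).
  exact: random_sqrtmx.
exact: random_invmx (@random_mx_id n n).
Qed.

Lemma random_whitening p0 p1 :
  random_mx (@whitening R p0 p1 : borelM R (p0 + p1) (p0 + p1) -> _).
Proof.
have rid := @random_mx_id (p0 + p1) (p0 + p1).
apply: random_mxM; last first.
  by apply: random_mxM; [exact: random_frakG | exact: random_invsqrtmx].
apply: random_invmx.
apply: (random_mx_comp (g := @sqrtmx R p0)
  (X := fun A : borelM R (p0 + p1) (p0 + p1) => invmx (ulsubmx A))).
  exact: random_sqrtmx.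
by apply: random_invmx; exact: random_ulsubmx.
Qed.

End BorelMaps.

(** * Gaussian vectors *)

Section Lebesgue2D.
Context {R : realType}.
Local Notation mu := (@lebesgue_measure R).

(** The image of Lebesgue measure under a translation gives half-open intervals their length, which
    characterizes Lebesgue measure. *)
Lemma lebesgue_shift (a : R) (g : R -> \bar R) :
  measurable_fun setT g -> (forall x, (0 <= g x)%E) ->
  (\int[mu]_x g (x + a)%R = \int[mu]_x g x)%E.
Proof.
move=> mg g0; have ma : measurable_fun setT (fun x : R => x + a).
  exact: measurable_funD.
transitivity (\int[pushforward mu (fun x : R => (x + a)%R : measurableTypeR R)]_x g x)%E.
  by rewrite ge0_integral_pushforward.
apply: eq_measure_integral => A mA _; apply/esym.
apply: lebesgue_measure_unique => // X [[x y] xy <-].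
rewrite /= /pushforward.
rewrite (_ : _ @^-1` _ = `]x - a, y - a]%classic); last first.
  by apply/seteqP; split=> z /=; rewrite !in_itv /= ltrBlDr lerBrDr.
by rewrite !lebesgue_measure_itv /= !lte_fin ltrD2r -!EFinB opprB addrA subrK.
Qed.

Lemma lebesgue_opp (g : R -> \bar R) :
  measurable_fun setT g -> (forall x, (0 <= g x)%E) ->
  (\int[mu]_x g (- x)%R = \int[mu]_x g x)%E.
Proof.
move=> mg g0; transitivity (\int[pushforward mu (-%R : R -> measurableTypeR R)]_x g x)%E.
  by rewrite ge0_integral_pushforward.
by apply: eq_measure_integral => A mA _; exact: lebesgue_measureN.
Qed.

(** Iterated rather than over the product: for a fixed outer variable, a shear of the inner one is a
    translation. Tonelli exchanges the roles. *)
Definition iint (f : R * R -> \bar R) : \bar R := (\int[mu]_x \int[mu]_y f (x, y))%E.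

Lemma measurable_shear_right (t : R) :
  measurable_fun setT (fun z : R * R => (z.1, z.2 + t * z.1)).
Proof.
apply: measurable_fun_pair => //=.
apply: measurable_funD => //; exact: measurable_funM.
Qed.

Lemma measurable_shear_left (t : R) :
  measurable_fun setT (fun z : R * R => (z.1 + t * z.2, z.2)).
Proof.
apply: measurable_fun_pair => //=.
apply: measurable_funD => //; exact: measurable_funM.
Qed.

Lemma shear_right (t : R) (f : R * R -> \bar R) :
  measurable_fun setT f -> (forall z, (0 <= f z)%E) ->
  iint (fun z : R * R => f (z.1, z.2 + t * z.1)) = iint f.
Proof.
move=> mf f0; apply: eq_integral => x _ /=.
apply: (@lebesgue_shift (t * x) (fun y => f (x, y))) => //.
exact: measurableT_comp.
Qed.

Lemma shear_left (t : R) (f : R * R -> \bar R) :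
  measurable_fun setT f -> (forall z, (0 <= f z)%E) ->
  iint (fun z : R * R => f (z.1 + t * z.2, z.2)) = iint f.
Proof.
move=> mf f0; have h := measurableT_comp mf (measurable_shear_left t).
rewrite /iint; transitivity (\int[mu]_y \int[mu]_x f ((x + t * y)%R, y))%E.
  exact: (@fubini_tonelli _ _ _ _ R mu mu _ h (fun z => f0 _)).
apply: etrans _ (esym (@fubini_tonelli _ _ _ _ R mu mu _ mf f0)).
apply: eq_integral => y _ /=.
apply: (@lebesgue_shift (t * y) (fun x => f (x, y))) => //.
exact: measurableT_comp.
Qed.

Definition rot2 (c s : R) (z : R * R) : R * R :=
  (c * z.1 + s * z.2, - s * z.1 + c * z.2).

Lemma measurable_rot2 c s : measurable_fun setT (rot2 c s).
Proof.
apply: measurable_fun_pair => /=; apply: measurable_funD => //;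
  exact: measurable_funM.
Qed.

(* A rotation by an angle that is not a multiple of pi is a product of three
   shears. *)
Lemma lebesgue_rot2 c s (f : R * R -> \bar R) : c ^+ 2 + s ^+ 2 = 1 -> s != 0 ->
  measurable_fun setT f -> (forall z, (0 <= f z)%E) ->
  iint (f \o rot2 c s) = iint f.
Proof.
(* The tangent of half the angle whose cosine and sine are [c] and [s]; the shears have parameters
   [t], [- s], [t]. *)
move=> cs s0 mf f0; pose t := (1 - c) / s.
have mfl := measurableT_comp mf (measurable_shear_left t).
have mflr := measurableT_comp mfl (measurable_shear_right (- s)).
apply: etrans (etrans (shear_left t mflr (fun z => f0 _))
  (etrans (shear_right (- s) mfl (fun z => f0 _)) (shear_left t mf f0))).
apply: eq_integral => x _; apply: eq_integral => y _; congr f; rewrite /rot2 /=.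
have c2 : c ^+ 2 = 1 - s ^+ 2 by rewrite -cs addrK.
congr pair; apply/eqP; rewrite -subr_eq0; apply/eqP.
  transitivity (y / s * (c ^+ 2 + s ^+ 2 - 1)); last by rewrite cs subrr mulr0.
  by rewrite /t; field.
by rewrite /t; field.
Qed.

Local Notation phi := (@normal_pdf R 0 1).

(** The product of two standard normal laws, given by its density so that invariance of Lebesgue
    measure applies. *)
Definition gauss2 (E : set (measurableTypeR R * measurableTypeR R)) : \bar R :=
  (\int[mu \x mu]_(z in E) (phi z.1 * phi z.2)%:E)%E.

Lemma gauss2_density_ge0 z : 0 <= phi z.1 * phi z.2.
Proof. by rewrite mulr_ge0// normal_pdf_ge0. Qed.

Lemma measurable_gauss2_density :
  measurable_fun setT (fun z : R * R => (phi z.1 * phi z.2)%:E).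
Proof.
apply/measurable_EFinP; apply: measurable_funM.
  by apply: (measurableT_comp (f := phi)) => //; exact: measurable_normal_pdf.
by apply: (measurableT_comp (f := phi)) => //; exact: measurable_normal_pdf.
Qed.

Let gauss2_set0 : gauss2 set0 = 0%E.
Proof. exact: integral_set0. Qed.

Let gauss2_ge0 E : (0 <= gauss2 E)%E.
Proof. by apply: integral_ge0 => z _; rewrite lee_fin gauss2_density_ge0. Qed.

Let gauss2_sigma_additive : semi_sigma_additive gauss2.
Proof.
move=> A mA tA mUA; rewrite /gauss2 ge0_integral_bigcup//.
- apply: is_cvg_ereal_nneg_natsum_cond => n _ _; exact: gauss2_ge0.
- by apply: measurable_funTS; exact: measurable_gauss2_density.
- by move=> z _; rewrite lee_fin gauss2_density_ge0.
Qed.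

HB.instance Definition _ := isMeasure.Build _ _ _ gauss2
  gauss2_set0 gauss2_ge0 gauss2_sigma_additive.

Local Notation N := (normal_prob (0 : R) 1).

Lemma gauss2E E : measurable E ->
  gauss2 E = iint (fun z => (\1_E z * (phi z.1 * phi z.2))%:E).
Proof.
move=> mE; rewrite /gauss2 integral_mkcond fubini_tonelli1.
- apply: eq_integral => x _; apply: eq_integral => y _.
  by rewrite patchE indicE; case: ifP => _; rewrite ?mul1r ?mul0r.
- by apply: (iffLR (measurable_restrictT _ mE)); apply: measurable_funTS; exact: measurable_gauss2_density.
- by move=> z; rewrite patchE; case: ifP => // _; rewrite lee_fin gauss2_density_ge0.
Qed.

Lemma gauss2_normal E : measurable E -> gauss2 E = (N \x N)%E E.
Proof.
move=> mE; apply/esym; apply: (@product_measure_unique _ _ _ _ R N N gauss2) => // A B mA mB.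
rewrite /= gauss2E; last exact: measurableX.
have mphi C : measurable C -> measurable_fun C (fun x => (phi x)%:E).
  by move=> _; apply: measurable_funTS; apply/measurable_EFinP; exact: measurable_normal_pdf.
have phi0 x : (0 <= (phi x)%:E)%E by rewrite lee_fin normal_pdf_ge0.
rewrite /normal_prob -ge0_integralZr//; [|exact: mphi|exact: integral_ge0].
rewrite /iint [RHS]integral_mkcond; apply: eq_integral => x _; rewrite patchE.
case: ifPn => xA.
  rewrite -ge0_integralZl//; last exact: mphi.
  rewrite [RHS]integral_mkcond; apply: eq_integral => y _; rewrite patchE.
  by rewrite indicE in_setX xA /=; case: ifP => _; rewrite ?mul1r ?mul0r.
rewrite integral0_eq// => y _; rewrite indicE in_setX (negbTE xA) /=.
by rewrite mul0r.
Qed.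

(** The density depends on [x ^+ 2 + y ^+ 2] alone, and both this and Lebesgue measure are invariant
    under the rotation. *)
Lemma gauss2_rot c s E : c ^+ 2 + s ^+ 2 = 1 -> s != 0 -> measurable E ->
  (N \x N)%E (rot2 c s @^-1` E) = (N \x N)%E E.
Proof.
move=> cs s0 mE; have mrE : measurable (rot2 c s @^-1` E).
  by rewrite -[X in measurable X]setTI; exact: measurable_rot2.
rewrite -(gauss2_normal mrE) -(gauss2_normal mE) (gauss2E mrE) (gauss2E mE).
rewrite -[RHS](lebesgue_rot2 cs s0); last 2 first.
- apply/measurable_EFinP; apply: measurable_funM; first exact: measurable_indic.
  by apply/measurable_EFinP; exact: measurable_gauss2_density.
- by move=> z; rewrite lee_fin mulr_ge0// gauss2_density_ge0.
apply: eq_integral => x _; apply: eq_integral => y _ /=; congr (_ * _)%:E.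
rewrite !normal_pdfE ?oner_neq0// /normal_fun !subr0 mulrACA -expRD.
rewrite [RHS]mulrACA -expRD; congr (_ * expR _).
rewrite -!mulrDl; congr (_ * _).
by transitivity (- (c ^+ 2 + s ^+ 2) * (x ^+ 2 + y ^+ 2)); [rewrite cs|]; ring.
Qed.

Lemma normal_opp (B : set R) : measurable B -> N [set x | B (- x)] = N B.
Proof.
move=> mB; rewrite /normal_prob [LHS]integral_mkcond [RHS]integral_mkcond.
rewrite -[RHS]lebesgue_opp; last 2 first.
- apply/(measurable_restrictT _ mB)/measurable_funTS/measurable_EFinP.
  exact: measurable_normal_pdf.
- by move=> z; rewrite patchE; case: ifP => // _; rewrite lee_fin normal_pdf_ge0.
apply: eq_integral => x _; rewrite !patchE; congr (if _ then _ else _).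
by rewrite !normal_pdfE ?oner_neq0// /normal_fun !subr0 sqrrN.
Qed.

End Lebesgue2D.

(** Rectangles form a generating pi-system containing the whole space. The measures are arbitrary
    because [std_gaussian_rot] compares a restricted law with a multiple of a product law. *)
Lemma rectangle_measure_unique {R : realType} d1 d2 (T1 : measurableType d1)
    (T2 : measurableType d2) (m1 m2 : {measure set (T1 * T2) -> \bar R}) :
  (m1 setT < +oo)%E ->
  (forall A B, measurable A -> measurable B -> m1 (A `*` B) = m2 (A `*` B)) ->
  forall X, measurable X -> m1 X = m2 X.
Proof.
move=> m1oo m12 X mX.
pose C := [set Z : set (T1 * T2) | exists A B, [/\ measurable A, measurable B & Z = A `*` B]].
apply: (measure_unique C (fun=> setT)) => //.
- rewrite measurable_prod_measurableType; congr (<<s _ >>).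
  apply/seteqP; split=> [_ [A mA [B mB <-]]|_ [A [B [mA mB ->]]]].
    by exists A, B.
  by exists A => //; exists B.
- move=> _ _ [A [B [mA mB ->]]] [A' [B' [mA' mB' ->]]].
  by exists (A `&` A'), (B `&` B'); split; [exact: measurableI..|rewrite setXI].
- by move=> _; exists setT, setT; rewrite setXTT.
- by rewrite bigcup_const.
- by move=> _ [A [B [mA mB ->]]]; exact: m12.
Qed.

(** * Gaussian vectors under plane rotations and sign changes *)

Section GaussianVectors.
Context {R : realType} {d : measure_display} {Omega : measurableType d}.
Variable P : probability Omega R.
Local Notation N := (normal_prob (0 : R) 1).

Lemma random_mx_box k (xi : Omega -> 'cV[R]_k) (B : 'I_k -> set R) (J : pred 'I_k) :
  random_mx xi -> (forall i, measurable (B i)) ->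
  measurable [set w | forall i, J i -> B i (xi w i 0)].
Proof.
move=> rxi mB.
rewrite (_ : mkset _ = \bigcap_(i in [set i | J i]) ((fun w => xi w i 0) @^-1` B i)).
  apply: fin_bigcap_measurable => // i _.
  by rewrite -[X in measurable X]setTI; apply: random_mx_entry.
by apply/seteqP; split.
Qed.

Lemma std_gaussian_box k (xi : Omega -> 'cV[R]_k) (B : 'I_k -> set R) :
  std_gaussian P xi -> (forall i, measurable (B i)) ->
  P [set w | forall i, B i (xi w i 0)] = (\prod_i N (B i))%E.
Proof.
move=> [_ xiN xiI] mB; transitivity (\prod_(i in [set: 'I_k]%SET) N (B i))%E.
  rewrite -(eq_bigr _ (fun i _ => xiN i _ (mB i))) -xiI//; congr (P _).
  by apply/seteqP; split=> w /= h i //; apply: h; rewrite inE.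
by apply: eq_bigl => i; rewrite inE.
Qed.

(** Marginals and subfamilies are full boxes in which the remaining factors are [setT], of
    probability 1. *)
Lemma std_gaussianP k (xi : Omega -> 'cV[R]_k) : random_mx xi ->
  (forall B : 'I_k -> set R, (forall i, measurable (B i)) ->
    P [set w | forall i, B i (xi w i 0)] = (\prod_i N (B i))%E) ->
  std_gaussian P xi.
Proof.
move=> rxi xiB.
have xiJ (J : {set 'I_k}) (B : 'I_k -> set R) : (forall i, measurable (B i)) ->
    P [set w | forall i, i \in J -> B i (xi w i 0)] = (\prod_(i in J) N (B i))%E.
  move=> mB; pose B' i := if i \in J then B i else setT.
  have mB' i : measurable (B' i) by rewrite /B'; case: ifP.
  rewrite (_ : mkset _ = [set w | forall i, B' i (xi w i 0)]).
    rewrite xiB// [RHS]big_mkcond; apply: eq_bigr => i _; rewrite /B'.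
    by case: ifP => // _; rewrite probability_setT.
  apply/seteqP; split=> w /= h i; first by rewrite /B'; case: ifP => [/h|].
  by move=> iJ; have := h i; rewrite /B' iJ.
have xiN i (B : set R) : measurable B -> P [set w | B (xi w i 0)] = N B.
  move=> mB; have := xiJ [set i]%SET (fun=> B) (fun=> mB); rewrite big_set1 => <-.
  congr (P _); apply/seteqP; split=> w /= h; first by move=> j; rewrite inE => /eqP ->.
  by apply: h; rewrite inE.
split=> // J B mB; rewrite xiJ//; apply: eq_bigr => i _; exact/esym/xiN.
Qed.

(** A Givens rotation: [rot2] acting on the coordinates [a] and [b]. *)
Definition rotmx k (a b : 'I_k) (c s : R) : 'M[R]_k := \matrix_(i, j)
  if i == a then c * (j == a)%:R + s * (j == b)%:R
  else if i == b then - s * (j == a)%:R + c * (j == b)%:R else (i == j)%:R.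

Lemma rotmxE k (a b : 'I_k) c s n (M : 'M[R]_(k, n)) i j :
  (rotmx a b c s *m M) i j =
  if i == a then c * M a j + s * M b j
  else if i == b then - s * M a j + c * M b j else M i j.
Proof.
have sumE l : \sum_m (m == l)%:R * M m j = M l j.
  rewrite (bigD1 l)//= eqxx mul1r big1 ?addr0// => m /negbTE ->; exact: mul0r.
rewrite mxE; case: ifPn => ia; last case: ifPn => ib.
- under eq_bigr => l _ do rewrite mxE ia mulrDl -!mulrA.
  by rewrite big_split /= -!mulr_sumr !sumE.
- under eq_bigr => l _ do rewrite mxE (negbTE ia) ib mulrDl -!mulrA.
  by rewrite big_split /= -!mulr_sumr !sumE.
- under eq_bigr => l _ do rewrite mxE (negbTE ia) (negbTE ib) eq_sym.
  exact: sumE.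
Qed.

Lemma rotmx_unitary k (a b : 'I_k) c s : a != b -> c ^+ 2 + s ^+ 2 = 1 ->
  (rotmx a b c s)^T *m rotmx a b c s = 1%:M.
Proof.
move=> ab cs; apply: mulmx1C; apply/matrixP => i j.
have ba : (b == a) = false by rewrite eq_sym (negbTE ab).
rewrite rotmxE !mxE !eqxx (negbTE ab) ba (eq_sym i j).
have [->|ia] := eqVneq i a; last have [->|ib] := eqVneq i b.
- have [ja|ja] := boolP (j == a); first by transitivity (c ^+ 2 + s ^+ 2) => /=; [ring | exact: cs].
  by have [jb|jb] := boolP (j == b) => /=; ring.
- have [/eqP ja|ja] := boolP (j == a); first by rewrite ja (negbTE ab) /=; ring.
  have [jb|jb] := boolP (j == b) => /=; last by ring.
  by transitivity (c ^+ 2 + s ^+ 2); [ring | exact: cs].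
- have [/eqP ja|ja] := boolP (j == a); first by rewrite ja (eq_sym a i) (negbTE ia) /=; ring.
  have [/eqP jb|//] := boolP (j == b) => /=.
  by rewrite jb (eq_sym b i) (negbTE ib) /=; ring.
Qed.

(** With the event [D] on the other coordinates fixed, the restricted law of coordinates [a] and [b]
    is [p] times the product of two normal laws: this holds on rectangles, hence on all Borel sets.
    The rotated rectangle [E] is such a set, and [gauss2_rot] turns it back. *)
Lemma std_gaussian_rot k (a b : 'I_k) c s (xi : Omega -> 'cV[R]_k) :
  a != b -> c ^+ 2 + s ^+ 2 = 1 -> s != 0 -> std_gaussian P xi ->
  std_gaussian P (fun w => rotmx a b c s *m xi w).
Proof.
move=> ab cs s0 gxi; have [rxi _ _] := gxi.
apply: std_gaussianP => [|B mB]; first by apply: random_mxM => //; exact: random_mx_cst.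
have ba : (b == a) = false by rewrite eq_sym (negbTE ab).
pose rest i := (i != a) && (i != b).
pose D := [set w | forall i, rest i -> B i (xi w i 0)].
have mD : measurable D by exact: random_mx_box.
pose pr w := (xi w a 0, xi w b 0).
have mpr : measurable_fun setT pr by apply: measurable_fun_pair; exact: random_mx_entry.
have gbox A C : measurable A -> measurable C ->
    P ([set w | A (xi w a 0) /\ C (xi w b 0)] `&` D) =
    (N A * N C * \prod_(i | rest i) N (B i))%E.
  move=> mA mC; pose B' i := if i == a then A else if i == b then C else B i.
  have mB' i : measurable (B' i) by rewrite /B'; case: ifP => // _; case: ifP.
  transitivity (P [set w | forall i, B' i (xi w i 0)]).
    congr (P _); apply/seteqP; split=> w /=.
      move=> [[Aa Cb] Dw] i; rewrite /B'; have [->//|ia] := eqVneq i a.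
      by have [->//|ib] := eqVneq i b; apply: Dw; rewrite /rest ia ib.
    move=> h; split; first by have := h a; have := h b; rewrite /B' eqxx ba eqxx.
    by move=> i /andP[ia ib]; have := h i; rewrite /B' (negbTE ia) (negbTE ib).
  rewrite (std_gaussian_box gxi mB') (bigD1 a)//= (bigD1 b)/=; last by rewrite ba.
  rewrite muleA /B' eqxx ba eqxx; congr (_ * _)%E; apply: eq_bigr => i /andP[ia ib].
  by rewrite (negbTE ia) (negbTE ib).
pose p := (\prod_(i | rest i) N (B i))%E.
have p0 : (0 <= p)%E by apply: prode_ge0 => i _; exact: measure_ge0.
have pfin : p \is a fin_num.
  by apply: prode_fin_num => i _; apply: fin_num_measure; exact: mB.
have fp0 : 0 <= fine p by rewrite fine_ge0.
have m12 E : measurable E -> P (pr @^-1` E `&` D) = (p * (N \x N)%E E)%E.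
  move=> mE.
  transitivity (pushforward (mrestr P mD)
    (pr : _ -> measurableTypeR R * measurableTypeR R) E) => //.
  transitivity (mscale (NngNum fp0) (N \x N)%E E); last by rewrite /mscale /= fineK.
  apply: rectangle_measure_unique => // [|A C mA mC].
    rewrite /= /pushforward /mrestr setTI -ge0_fin_numE//; exact: fin_num_measure.
  rewrite /= /pushforward /mrestr /mscale /= product_measure1E// fineK// muleC -gbox//.
pose E := rot2 c s @^-1` (B a `*` B b).
have mE : measurable E.
  rewrite -[X in measurable X]setTI; apply: measurable_rot2 => //; exact: measurableX.
transitivity (P (pr @^-1` E `&` D)).
  congr (P _); apply/seteqP; split=> w /=.
    move=> h; split; first split.
    - by have := h a; rewrite rotmxE eqxx.
    - by have := h b; rewrite rotmxE eqxx ba.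
    - by move=> i /andP[ia ib]; have := h i; rewrite rotmxE (negbTE ia) (negbTE ib).
  move=> [[/= Ea Eb] Dw] i; rewrite rotmxE.
  have [->//|ia] := eqVneq i a; have [->//|ib] := eqVneq i b.
  by apply: Dw; rewrite /rest ia ib.
rewrite m12// gauss2_rot//; last exact: measurableX.
have -> : (N \x N)%E (B a `*` B b) = (N (B a) * N (B b))%E.
  exact: (@product_measure1E _ _ (measurableTypeR R) (measurableTypeR R) R N N _ _ (mB a) (mB b)).
rewrite (bigD1 a)//= [in RHS](bigD1 b)/=; last by rewrite ba.
by rewrite muleC muleA.
Qed.

Definition flipmx k (a : 'I_k) : 'M[R]_k :=
  \matrix_(i, j) (if i == a then - (j == a)%:R else (i == j)%:R).

Lemma flipmxE k (a : 'I_k) n (M : 'M[R]_(k, n)) i j :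
  (flipmx a *m M) i j = if i == a then - M a j else M i j.
Proof.
have sumE l : \sum_m (m == l)%:R * M m j = M l j.
  rewrite (bigD1 l)//= eqxx mul1r big1 ?addr0// => m /negbTE ->; exact: mul0r.
rewrite mxE; case: ifPn => ia.
  by under eq_bigr => l _ do rewrite mxE ia mulNr; rewrite sumrN sumE.
by under eq_bigr => l _ do rewrite mxE (negbTE ia) eq_sym; exact: sumE.
Qed.

Lemma flipmx_unitary k (a : 'I_k) : (flipmx a)^T *m flipmx a = 1%:M.
Proof.
apply: mulmx1C; apply/matrixP => i j; rewrite flipmxE !mxE eqxx (eq_sym i j).
have [->|ia] := eqVneq i a.
  by have [ja|ja] := boolP (j == a) => /=; rewrite ?eqxx ?opprK ?oppr0.
by have [/eqP ja|//] := boolP (j == a); rewrite ja (eq_sym a i) (negbTE ia) oppr0.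
Qed.

Lemma std_gaussian_flip k (a : 'I_k) (xi : Omega -> 'cV[R]_k) :
  std_gaussian P xi -> std_gaussian P (fun w => flipmx a *m xi w).
Proof.
move=> gxi; have [rxi _ _] := gxi.
apply: std_gaussianP => [|B mB]; first by apply: random_mxM => //; exact: random_mx_cst.
pose B' i := if i == a then [set x | B a (- x)] else B i.
have mBa : measurable [set x : R | B a (- x)].
  have mo : measurable_fun setT (fun x : R => - x) by exact: measurable_funN.
  by rewrite -[X in measurable X]setTI; exact: (mo measurableT _ (mB a)).
transitivity (P [set w | forall i, B' i (xi w i 0)]).
  congr (P _); apply/seteqP; split=> w /= h i; have := h i; rewrite flipmxE /B'.
    by have [->|] := eqVneq i a.
  by have [->|] := eqVneq i a.
rewrite (std_gaussian_box gxi); last by move=> i; rewrite /B'; case: ifP.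
by apply: eq_bigr => i _; rewrite /B'; have [->|//] := eqVneq i a; rewrite normal_opp.
Qed.

End GaussianVectors.

(** * Gaussian vectors under matrices with orthonormal rows *)

Section GaussianUnitary.
Context {R : realType} {d : measure_display} {Omega : measurableType d}.
Variable P : probability Omega R.
Local Notation N := (normal_prob (0 : R) 1).

Let good m k (A : 'M[R]_(m, k)) := forall xi : Omega -> 'cV[R]_k,
  std_gaussian P xi -> std_gaussian P (fun w => A *m xi w).

(** Since [A = (A *m U^T) *m U], elementary isometries can be peeled off on the right until only a
    selection of coordinates is left. *)
Let good_step m k (A : 'M[R]_(m, k)) (U : 'M[R]_k) :
  U^T *m U = 1%:M -> good U -> good (A *m U^T) -> good A.
Proof.
move=> UU gU gA xi gxi; rewrite (_ : (fun w => _) = fun w => A *m U^T *m (U *m xi w)).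
  by apply: gA; exact: gU.
by apply/funext => w; rewrite mulmxA -(mulmxA A) UU mulmx1.
Qed.

Let unitary_step m k (A : 'M[R]_(m, k)) (U : 'M[R]_k) :
  U^T *m U = 1%:M -> A *m A^T = 1%:M -> (A *m U^T) *m (A *m U^T)^T = 1%:M.
Proof. by move=> UU AA; rewrite trmx_mul trmxK mulmxA -(mulmxA A) UU mulmx1. Qed.

Let good_selection m k (A : 'M[R]_(m, k)) (f : 'I_m -> 'I_k) :
  A *m A^T = 1%:M -> (forall i j, A i j = (j == f i)%:R) -> good A.
Proof.
move=> AA Af xi gxi; have [rxi _ _] := gxi.
have AE i w : (A *m xi w) i 0 = xi w (f i) 0.
  rewrite mxE (bigD1 (f i))//= Af eqxx mul1r big1 ?addr0// => j /negbTE jf.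
  by rewrite Af jf mul0r.
have finj : injective f.
  move=> i i' fii; have /matrixP /(_ i i') := AA; rewrite !mxE (bigD1 (f i))//=.
  rewrite big1 => [|j /negbTE jf]; last by rewrite Af jf mul0r.
  rewrite mxE !Af -fii eqxx mulr1 addr0; have [//|_] := eqVneq i i'.
  by move=> /eqP; rewrite oner_eq0.
apply: std_gaussianP => [|B mB]; first by apply: random_mxM => //; exact: random_mx_cst.
(* The box is pulled back along the injection [f]; coordinates outside its image are unconstrained
   and contribute the factor 1. *)
pose C j := if [pick i | f i == j] is Some i then B i else setT.
have Cf i : C (f i) = B i.
  by rewrite /C; case: pickP => [i' /eqP /finj ->//|/(_ i)]; rewrite eqxx.
transitivity (P [set w | forall j, C j (xi w j 0)]).
  congr (P _); apply/seteqP; split=> w /= h.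
    move=> j; rewrite /C; case: pickP => // i /eqP <-.
    by have := h i; rewrite AE.
  by move=> i; rewrite AE -Cf; exact: h.
rewrite (std_gaussian_box gxi); last by move=> j; rewrite /C; case: pickP.
rewrite (bigID (mem (f @: 'I_m)))/= [X in (_ * X)%E]big1 => [|j jf]; last first.
  rewrite /C; case: pickP => [i /eqP fij|_]; last exact: probability_setT.
  by rewrite -fij imset_f in jf.
rewrite mule1 big_imset/=; last by move=> i i' _ _; exact: finj.
by apply: eq_bigr => i _; rewrite Cf.
Qed.

(* Rotations of pairs of columns turn the row [r0] into a basis vector; they do not touch
   the pivots of the previous rows, where [A r0] vanishes by orthogonality. *)
Let pivot_row m k (f : 'I_m -> 'I_k) (r0 : 'I_m) n (A : 'M[R]_(m, k)) :
  A *m A^T = 1%:M ->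
  (forall (i : 'I_m) (j : 'I_k), (i < r0)%N -> A i j = (j == f i)%:R) ->
  (#|[set j | A r0 j != 0%R]%SET| <= n)%N ->
  (forall (A' : 'M[R]_(m, k)) a, A' *m A'^T = 1%:M ->
    (forall (i : 'I_m) (j : 'I_k), (i < r0)%N -> A' i j = (j == f i)%:R) ->
    (forall j, A' r0 j = (j == a)%:R) -> good A') ->
  good A.
Proof.
elim: n A => [|n IH] A AA Af cA gA'.
  have /matrixP /(_ r0 r0) := AA; rewrite !mxE eqxx big1 => [/eqP|j _].
    by rewrite eq_sym oner_eq0.
  move: cA; rewrite leqn0 cards_eq0 => /eqP /setP /(_ j); rewrite !inE => /negbFE /eqP ->.
  by rewrite mul0r.
have Ar0f (i : 'I_m) : (i < r0)%N -> A r0 (f i) = 0.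
  move=> ir; have /matrixP /(_ i r0) := AA; rewrite !mxE.
  rewrite (bigD1 (f i))//= big1 => [|j /negbTE jf]; last by rewrite Af// jf mul0r.
  by rewrite Af// eqxx mul1r addr0 mxE => ->; have [ir0|//] := eqVneq i r0; rewrite ir0 ltnn in ir.
have r0norm : \sum_j A r0 j ^+ 2 = 1.
  transitivity ((A *m A^T) r0 r0); last by rewrite AA mxE eqxx.
  rewrite mxE.
  by apply: eq_bigr => j _; rewrite mxE expr2.
have [a Aa] : exists a, A r0 a != 0.
  apply/existsP; apply: contraTT isT => /existsPn A0; move/eqP: r0norm.
  rewrite big1 => [|j _]; first by rewrite eq_sym oner_eq0.
  by have := A0 j; rewrite negbK => /eqP ->; rewrite expr0n.
(* With two nonzero entries, the rotation collects their norm [rho] in column [a] and cancels column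
   [b], so the number of nonzero entries drops. *)
have [/existsP[b /andP[ba Ab]]|/existsPn A0] := boolP [exists b, (b != a) && (A r0 b != 0)].
  pose rho := Num.sqrt (A r0 a ^+ 2 + A r0 b ^+ 2).
  have rho2 : rho ^+ 2 = A r0 a ^+ 2 + A r0 b ^+ 2.
    by rewrite sqr_sqrtr// addr_ge0 ?sqr_ge0.
  have rho0 : rho != 0.
    by rewrite -sqrf_eq0 rho2 paddr_eq0 ?sqr_ge0// !sqrf_eq0 negb_and Aa.
  pose c := A r0 a / rho; pose s := A r0 b / rho.
  have cs : c ^+ 2 + s ^+ 2 = 1 by rewrite !expr_div_n -mulrDl -rho2 divff// sqrf_eq0.
  have s0 : s != 0 by rewrite mulf_neq0 ?invr_eq0.
  have ab : a != b by rewrite eq_sym.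
  have UU := rotmx_unitary ab cs.
  have AUE i j : (A *m (rotmx a b c s)^T) i j =
      if j == a then c * A i a + s * A i b
      else if j == b then - s * A i a + c * A i b else A i j.
    by rewrite -{1}[A]trmxK -trmx_mul mxE rotmxE !mxE.
  apply: (good_step UU); first by move=> xi; exact: std_gaussian_rot.
  apply: IH gA'; first exact: unitary_step.
    move=> i j ir; rewrite AUE Af//.
    have fia : (a == f i) = false.
      by apply/eqP => fia; rewrite fia Ar0f// eqxx in Aa.
    have fib : (b == f i) = false.
      by apply/eqP => fib; rewrite fib Ar0f// eqxx in Ab.
    rewrite !Af// fia fib !mulr0 addr0.
    by have [->|_] := eqVneq j a; [rewrite fia | have [->|//] := eqVneq j b; rewrite fib].
  rewrite -ltnS; apply: leq_trans cA; apply: proper_card; apply/properP; split.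
    apply/fintype.subsetP => j; rewrite !inE AUE.
    by have [->|_] := eqVneq j a => //; have [->|] := eqVneq j b.
  exists b; rewrite !inE// AUE (negbTE ba) eqxx negbK /c /s; apply/eqP.
  by field.
have {}A0 j : j != a -> A r0 j = 0.
  by move=> ja; have := A0 j; rewrite ja /= negbK => /eqP.
(* A single nonzero entry remains, equal to 1 or -1; in the second case no column is left to rotate
   with, and a sign change is used. *)
have : A r0 a ^+ 2 == 1 ^+ 2.
  rewrite expr1n -r0norm (bigD1 a)//= big1 ?addr0// => j ja.
  by rewrite A0// expr0n.
rewrite eqf_sqr => /orP[] /eqP Aa1.
  by apply: (gA' A a) => // j; have [->//|ja] := eqVneq j a; rewrite A0.
have UU := @flipmx_unitary R k a.
have AUE i j : (A *m (flipmx a)^T) i j = if j == a then - A i a else A i j.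
  by rewrite -{1}[A]trmxK -trmx_mul mxE flipmxE !mxE.
apply: (good_step UU); first by move=> xi; exact: std_gaussian_flip.
apply: (gA' _ a); first exact: unitary_step.
  move=> i j ir; rewrite AUE !Af//.
  have fia : (a == f i) = false.
    by apply/eqP => fia; rewrite fia Ar0f// eqxx in Aa.
  by have [->|_ //] := eqVneq j a; rewrite fia oppr0.
move=> j; rewrite AUE; have [_|ja] := eqVneq j a; first by rewrite Aa1 opprK.
exact: A0.
Qed.

Lemma std_gaussian_unitary m k (A : 'M[R]_(m, k)) (xi : Omega -> 'cV[R]_k) :
  A *m A^T = 1%:M -> std_gaussian P xi -> std_gaussian P (fun w => A *m xi w).
Proof.
move=> AA; move: xi.
suff H n : forall (A : 'M[R]_(m, k)) (f : 'I_m -> 'I_k) r, A *m A^T = 1%:M ->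
    (m - r <= n)%N ->
    (forall (i : 'I_m) (j : 'I_k), (i < r)%N -> A i j = (j == f i)%:R) -> good A.
  (* The initial pivot map is a dummy but must take values in ['I_k], so [k = 0] is apart;
     orthonormality then forces [m = 0]. *)
  case: k A AA H => [|k] A AA H; last by apply: (H m A (fun=> 0) 0%N) => //; rewrite subn0.
  move=> xi gxi; apply: std_gaussianP => [|B mB].
    by apply: random_mxM; [exact: random_mx_cst | case: gxi].
  case: m A AA H B mB => [|m] A AA _ B mB.
    by rewrite big_ord0 -[RHS](@probability_setT _ _ _ P); congr (P _);
      apply/seteqP; split => // w _ [].
  have /matrixP /(_ 0 0) := AA; rewrite !mxE big_ord0 eqxx => /eqP.
  by rewrite eq_sym oner_eq0.
elim: n => [|n IH] {AA}A f r AA mrn Af.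
  apply: (good_selection AA) => i j; apply: Af.
  by move: mrn; rewrite leqn0 subn_eq0; apply: leq_trans.
have [rm|mr] := ltnP r m; last first.
  by apply: (good_selection AA) => i j; apply: Af; apply: leq_trans mr.
apply: (@pivot_row m k f (Ordinal rm) _ A AA Af (leqnn _)) => A' a AA' Af' Ara.
apply: (IH A' (fun i => if i == Ordinal rm then a else f i) r.+1 AA').
  by rewrite subnS -ltnS; case: (m - r)%N mrn.
move=> i j; rewrite ltnS leq_eqVlt => /orP[/eqP ir|ir].
  have -> : i = Ordinal rm by exact: val_inj.
  by rewrite eqxx Ara.
have [ii|_] := eqVneq i (Ordinal rm); first by rewrite ii ltnn in ir.
exact: Af'.
Qed.

End GaussianUnitary.

(** * Mixtures of isometric images of a Gaussian vector *)

Section GaussianLaw.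
Context {R : realType}.

(** Boxes form a pi-system and generate the Borel sets, as entries determine measurability
    ([random_mxP] for the identity); on boxes [std_gaussian_box] fixes the value. *)
Lemma std_gaussian_same_law k d1 (Omega1 : measurableType d1) (P1 : probability Omega1 R)
    d2 (Omega2 : measurableType d2) (P2 : probability Omega2 R)
    (X1 : Omega1 -> 'cV[R]_k) (X2 : Omega2 -> 'cV[R]_k) :
  std_gaussian P1 X1 -> std_gaussian P2 X2 -> same_law P1 P2 X1 X2.
Proof.
move=> g1 g2; have [[r1 _ _] [r2 _ _]] := (g1, g2).
pose C := [set Z : set 'cV[R]_k | exists B : 'I_k -> set R,
  (forall i, measurable (B i)) /\ Z = [set x | forall i, B i (x i 0)]].
have CE : @measurable _ (borelM R k 1) = <<s C >>.
  apply/seteqP; split.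
    have : random_mx (id : g_sigma_algebraType C -> 'cV[R]_k).
      apply: random_mxP => i j; rewrite ord1 => _ B mB; rewrite setTI.
      apply: sub_sigma_algebra; exists (fun l => if l == i then B else setT); split.
        by move=> l; case: ifP.
      apply/seteqP; split=> x /= h; first by move=> l; have [->|] := eqVneq l i.
      by have := h i; rewrite eqxx.
    by move=> h B mB; have := h B mB; rewrite preimage_id.
  apply: smallest_sub; first exact: sigma_algebra_measurable.
  move=> _ [B [mB ->]].
  have := @random_mx_box R _ (borelM R k 1) k id B xpredT (@random_mx_id R k 1) mB.
  by congr measurable; apply/seteqP; split=> x /= h; [move=> i; exact: h | move=> i _; exact: h].
move=> B mB.
have m1 := random_mx_fun r1; have m2 := random_mx_fun r2.
transitivity (pushforward P1 (X1 : _ -> borelM R k 1) B) => //.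
transitivity (pushforward P2 (X2 : _ -> borelM R k 1) B) => //.
apply: (@measure_unique _ R (borelM R k 1) C (fun=> setT)) => //.
- move=> _ _ [B1 [mB1 ->]] [B2 [mB2 ->]]; exists (fun i => B1 i `&` B2 i).
  split; first by move=> i; exact: measurableI.
  by apply/seteqP; split=> x /=; [move=> [h1 h2] i | move=> h; split=> i; case: (h i)].
- by move=> _; exists (fun=> setT); split=> //; apply/seteqP; split.
- by rewrite bigcup_const.
- by move=> _ [B' [mB' ->]]; rewrite /= /pushforward /= !std_gaussian_box.
- by move=> _; rewrite /= /pushforward preimage_setT probability_setT ltry.
Qed.

Context {d : measure_display} {Omega : measurableType d} (GG : set_system Omega).
Context {d' : measure_display} {Omega' : measurableType d'}.
Variables (P' : probability Omega' R) (proj : Omega' -> Omega).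
Hypothesis sGG : sigma_algebra setT GG.
Hypothesis mproj : forall A, GG A -> measurable (proj @^-1` A).

(** [Omega] with [GG] as its sigma-field, so that [GG]-measurability is ordinary measurability. *)
Local Notation T1 := (g_sigma_algebraType GG).

Let mT1 A : @measurable _ T1 A -> GG A.
Proof. by apply: smallest_sub. Qed.

Variables (k : nat) (zeta : Omega' -> 'cV[R]_k).
Hypothesis gzeta : std_gaussian P' zeta.
Hypothesis zetaI : indep_sigma P' (sigma_mx zeta) (preimage_set_system setT proj GG).
Variables (m : nat) (W : Omega -> 'M[R]_(m, k)).
Hypothesis mW : random_mx (W : T1 -> _).
Hypothesis WW : forall w, W w *m (W w)^T = 1%:M.

Let xi w := W (proj w) *m zeta w.

Let mproj1 : measurable_fun setT (proj : Omega' -> T1).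
Proof. by move=> _ A mA; rewrite setTI; apply/mproj/mT1. Qed.

Let h w : T1 * borelM R k 1 := (proj w, zeta w).

Let mh : measurable_fun setT h.
Proof.
apply: measurable_fun_pair; first exact: mproj1.
by apply: random_mx_fun; case: gzeta.
Qed.

Let rW2 : random_mx (fun z : T1 * borelM R k 1 => W z.1 *m (z.2 : 'cV[R]_k)).
Proof.
apply: random_mxM => B BB.
  rewrite -[X in measurable X]setTI.
  exact: (@measurable_fst _ _ T1 (borelM R k 1) measurableT _ (mW BB)).
rewrite -[X in measurable X]setTI.
exact: (@measurable_snd _ _ T1 (borelM R k 1) measurableT _ BB).
Qed.

Lemma random_gaussian_mixture : random_mx xi.
Proof.
by move=> B BB; rewrite -[X in measurable X]setTI; exact: (mh measurableT (rW2 BB)).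
Qed.

(* Conditionally on [proj], the vector [xi] is the image of a standard Gaussian vector
   under a fixed isometry, so its conditional law does not depend on [proj]. *)
Lemma gaussian_mixture_indep B C w0 : borel_mx B -> GG C ->
  P' (xi @^-1` B `&` proj @^-1` C) =
  (P' [set w | B (W w0 *m zeta w)] * P' (proj @^-1` C))%E.
Proof.
move=> BB CC.
pose E : set (T1 * borelM R k 1) := [set z | B (W z.1 *m (z.2 : 'cV[R]_k))] `&` (C `*` setT).
have mC : @measurable _ T1 C by exact: sub_sigma_algebra.
have mE : measurable E by apply: measurableI; [exact: rW2 | exact: measurableX].
have rzeta : random_mx zeta by case: gzeta.
have mz := random_mx_fun rzeta.
pose X1 : {mfun Omega' >-> T1} := mfun_Sub (mem_set mproj1).
pose X2 : {mfun Omega' >-> borelM R k 1} := mfun_Sub (mem_set mz).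
pose m1 : probability T1 R := distribution P' X1.
pose m2 : probability (borelM R k 1) R := distribution P' X2.
transitivity (pushforward P' h E).
  by congr (P' _); apply/seteqP; split=> w /=; [move=> [? ?] | move=> [? [? ?]]].
(* By independence the pair has a product law; integrating over [proj] last leaves sections in which
   [W] is a constant matrix. *)
transitivity ((m1 \x m2)%E E).
  apply/esym. apply: (@product_measure_unique _ _ T1 (borelM R k 1) R m1 m2) => // => A D mA mD.
  have [GA BD] := (mT1 mA, mD : borel_mx D).
  rewrite [LHS](_ : _ = P' (zeta @^-1` D `&` proj @^-1` A)); last first.
    by congr (P' _); apply/seteqP; split=> w /= [].
  rewrite (zetaI (a := zeta @^-1` D) (b := proj @^-1` A)).
  - exact: muleC.
  - by exists D; rewrite ?setTI.
  - by exists A; rewrite ?setTI.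
set g := P' _.
transitivity (\int[m1]_x (g * (\1_C x)%:E))%E.
  apply: eq_integral => x _ /=; rewrite indicE.
  have [xC|xC] := boolP (x \in C).
    rewrite mule1; transitivity (P' [set w | B (W x *m zeta w)]).
      congr (P' _); apply/seteqP; split=> w; rewrite /= /xsection /= inE.
        by move=> [].
      by move=> BW; split=> //; split=> //; rewrite inE in xC.
    by apply: (std_gaussian_same_law _ _ BB); exact: std_gaussian_unitary.
  rewrite mule0 (_ : xsection E x = set0); first exact: measure0.
  apply/seteqP; split=> // z; rewrite /= /xsection /= inE => -[_ [/= xC' _]].
  by rewrite mem_set in xC.
rewrite ge0_integralZl//; first by rewrite integral_indic// setIT.
  by apply/measurable_EFinP; exact: measurable_indic.
exact: measure_ge0.
Qed.

Lemma gaussian_mixture_std : std_gaussian P' xi.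
Proof.
have gW w0 : std_gaussian P' (fun w => W w0 *m zeta w) by exact: std_gaussian_unitary.
have GT : GG setT by case: sGG => G0 GC _; rewrite -[setT]setD0; exact: GC.
have law B w0 : borel_mx B -> P' (xi @^-1` B) = P' [set w | B (W w0 *m zeta w)].
  move=> BB; have := gaussian_mixture_indep w0 BB GT.
  by rewrite preimage_setT setIT probability_setT mule1.
apply: std_gaussianP => [|B mB]; first exact: random_gaussian_mixture.
have BB : borel_mx [set x : 'cV[R]_m | forall i, B i (x i 0)].
  have := @random_mx_box R _ (borelM R m 1) m id B xpredT (@random_mx_id R m 1) mB.
  by congr measurable; apply/seteqP; split=> x /= h'; [move=> i; exact: h' | move=> i _; exact: h'].
by have := law _ point BB; rewrite -(std_gaussian_box (gW point) mB).
Qed.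

Lemma gaussian_mixture_indep_sigma :
  indep_sigma P' (sigma_mx xi) (preimage_set_system setT proj GG).
Proof.
move=> _ _ [B BB <-] [C CC <-]; rewrite !setTI (gaussian_mixture_indep point BB CC).
congr (_ * _)%E; apply/esym.
apply: (std_gaussian_same_law gaussian_mixture_std _ BB); exact: std_gaussian_unitary.
Qed.

End GaussianLaw.

(** * The penalized estimator *)

Section PowerIncrements.
Context {R : realType}.

Lemma powR_anti (a x y : R) : a <= 0 -> 0 < x -> x <= y -> y `^ a <= x `^ a.
Proof.
move=> a0 x0 xy; rewrite -[a]opprK !(powRN _ (- a)) lef_pV2 ?posrE ?powR_gt0//.
  by apply: ge0_ler_powR; rewrite ?oppr_ge0// nnegrE ltW// (lt_le_trans x0).
exact: lt_le_trans xy.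
Qed.

(** The slope is that of the chord from 0 to [x], above which the concave power lies on [[0, x]];
    for [y > x] the left side is not positive. Only [x] has to stay away from 0. *)
Lemma powR_sub_le (q x y : R) : 0 < q -> q <= 1 -> 0 < x -> 0 <= y ->
  x `^ q - y `^ q <= x `^ (q - 1) * `|x - y|.
Proof.
move=> q0 q1 x0 y0; have [yx|xy] := leP y x; last first.
  rewrite (@le_trans _ _ 0)// ?mulr_ge0 ?powR_ge0// subr_le0.
  by apply: ge0_ler_powR; rewrite ?nnegrE// ltW.
rewrite ger0_norm ?subr_ge0// mulrBr (mulrC _ x) mulr_powRB1 ?(ltW x0)// lerD2l lerN2.
have [->|yn0] := eqVneq y 0; first by rewrite mulr0 powR_ge0.
have y0' : 0 < y by rewrite lt_def yn0.
rewrite -(mulr_powRB1 y0 q0) mulrC ler_pM2l//.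
by apply: powR_anti => //; rewrite subr_le0.
Qed.

End PowerIncrements.

(** * The deterministic estimate on one sample *)

Section Deterministic.
Context {R : realType} (p0 p1 : nat).
Local Notation n := (p0 + p1)%N.
Local Notation nn := ((p0 + p1)%:R : R).

Lemma qform_le (A : 'M[R]_n) (x : 'cV[R]_n) : `|qform A x| <= nn ^+ 2 * `|A| * `|x| ^+ 2.
Proof.
rewrite qformE (le_trans (dotc_le _ _))//.
have -> : nn ^+ 2 * `|A| * `|x| ^+ 2 = nn * `|x| * (nn * `|A| * `|x|) by ring.
by rewrite ler_wpM2l ?mx_norm_mul// mulr_ge0.
Qed.

(* This is [0 <= qform A (x - c^-1 *: invmx A *m x)] for [c = nn ^+ 2 * M + 1]. *)
Lemma qform_coercive (A : 'M[R]_n) (M : R) (x : 'cV[R]_n) : sym_posdef A -> `|invmx A| <= M ->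
  `|x| ^+ 2 / (nn ^+ 2 * M + 1) <= qform A x.
Proof.
move=> Ap iM; set c := _ + 1.
have M0 : 0 <= M by apply: le_trans iM.
have c0 : 0 < c by rewrite ltr_wpDl// mulr_ge0// sqr_ge0.
have Au := posdef_unit Ap; have [As A0] := posdef_psd Ap.
pose H := invmx A; have Hs : H^T = H by have [] := posdef_inv Ap.
have := A0 (x + - c^-1 *: (H *m x)).
rewrite qformD// dotcZl qformZ (dotc_mull H) Hs /H mulmxA mulVmx// mul1mx.
have -> : qform A (invmx A *m x) = qform (invmx A) x.
  by rewrite !qformE mulmxA mulmxV// mul1mx dotcC.
have Hx : qform (invmx A) x <= c * dotc x x.
  rewrite (le_trans (ler_norm _))// (le_trans (qform_le _ _))//.
  rewrite (@le_trans _ _ (nn ^+ 2 * M * `|x| ^+ 2))//.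
    by rewrite ler_wpM2r ?sqr_ge0// ler_wpM2l ?sqr_ge0.
  by rewrite ler_pM ?sqr_ge0 ?mulr_ge0 ?sqr_ge0// ?dotcxx_norm// lerDl.
have xx := dotcxx_norm x.
move=> h; have h2 : (- c^-1) ^+ 2 * qform (invmx A) x <= c^-1 * dotc x x.
  rewrite sqrrN (le_trans (ler_wpM2l (sqr_ge0 _) Hx))//.
  by rewrite le_eqVlt; apply/orP; left; apply/eqP; field; rewrite gt_eqF.
rewrite (@le_trans _ _ (c^-1 * dotc x x))//.
  by rewrite mulrC ler_wpM2l// invr_ge0 ltW.
lra.
Qed.

Variables (q : R) (q_gt0 : 0 < q) (q_le1 : q <= 1).
Variables (ths : 'cV[R]_n).
Hypothesis ths_neq0 : forall j : 'I_p0, ths (lshift p1 j) 0 != 0.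
Hypothesis ths_eq0 : forall j : 'I_p1, ths (rshift p0 j) 0 = 0.

(* A bound for the derivatives of [|x|^q] at distance at least [|ths_j| / 2] of 0. *)
Let L : R := \sum_(j < p0) (`|ths (lshift p1 j) 0| / 2) `^ (q - 1).

Let L_ge0 : 0 <= L.
Proof. by apply: sumr_ge0 => j _; exact: powR_ge0. Qed.

Let half_gt0 (j : 'I_p0) : 0 < `|ths (lshift p1 j) 0| / 2.
Proof. by rewrite divr_gt0// normr_gt0. Qed.

Let pow_le_L (j : 'I_p0) (x : R) : `|ths (lshift p1 j) 0| / 2 <= x -> x `^ (q - 1) <= L.
Proof.
move=> hx; rewrite (@le_trans _ _ ((`|ths (lshift p1 j) 0| / 2) `^ (q - 1)))//.
  by apply: powR_anti => //; rewrite subr_le0.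
by rewrite /L (bigD1 j)//= lerDl sumr_ge0// => i _; exact: powR_ge0.
Qed.

Let usub_le k (x : 'M[R]_(p0 + p1, k)) : `|usubmx x| <= `|x|.
Proof. by apply: mx_norm_leP => // i j; rewrite mxE mx_entry_le. Qed.

Let dsub_le k (x : 'M[R]_(p0 + p1, k)) : `|dsubmx x| <= `|x|.
Proof. by apply: mx_norm_leP => // i j; rewrite mxE mx_entry_le. Qed.

Let col_le k (x : 'M[R]_(p0, k)) (y : 'M[R]_(p1, k)) (a : R) :
  `|x| <= a -> `|y| <= a -> `|col_mx x y| <= a.
Proof.
move=> xa ya; apply: mx_norm_leP => [|i j]; first exact: le_trans xa.
case: (split_ordP i) => l ->; rewrite ?col_mxEu ?col_mxEd;
  exact: le_trans (mx_entry_le _ _ _) _.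
Qed.

Section OneSample.
Variables (M e delta eta B : R).
Hypothesis M_ge0 : 0 <= M.
Hypotheses (delta_ge0 : 0 <= delta) (eta_gt0 : 0 < eta).

(* [lam] bounds the eigenvalues of [Gh] from below, [U] bounds the rescaled error of the
   estimator, and [sb] bounds [G_11^-1 *m G_10 *m ut_0]. *)
Let c := nn ^+ 2 * M + 1.
Let lam := (2 * c)^-1.
Let C1 := nn ^+ 2 * (M + 1) * M ^+ 2.
Let U := 1 + (C1 + M + 1) / lam + M.
Let sb := c * (nn ^+ 2 * M ^+ 2).

(** In order: [delta_le1] bounds [Gh] by [M + 1], [delta_lam] lets [Gh] keep half the coercivity of
    [G], [delta_L] bounds the gain in J^1 penalty by the norm of [u], [B_ge] excludes a J^0
    component above [eta], and [e_ge] collects the errors of the last comparison. *)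
Hypotheses (delta_le1 : delta <= 1) (delta_lam : nn ^+ 2 * delta <= lam).
Hypothesis (delta_L : nn * delta * L <= 1).
Hypothesis (B_ge : C1 + U <= B * eta `^ q) (B_gt0 : 0 < B).
Hypothesis (e_ge : nn * delta * L + 2 * nn * (nn * delta * (sb + U + M) + nn * M * eta) <= lam * e).

Variables (r : R) (tht thh : 'cV[R]_n) (G Gh : 'M[R]_n) (kap : 'I_n -> R).
Hypothesis r_gt0 : 0 < r.
Hypothesis (kap_ge0 : forall j, 0 <= kap j).
Hypothesis (Gh_sym : Gh^T = Gh) (Gp : sym_posdef G).
Hypothesis (G_M : `|G| <= M) (iG_M : `|invmx G| <= M) (GhG : `|Gh - G| <= delta).
Hypothesis ut_M : `|r^-1 *: (tht - ths)| <= M.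
Hypothesis r_small : forall j : 'I_p0, r * (M + sb) <= `|ths (lshift p1 j) 0| / 2.
Hypothesis kap_small : forall j : 'I_p0, kap (lshift p1 j) <= delta * r.
Hypothesis kap_large : forall j : 'I_p1, B <= r `^ (- (2 - q)) * kap (rshift p0 j).
Hypothesis thh_min : forall th, QLSA q Gh tht kap thh <= QLSA q Gh tht kap th.

Let u : 'cV[R]_n := r^-1 *: (thh - ths).
Let ut : 'cV[R]_n := r^-1 *: (tht - ths).
Let D (y : 'cV[R]_n) := qform Gh (y - ut).
Let pen (y : 'cV[R]_n) j := kap j * `|ths j 0 + r * y j 0| `^ q.

Let r_ge0 : 0 <= r := ltW r_gt0.

Let c_gt0 : 0 < c.
Proof. by rewrite ltr_wpDl// mulr_ge0// sqr_ge0. Qed.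

Let lam_gt0 : 0 < lam.
Proof. by rewrite invr_gt0 mulr_gt0. Qed.

Let Gh_coercive (x : 'cV[R]_n) : lam * `|x| ^+ 2 <= qform Gh x.
Proof.
have -> : qform Gh x = qform G x + qform (Gh - G) x.
  by rewrite !qformE mulmxBl -scaleN1r dotcDr dotcZr; ring.
have h1 := qform_coercive x Gp iG_M.
have := qform_le (Gh - G) x; rewrite ler_norml => /andP[h2 _].
have h3 : nn ^+ 2 * `|Gh - G| * `|x| ^+ 2 <= lam * `|x| ^+ 2.
  rewrite ler_wpM2r ?sqr_ge0// (le_trans _ delta_lam)// ler_wpM2l// sqr_ge0//.
have h4 : `|x| ^+ 2 / c = lam * `|x| ^+ 2 + lam * `|x| ^+ 2.
  by rewrite /lam; field; rewrite gt_eqF.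
rewrite -/c h4 in h1; lra.
Qed.

Let scaled_min (y : 'cV[R]_n) :
  r ^+ 2 * D u + \sum_j pen u j <= r ^+ 2 * D y + \sum_j pen y j.
Proof.
have QE z : QLSA q Gh tht kap (ths + r *: z) = r ^+ 2 * D z + \sum_j pen z j.
  rewrite /QLSA /D -qformZ; congr (qform _ _ + _).
    by rewrite scalerBr /ut scalerA divff ?gt_eqF// scale1r; apply/colP => j; rewrite !mxE; ring.
  by apply: eq_bigr => j _; rewrite !mxE.
rewrite -!QE (_ : ths + r *: u = thh) ?thh_min// /u scalerA divff ?gt_eqF//.
by rewrite scale1r addrC subrK.
Qed.

Let D_le (y : 'cV[R]_n) : D y <= nn ^+ 2 * (M + 1) * `|y - ut| ^+ 2.
Proof.
rewrite (le_trans (ler_norm _))// (le_trans (qform_le _ _))//.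
rewrite ler_wpM2r ?sqr_ge0// ler_wpM2l ?sqr_ge0//.
by rewrite -[Gh](subrK G) addrC (le_trans (ler_normD _ _))// lerD// (le_trans GhG).
Qed.

(** One factor [r] comes from [kap_small], the other from the increment of the argument; together
    they match the scale of the quadratic form. No lower bound is asked at [z], which will be the
    minimizer. *)
Let pen_diff (y z : 'cV[R]_n) (j : 'I_p0) : `|ths (lshift p1 j) 0| / 2 <= `|ths (lshift p1 j) 0 + r * y (lshift p1 j) 0| ->
  pen y (lshift p1 j) - pen z (lshift p1 j) <=
  delta * L * r ^+ 2 * `|y (lshift p1 j) 0 - z (lshift p1 j) 0|.
Proof.
move=> hy; rewrite /pen -mulrBr.
have ay0 := lt_le_trans (half_gt0 j) hy.
have h1 := powR_sub_le q_gt0 q_le1 ay0 (normr_ge0 (ths (lshift p1 j) 0 + r * z (lshift p1 j) 0)).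
set x := y _ _ in hy h1 ay0 *; set x' := z _ _ in h1 *; set t := ths _ _ in hy h1 ay0 *.
have h2 : `|t + r * x| `^ q - `|t + r * x'| `^ q <= L * (r * `|x - x'|).
  apply: le_trans h1 _; rewrite ler_pM ?powR_ge0//; first exact: pow_le_L hy.
  rewrite (le_trans (ler_dist_dist _ _))// opprD addrACA subrr add0r -mulrBr.
  by rewrite normrM gtr0_norm.
rewrite (le_trans (ler_wpM2l (kap_ge0 _) h2))//.
have -> : delta * L * r ^+ 2 * `|x - x'| = delta * r * (L * (r * `|x - x'|)) by ring.
by rewrite ler_wpM2r// !mulr_ge0// ltW.
Qed.

Let pen_sum_diff (y z : 'cV[R]_n) : (forall j : 'I_p0,
    `|ths (lshift p1 j) 0| / 2 <= `|ths (lshift p1 j) 0 + r * y (lshift p1 j) 0|) ->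
  \sum_(j < p0) (pen y (lshift p1 j) - pen z (lshift p1 j)) <=
  nn * delta * L * r ^+ 2 * `|usubmx (y - z)|.
Proof.
move=> hy; apply: (@le_trans _ _ (\sum_(j < p0) delta * L * r ^+ 2 * `|usubmx (y - z)|)).
  apply: ler_sum => j _; apply: le_trans (pen_diff _ (hy j)) _.
  rewrite ler_wpM2l ?mulr_ge0 ?sqr_ge0//; apply: le_trans _ (mx_entry_le _ j 0).
  by rewrite !mxE.
rewrite sumr_const card_ord -[leLHS]mulr_natl -!mulrA ler_wpM2r//; last by rewrite ler_nat leq_addr.
by rewrite !mulr_ge0 ?sqr_ge0.
Qed.

(** The origin of the rate [2 - q]: a J^0 penalty scales as [r] to the power [q], the quadratic form
    as [r ^+ 2]. *)
Let pen_right (y : 'cV[R]_n) (j : 'I_p1) : pen y (rshift p0 j) =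
  r ^+ 2 * (r `^ (- (2 - q)) * kap (rshift p0 j)) * `|y (rshift p0 j) 0| `^ q.
Proof.
rewrite /pen ths_eq0 add0r normrM gtr0_norm// powRM// ?ltW//.
have -> : r `^ q = r ^+ 2 * r `^ (- (2 - q)); last by ring.
rewrite -powR_mulrn ?ltW// -powRD; last by rewrite (gt_eqF r_gt0) implybT.
by congr (_ `^ _); ring.
Qed.

(* The minimizer against the true parameter. *)
Let u_ineq : D u + \sum_(j < p1) (r `^ (- (2 - q)) * kap (rshift p0 j)) * `|u (rshift p0 j) 0| `^ q
   <= C1 + `|u|.
Proof.
have := scaled_min 0; rewrite !big_split_ord /=.
under [X in _ + (_ + X) <= _]eq_bigr do rewrite pen_right -mulrA.
rewrite [X in _ <= _ + (_ + X)]big1 => [|j _]; last first.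
  by rewrite pen_right mxE normr0 powR0 ?gt_eqF// mulr0.
rewrite -mulr_sumr; set S := \sum_(j < p1) _ => h.
have := @pen_sum_diff 0 u; rewrite sumrB => /(_ _) h2.
have {}h2 := h2 _; move: h2 => h2.
have {}h2 : \sum_(j < p0) pen 0 (lshift p1 j) - \sum_(j < p0) pen u (lshift p1 j) <= r ^+ 2 * `|u|.
  apply: le_trans (h2 _) _.
    move=> j; rewrite mxE mulr0 addr0 ler_pdivrMr// ler_peMr// ler1n//.
  rewrite sub0r (mulrAC _ (r ^+ 2)) [leLHS]mulrC ler_wpM2l ?sqr_ge0//.
  rewrite (@le_trans _ _ (1 * `|usubmx (- u)|))//; first by rewrite ler_wpM2r.
  by rewrite mul1r (le_trans (usub_le _))// normrN.
have h3 : D 0 <= C1.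
  rewrite (le_trans (D_le _))// sub0r normrN ler_wpM2l//.
    by rewrite !mulr_ge0 ?sqr_ge0// addr_ge0.
  by rewrite ler_pXn2r// nnegrE.
have r2 : 0 < r ^+ 2 by rewrite exprn_gt0.
rewrite -(ler_pM2l r2) !mulrDr -/S.
have := ler_wpM2l (ltW r2) h3; lra.
Qed.

(** The coercive left side of [u_ineq] is quadratic in the distance [t] from [u] to [ut], the right
    side at most [C1 + M + t]. Hence [t <= 1] or [t <= (C1 + M + 1) / lam], and [U] is the sum of
    both bounds and of [M]. *)
Let u_bound : `|u| <= U.
Proof.
have h : lam * `|u - ut| ^+ 2 <= C1 + M + `|u - ut|.
  apply: le_trans (Gh_coercive _) _.
  have h1 := u_ineq; rewrite -/(D u).
  have h2 : `|u| <= `|u - ut| + M.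
    by rewrite -{1}[u](subrK ut) (le_trans (ler_normD _ _))// lerD2l.
  have h3 : 0 <= \sum_(j < p1) (r `^ (- (2 - q)) * kap (rshift p0 j)) * `|u (rshift p0 j) 0| `^ q.
    by apply: sumr_ge0 => j _; rewrite !mulr_ge0 ?powR_ge0.
  lra.
have C10 : 0 <= C1 by rewrite /C1 !mulr_ge0 ?sqr_ge0// addr_ge0.
have h2 : `|u - ut| <= 1 + (C1 + M + 1) / lam.
  have [t1|t1] := leP `|u - ut| 1.
    by rewrite (le_trans t1)// lerDl divr_ge0 ?(ltW lam_gt0)// !addr_ge0.
  rewrite (@le_trans _ _ ((C1 + M + 1) / lam))// ?lerDr// ler_pdivlMr//.
  rewrite -(@ler_pM2r _ `|u - ut|) ?(lt_trans _ t1)//.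
  have : C1 + M <= (C1 + M) * `|u - ut| by rewrite ler_peMr ?addr_ge0// ltW.
  lra.
by rewrite -[u](subrK ut) (le_trans (ler_normD _ _))// lerD.
Qed.

Let u0_small : `|dsubmx u| <= eta.
Proof.
apply: mx_norm_leP => [|j i]; first exact: ltW.
rewrite ord1 mxE leNgt; apply/negP => h.
have h1 : eta `^ q < `|u (rshift p0 j) 0| `^ q.
  by apply: gt0_ltr_powR; rewrite // nnegrE ltW.
have := u_ineq; have := Gh_coercive (u - ut); rewrite -/(D u).
rewrite (bigD1 j)//=; set S := \sum_(i < p1 | _) _ => hD hu.
have S0 : 0 <= S by apply: sumr_ge0 => l _; rewrite !mulr_ge0 ?powR_ge0.
have D0 : 0 <= lam * `|u - ut| ^+ 2 by rewrite mulr_ge0 ?sqr_ge0// ltW.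
have : B * eta `^ q < r `^ (- (2 - q)) * kap (rshift p0 j) * `|u (rshift p0 j) 0| `^ q.
  rewrite (@lt_le_trans _ _ (B * `|u (rshift p0 j) 0| `^ q)) ?ltr_pM2l//.
  by rewrite ler_wpM2r ?powR_ge0.
have := u_bound; have := B_ge; lra.
Qed.

(** The shift from [usubmx ut] to the minimizer of the [G]-form over J^1 when the J^0 block is 0. *)
Let s := invmx (ulsubmx G) *m (ursubmx G *m dsubmx ut).

Let frakG_ut : frakG G *m ut = usubmx ut + s.
Proof.
by rewrite /frakG -{1}[ut]vsubmxK mul_row_col mul1mx /s mulmxA.
Qed.

Let G_s : usubmx (G *m col_mx s 0) = ursubmx G *m dsubmx ut.
Proof.
rewrite -{1}[G]submxK mul_block_col col_mxKu mulmx0 addr0 /s mulKVmx//.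
exact/posdef_unit/posdef_ulsub.
Qed.

(** The hypotheses control [invmx G], not [invmx (ulsubmx G)]. Coercivity of [G] at [col_mx s 0]
    bounds a quadratic in the norm of [s] by a linear term, through [G_s]. *)
Let s_bound : `|s| <= sb.
Proof.
have [->|s0] := eqVneq s 0; first by rewrite normr0 /sb !mulr_ge0 ?sqr_ge0// ltW.
have sgt0 : 0 < `|s| by rewrite normr_gt0.
have e1 : `|col_mx s (0 : 'cV[R]_p1)| = `|s|.
  apply/eqP; rewrite eq_le; apply/andP; split; first by apply: col_le => //; rewrite normr0.
  by rewrite -{1}(col_mxKu s (0 : 'cV[R]_p1)) usub_le.
have := qform_coercive (col_mx s 0) Gp iG_M; rewrite e1 -/c => h1.
have h2 : qform G (col_mx s 0) <= nn * `|s| * (nn * M * M).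
  rewrite qformE {1}/dotc tr_col_mx -[G *m _]vsubmxK mul_row_col trmx0 mul0mx addr0 G_s.
  rewrite (le_trans (ler_norm _))// (le_trans (dotc_le _ _))//.
  rewrite ler_pM ?mulr_ge0 ?ler_wpM2r ?ler_nat ?leq_addr//.
  rewrite (le_trans (mx_norm_mul _ _))//.
  rewrite ler_pM ?mulr_ge0 ?(le_trans (dsub_le _))// ler_pM ?ler_nat ?leq_addl//.
  by apply: mx_norm_leP => // i j; rewrite !mxE (le_trans (mx_entry_le _ _ _)).
have := le_trans h1 h2; rewrite ler_pdivrMr// expr2.
have -> : nn * `|s| * (nn * M * M) * c = `|s| * sb by rewrite /sb; ring.
by rewrite ler_pM2l.
Qed.

Lemma penalized_lsa_close :
  `|r^-1 *: usubmx (thh - ths) - frakG G *m (r^-1 *: (tht - ths))| <= e.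
Proof.
have sb_ge0 : 0 <= sb by apply: le_trans s_bound.
have e_pos : 0 <= nn * delta * L + 2 * nn * (nn * delta * (sb + U + M) + nn * M * eta).
  have U0 : 0 <= U by apply: le_trans u_bound.
  have e0 := ltW eta_gt0.
  have X0 : 0 <= nn * delta * (sb + U + M) + nn * M * eta.
    apply: addr_ge0; apply: mulr_ge0 => //; [exact: mulr_ge0 | | exact: mulr_ge0].
    exact: addr_ge0 (addr_ge0 sb_ge0 U0) M_ge0.
  have Y0 : 0 <= nn * delta * L by rewrite !mulr_ge0.
  by rewrite addr_ge0 // mulr_ge0.
have -> : r^-1 *: usubmx (thh - ths) = usubmx u by apply/matrixP => i j; rewrite !mxE.
rewrite -/ut frakG_ut; set v := _ - _.
have [->|v0] := eqVneq v 0.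
  by rewrite normr0 -(pmulr_rge0 _ lam_gt0) (le_trans _ e_ge).
have vgt0 : 0 < `|v| by rewrite normr_gt0.
pose y : 'cV[R]_n := col_mx (usubmx ut + s) (dsubmx u).
have uy : u = y + col_mx v 0.
  by rewrite /y add_col_mx addr0 /v addrC subrK vsubmxK.
have yut : y - ut = col_mx s (dsubmx u - dsubmx ut).
  by rewrite /y -[X in _ - X]vsubmxK opp_col_mx add_col_mx addrAC subrr add0r.
(* Half the J^1 gradient of [D] at [y]. It would be 0 if [Gh] were [G] and [dsubmx u] were 0, so it
   is controlled by [delta] and [eta]. *)
pose z := usubmx (Gh *m (y - ut)).
have DE : D u = D y + 2 * dotc v z + qform Gh (col_mx v 0).
  rewrite /D {1}uy addrAC (qformD (y - ut) (col_mx v 0) Gh_sym); congr (_ + 2 * _ + _).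
  by rewrite {1}/dotc tr_col_mx -{1}[Gh *m _]vsubmxK mul_row_col trmx0 mul0mx addr0.
have v_le (a : R) : 0 <= a -> `|v| <= a -> `|col_mx v (0 : 'cV[R]_p1)| <= a.
  by move=> a0 va; apply: col_le => //; rewrite normr0.
have v_col : `|v| <= `|col_mx v (0 : 'cV[R]_p1)|.
  by rewrite -{1}(col_mxKu v (0 : 'cV[R]_p1)) usub_le.
have hv : lam * `|v| ^+ 2 <= qform Gh (col_mx v 0).
  apply: le_trans (Gh_coercive _); rewrite ler_wpM2l ?(ltW lam_gt0)//.
  by rewrite ler_pXn2r ?nnegrE.
(* The minimizer against [y]. *)
have hmin : D u - D y <= nn * delta * L * `|v|.
  have r2 : 0 < r ^+ 2 by rewrite exprn_gt0.
  have pr j : pen y (rshift p0 j) = pen u (rshift p0 j).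
    by rewrite /pen /y col_mxEd mxE.
  have := scaled_min y; rewrite !big_split_ord /= (eq_bigr _ (fun j _ => pr j)) => h.
  have h2 : \sum_(j < p0) (pen y (lshift p1 j) - pen u (lshift p1 j)) <=
      nn * delta * L * r ^+ 2 * `|v|.
    have -> : `|v| = `|usubmx (y - u)|.
      by rewrite uy opprD addNKr linearN /= col_mxKu normrN.
    apply: pen_sum_diff => j; rewrite /y col_mxEu.
    (* [r_small] keeps the J^1 coordinates of [y] within half of [t], which is what [pen_sum_diff]
       asks of its first point. *)
    set t := ths _ _; have ht : r * `|(usubmx ut + s) j 0| <= `|t| / 2.
      apply: le_trans (r_small j); rewrite ler_wpM2l//.
      apply: le_trans (mx_entry_le _ _ _) _; apply: le_trans (ler_normD _ _) _.
      by rewrite lerD// (le_trans (usub_le _)).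
    have := ler_normB (t + r * (usubmx ut + s) j 0) (r * (usubmx ut + s) j 0).
    by rewrite addrK normrM gtr0_norm//; lra.
  rewrite sumrB in h2.
  rewrite -(ler_pM2l r2) mulrBr.
  have -> : r ^+ 2 * (nn * delta * L * `|v|) = nn * delta * L * r ^+ 2 * `|v| by ring.
  lra.
have hz : `|z| <= nn * delta * (sb + U + M) + nn * M * eta.
  have zE : z = usubmx ((Gh - G) *m (y - ut)) + ursubmx G *m dsubmx u.
    have GE : usubmx (G *m (y - ut)) = ursubmx G *m dsubmx u.
      rewrite yut (_ : col_mx s _ = col_mx s 0 + col_mx 0 (dsubmx u - dsubmx ut)); last first.
        by rewrite add_col_mx addr0 add0r.
      rewrite mulmxDr linearD /= G_s -{2}[G]submxK mul_block_col mulmx0 add0r col_mxKu.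
      by rewrite mulmxBr addrC subrK.
    by rewrite /z -GE (mulmxBl Gh G) -linearD /= subrK.
  rewrite zE (le_trans (ler_normD _ _))// lerD//.
    rewrite (le_trans (usub_le _))// (le_trans (mx_norm_mul _ _))//.
    rewrite ler_pM ?mulr_ge0// ?ler_wpM2l// yut.
    have U0 : 0 <= U by apply: le_trans u_bound.
    apply: col_le; first by rewrite (le_trans s_bound)// -addrA lerDl addr_ge0.
    rewrite (le_trans (ler_normB _ _))// -addrA (le_trans (lerD (dsub_le _) (dsub_le _)))//.
    by apply: (@le_trans _ _ (U + M)); [exact: lerD | rewrite lerDr].
  rewrite (le_trans (mx_norm_mul _ _))// ler_pM ?mulr_ge0// ler_pM ?ler_nat ?leq_addl//.
  by apply: mx_norm_leP => // i j; rewrite !mxE (le_trans (mx_entry_le _ _ _)).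
have hd : `|dotc v z| <= nn * `|v| * (nn * delta * (sb + U + M) + nn * M * eta).
  rewrite (le_trans (dotc_le _ _))// ler_pM ?mulr_ge0// ler_wpM2r// ler_nat leq_addr//.
have : lam * `|v| * `|v| <= lam * e * `|v|.
  apply: (@le_trans _ _ ((nn * delta * L + 2 * nn * (nn * delta * (sb + U + M) + nn * M * eta)) * `|v|)).
    have := hd; rewrite ler_norml => /andP[hd1 _].
    have -> : lam * `|v| * `|v| = lam * `|v| ^+ 2 by ring.
    rewrite DE in hmin; rewrite mulrDl.
    have -> : 2 * nn * (nn * delta * (sb + U + M) + nn * M * eta) * `|v| =
      2 * (nn * `|v| * (nn * delta * (sb + U + M) + nn * M * eta)) by ring.
    lra.
  by rewrite ler_wpM2r.
by rewrite ler_pM2r// ler_pM2l.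
Qed.

End OneSample.
End Deterministic.

Section Uniform.
Context {R : realType} (p0 p1 : nat).
Local Notation n := (p0 + p1)%N.

(** The thresholds depend on [M] and [e] only, not on the sample, so they can be fixed before any
    probability is estimated. *)
Lemma penalized_lsa_uniform (q : R) (q_gt0 : 0 < q) (q_le1 : q <= 1) (ths : 'cV[R]_n)
    (ths_neq0 : forall j : 'I_p0, ths (lshift p1 j) 0 != 0)
    (ths_eq0 : forall j : 'I_p1, ths (rshift p0 j) 0 = 0) (M e : R) :
  0 <= M -> 0 < e -> exists delta B rho : R, [/\ 0 < delta, 0 < rho &
  forall (r : R) (tht thh : 'cV[R]_n) (G Gh : 'M[R]_n) (kap : 'I_n -> R),
    0 < r -> r <= rho -> (forall j, 0 <= kap j) ->
    sym_posdef Gh -> sym_posdef G -> `|G| <= M -> `|invmx G| <= M ->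
    `|Gh - G| <= delta -> `|r^-1 *: (tht - ths)| <= M ->
    `|r^-1 * amax kap| <= delta -> (B%:E < (r `^ (- (2 - q)))%:E * bmin kap)%E ->
    (forall th, QLSA q Gh tht kap thh <= QLSA q Gh tht kap th) ->
    `|r^-1 *: usubmx (thh - ths) - frakG G *m (r^-1 *: (tht - ths))| <= e].
Proof.
move=> M0 e0.
pose L : R := \sum_(j < p0) (`|ths (lshift p1 j) 0| / 2) `^ (q - 1).
pose nn : R := n%:R.
pose c := nn ^+ 2 * M + 1.
pose lam := (2 * c)^-1.
pose C1 := nn ^+ 2 * (M + 1) * M ^+ 2.
pose U := 1 + (C1 + M + 1) / lam + M.
pose sb := c * (nn ^+ 2 * M ^+ 2).
have nn0 : 0 <= nn by [].
have L0 : 0 <= L by apply: sumr_ge0 => j _; exact: powR_ge0.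
have c0 : 0 < c by rewrite ltr_wpDl// mulr_ge0// sqr_ge0.
have lam0 : 0 < lam by rewrite invr_gt0 mulr_gt0.
have C10 : 0 <= C1 by rewrite /C1 !mulr_ge0 ?sqr_ge0// addr_ge0.
have U0 : 0 < U.
  by rewrite /U -addrA ltr_pwDl// addr_ge0// divr_ge0 ?(ltW lam0)// !addr_ge0.
have sb0 : 0 <= sb by rewrite /sb mulr_ge0 ?(ltW c0)// mulr_ge0 ?sqr_ge0.
(* The [eta] term of [e_ge] gets half of [lam * e]; the bound [d3] on [delta] leaves the other half
   to the [delta] terms. The added 1 keeps denominators positive. *)
pose eta := lam * e / (4 * (nn ^+ 2 * M + 1)).
have eta0 : 0 < eta by rewrite divr_gt0 ?mulr_gt0.
pose B := (C1 + U) / eta `^ q.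
have B0 : 0 < B by rewrite divr_gt0 ?powR_gt0// ltr_wpDl.
pose d1 := lam / (nn ^+ 2 + 1).
pose d2 := (nn * L + 1)^-1.
pose D3 := nn * L + 2 * nn * (nn * (sb + U + M)).
have D30 : 0 <= D3.
  apply: addr_ge0; first exact: mulr_ge0.
  apply: mulr_ge0; first exact: mulr_ge0.
  apply: mulr_ge0 => //; exact: addr_ge0 (addr_ge0 sb0 (ltW U0)) M0.
pose d3 := (lam * e / 2) / (D3 + 1).
pose delta := Num.min (Num.min 1 d1) (Num.min d2 d3).
have n21 : 0 < nn ^+ 2 + 1 by rewrite ltr_wpDl// sqr_ge0.
have nL1 : 0 < nn * L + 1 by rewrite ltr_wpDl// mulr_ge0.
have D31 : 0 < D3 + 1 by rewrite ltr_wpDl.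
have delta0 : 0 < delta.
  by rewrite !lt_min ltr01 divr_gt0// invr_gt0 nL1 !divr_gt0 ?mulr_gt0.
have [dl1 dl2 dl3 dl4] : [/\ delta <= 1, delta <= d1, delta <= d2 & delta <= d3].
  by split; rewrite !ge_min lexx ?orbT.
(* [S] dominates the inverse of each half-size [ths_j / 2], so [(S + 1)^-1] is below all of them,
   and positive even for [p0 = 0]. *)
pose S : R := \sum_(j < p0) (`|ths (lshift p1 j) 0| / 2)^-1.
have S0 : 0 <= S by apply: sumr_ge0 => j _; rewrite invr_ge0 divr_ge0.
pose rho := (S + 1)^-1 / (M + sb + 1).
have S1 : 0 < S + 1 by rewrite ltr_wpDl.
have Ms : 0 < M + sb + 1 by rewrite ltr_wpDl// addr_ge0.
exists delta, B, rho; split=> //; first by rewrite divr_gt0 ?invr_gt0.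
move=> r tht thh G Gh kap r0 rrho kap0 [Ghs _] Gp GM iGM GhG utM ka kb thmin.
apply: (@penalized_lsa_close _ _ _ q _ _ ths _ _ M e delta eta B _ _ _ _ _ _ _ _ _ r tht thh G Gh kap) => //.
- exact: ltW.
- rewrite -/nn -/c -/lam (le_trans (ler_wpM2l (sqr_ge0 nn) dl2))//.
  by rewrite /d1 mulrA ler_pdivrMr// mulrC ler_wpM2l ?(ltW lam0)// lerDl.
- rewrite -/nn -/L mulrAC (le_trans (ler_wpM2l (mulr_ge0 nn0 L0) dl3))//.
  by rewrite /d2 ler_pdivrMr// mul1r lerDl.
- by rewrite -/nn -/c -/lam -/C1 -/U /B divfK// gt_eqF// powR_gt0.
- rewrite -/nn -/c -/lam -/C1 -/U -/sb -/L.
  have h1 : delta * D3 <= lam * e / 2.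
    rewrite (le_trans (ler_wpM2r D30 dl4))// /d3 mulrAC ler_pdivrMr//.
    by rewrite ler_wpM2l ?divr_ge0 ?mulr_ge0// ?ltW// ltrDl.
  have h2 : 2 * nn * (nn * M * eta) <= lam * e / 2.
    have -> : 2 * nn * (nn * M * eta) = (lam * e / 2) * ((nn ^+ 2 * M) / (nn ^+ 2 * M + 1)).
      by rewrite /eta; field; rewrite -natrD (lt0r_neq0 c0).
    rewrite ler_piMr ?divr_ge0 ?mulr_ge0// ?ltW//.
    by rewrite ltr_pdivrMr// mul1r ltrDl.
  have -> : nn * delta * L + 2 * nn * (nn * delta * (sb + U + M) + nn * M * eta) =
    delta * D3 + 2 * nn * (nn * M * eta) by rewrite /D3; ring.
  lra.
- move=> j; rewrite -/nn -/c -/sb.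
  have tj : 0 < `|ths (lshift p1 j) 0| / 2 by rewrite divr_gt0// normr_gt0.
  rewrite (@le_trans _ _ (rho * (M + sb + 1)))//.
    by rewrite ler_pM ?(ltW r0) ?addr_ge0// lerDl.
  rewrite /rho divfK ?gt_eqF// -[leRHS]invrK lef_pV2 ?posrE ?invr_gt0//.
  rewrite (@le_trans _ _ S)// ?lerDl// /S (bigD1 j)//= lerDl.
  by apply: sumr_ge0 => i _; rewrite invr_ge0 divr_ge0.
- move=> j; have amj : kap (lshift p1 j) <= amax kap.
    by apply: (le_bigmax _ (fun j => kap (lshift p1 j))).
  rewrite (le_trans amj)// -ler_pdivrMr// mulrC; apply: le_trans ka; exact: ler_norm.
- move=> j; have bj : (bmin kap <= (kap (rshift p0 j))%:E)%E.
    by apply: (bigmin_le _ j (fun j => (kap (rshift p0 j))%:E)).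
  rewrite -lee_fin; apply: le_trans (ltW kb) _.
  by rewrite [leRHS]EFinM lee_wpmul2l// lee_fin powR_ge0.
Qed.

End Uniform.

(** * From the deterministic estimate to convergence in probability *)

Section LimitsInProbability.
Context {R : realType}.

Lemma cvge0P (I : Type) (F : set_system I) {FF : Filter F} (f : I -> \bar R) :
  (forall T, (0 <= f T)%E) ->
  (f @ F --> 0%E) <-> (forall e : R, 0 < e -> \forall T \near F, (f T <= e%:E)%E).
Proof.
move=> f0; split=> [cf e e0|h].
  have /fine_cvgP[ffin fcv] : f @ F --> (0 : R)%:E by [].
  have /cvgr0Pnorm_le /(_ _ e0) := fcv.
  apply: filterS2 ffin => T ffT fe; rewrite -(fineK ffT) lee_fin.
  by rewrite (le_trans (ler_norm _))//.
apply/fine_cvgP; split.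
  have := h 1 ltr01; apply: filterS => T fT.
  by rewrite ge0_fin_numE// (le_lt_trans fT) ?ltry.
apply/cvgr0Pnorm_le => e e0; have := h e e0; apply: filterS => T fT /=.
rewrite ger0_norm ?fine_ge0// -lee_fin fineK// ge0_fin_numE//.
by rewrite (le_lt_trans fT) ?ltry.
Qed.

Context {d : measure_display} {Omega : measurableType d} (P : probability Omega R).

Lemma measurable_lt_fun (f : Omega -> R) (M : R) :
  measurable_fun setT f -> measurable [set w | M < f w].
Proof.
move=> mf; rewrite -[X in measurable X]setTI.
rewrite (_ : mkset _ = f @^-1` `]M, +oo[%classic); first exact: mf.
by apply/seteqP; split=> w /=; rewrite in_itv /= andbT.
Qed.

Lemma measureU_le (A B : set Omega) (a b : R) : measurable A -> measurable B ->
  (P A <= a%:E)%E -> (P B <= b%:E)%E -> (P (A `|` B) <= (a + b)%:E)%E.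
Proof. by move=> mA mB Aa Bb; rewrite (le_trans (measureU2 P mA mB))// EFinD leeD. Qed.

Lemma tight_fun (f : Omega -> R) (e : R) : measurable_fun setT f -> 0 < e ->
  exists2 M : R, 0 <= M & (P [set w | (M < f w)%R] <= e%:E)%E.
Proof.
move=> mf e0; pose E k := [set w | k%:R < f w].
have mE k : measurable (E k) by exact: measurable_lt_fun.
have E0 : \bigcap_k E k = set0.
  apply/seteqP; split=> // w /(_ (Num.trunc `|f w|).+1 I) /=.
  by rewrite /E /= ltNge (le_trans (ler_norm _))// ltW// truncnS_gt.
have := @nonincreasing_cvg_mu _ _ _ P E; rewrite E0 measure0.
move=> /(_ _ mE measurable0 _) h.
have {h} : (P \o E) x @[x --> \oo] --> 0%E.
  apply: h; first by rewrite (le_lt_trans (probability_le1 _ (mE _))) ?ltry.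
  move=> k l kl; apply/subsetPset => w; rewrite /E /=; apply: le_lt_trans.
  by rewrite ler_nat.
move/cvge0P => /(_ (fun _ => measure_ge0 _ _) e e0)[k _ /(_ k (leqnn k)) h].
by exists k%:R.
Qed.

Lemma cvg_prob_le (I : Type) (F : set_system I) {FF : Filter F} m n
    (X : I -> Omega -> 'M[R]_(m, n)) (Y : Omega -> 'M[R]_(m, n)) (t e : R) :
  cvg_prob F P X Y -> 0 < t -> 0 < e ->
  \forall T \near F, (P [set w | (t < `|X T w - Y w|)%R] <= e%:E)%E.
Proof. by move=> h t0 e0; have /cvge0P := h t t0; apply. Qed.

Lemma probability_ae_le (A B N : set Omega) (a : R) : measurable A -> measurable B ->
  P.-negligible N -> A `<=` N `|` B -> (P B <= a%:E)%E -> (P A <= a%:E)%E.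
Proof.
move=> mA mB [N' [mN' N'0 NN']] AB; apply: le_trans.
have : (P A <= P (N' `|` B))%E.
  rewrite le_measure ?inE//; first exact: measurableU.
  by move=> w /AB[/NN'|]; [left|right].
by move/le_trans; apply; rewrite (le_trans (measureU2 P mN' mB))// /= N'0 add0e.
Qed.

Section PartOne.
Context (I : Type) (F : set_system I) (FF : ProperFilter F).
Context (p0 p1 : nat) (q : R) (q_gt0 : 0 < q) (q_le1 : q <= 1).
Context (r : I -> R) (r_gt0 : forall T, 0 < r T) (r_cvg0 : r T @[T --> F] --> 0).
Context (thetas : 'cV[R]_(p0 + p1))
    (thetas_neq0 : forall j : 'I_p0, thetas (lshift p1 j) 0 != 0)
    (thetas_eq0 : forall j : 'I_p1, thetas (rshift p0 j) 0 = 0)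
    (thetat : I -> Omega -> 'cV[R]_(p0 + p1))
    (thetat_rv : forall T, random_mx (thetat T))
    (Ghat : I -> Omega -> 'M[R]_(p0 + p1))
    (Ghat_rv : forall T, random_mx (Ghat T))
    (Ghat_posdef : forall T, {ae P, forall w, sym_posdef (Ghat T w)})
    (kappa : I -> 'I_(p0 + p1) -> Omega -> R)
    (kappa_rv : forall T j, measurable_fun setT (kappa T j))
    (kappa_ge0 : forall T j w, 0 <= kappa T j w)
    (thetah : I -> Omega -> 'cV[R]_(p0 + p1))
    (thetah_rv : forall T, random_mx (thetah T))
    (thetah_min : forall T, {ae P, forall w, forall theta : 'cV[R]_(p0 + p1),
        QLSA q (Ghat T w) (thetat T w) (fun j => kappa T j w) (thetah T w) <=
        QLSA q (Ghat T w) (thetat T w) (fun j => kappa T j w) theta})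
    (G : Omega -> 'M[R]_(p0 + p1))
    (G_rv : random_mx G)
    (G_posdef : {ae P, forall w, sym_posdef (G w)})
    (Ghat_cvg : cvg_prob F P Ghat G)
    (thetat_Op1 : Op1 F P (fun T w => (r T)^-1 *: (thetat T w - thetas)))
    (a_op1 : op1 F P (fun T w => (r T)^-1 * amax (fun j => kappa T j w)))
    (b_infty : cvg_prob_pinfty F P (fun T w =>
        ((r T `^ (- (2 - q)))%:E * bmin (fun j => kappa T j w))%E)).

Lemma measurable_bmin T : measurable_fun setT (fun w => bmin (fun j => kappa T j w)).
Proof.
rewrite /bmin; elim: (index_enum _) => [|j s IH].
  by under eq_fun do rewrite big_nil; exact: measurable_cst.
under eq_fun do rewrite big_cons; apply: measurable_mine => //.
exact/measurable_EFinP.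
Qed.

Lemma lsa_oracle_cvg : cvg_prob F P
    (fun T w => (r T)^-1 *: usubmx (thetah T w - thetas)
                - frakG (G w) *m ((r T)^-1 *: (thetat T w - thetas)))
    (fun _ => 0).
Proof.
move=> e e0; apply/cvge0P => [T|eps eps0]; first exact: measure_ge0.
have eps6 : 0 < eps / 6 by rewrite divr_gt0.
have [M1 M10 PM1] := tight_fun (random_mx_norm G_rv) eps6.
have [M2 M20 PM2] := tight_fun (random_mx_norm (random_invmx G_rv)) eps6.
have [M3 PM3] := thetat_Op1 eps6.
pose M := Num.max M1 (Num.max M2 M3).
have [M1M M2M M3M] : [/\ M1 <= M, M2 <= M & M3 <= M].
  by split; rewrite !le_max lexx ?orbT.
have M0 : 0 <= M by apply: le_trans M1M.
(* [M] comes from tightness alone; [delta] and [B] are then levels for the three convergences in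
   probability. Each of the six bad events gets [eps / 6]. *)
have [delta [B [rho [delta0 rho0 unif]]]] :=
  penalized_lsa_uniform q_gt0 q_le1 thetas_neq0 thetas_eq0 M0 e0.
have PG := cvg_prob_le Ghat_cvg delta0 eps6.
have Pa := (iffLR (cvge0P (fun _ => measure_ge0 _ _)) (a_op1 delta0)) _ eps6.
have Pb := (iffLR (cvge0P (fun _ => measure_ge0 _ _)) (b_infty B)) _ eps6.
have rr : \forall T \near F, r T <= rho.
  have /cvgr0Pnorm_le /(_ _ rho0) := r_cvg0; apply: filterS => T.
  by apply: le_trans; exact: ler_norm.
near=> T.
have rut : random_mx (fun w => (r T)^-1 *: (thetat T w - thetas)).
  by apply: random_mxZ; apply: random_mxB => //; exact: random_mx_cst.
pose N := ~` [set w | [/\ sym_posdef (Ghat T w), sym_posdef (G w) &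
  forall theta, QLSA q (Ghat T w) (thetat T w) (fun j => kappa T j w) (thetah T w) <=
        QLSA q (Ghat T w) (thetat T w) (fun j => kappa T j w) theta]].
have N0 : P.-negligible N.
  apply: negligibleS (negligibleU (Ghat_posdef T) (negligibleU G_posdef (thetah_min T))).
  move=> w Nw; apply: contrapT => /not_orP[/contrapT w1 /not_orP[/contrapT w2 /contrapT w3]].
  exact: Nw.
pose A1 := [set w | M1 < `|G w|].
pose A2 := [set w | M2 < `|invmx (G w)|].
pose A3 := [set w | M3 < `|(r T)^-1 *: (thetat T w - thetas)|].
pose A4 := [set w | delta < `|Ghat T w - G w|].
pose A5 := [set w | delta < `|(r T)^-1 * amax (fun j => kappa T j w)|].
pose A6 := [set w | ((r T `^ (- (2 - q)))%:E * bmin (fun j => kappa T j w) <= B%:E)%E].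
have mnorm k l (X : Omega -> 'M[R]_(k, l)) (a : R) : random_mx X -> measurable [set w | a < `|X w|].
  by move=> rX; apply: (@measurable_lt_fun (fun w => `|X w|)); exact: random_mx_norm.
have mA1 : measurable A1 by exact: mnorm.
have mA2 : measurable A2 by apply: mnorm; exact: random_invmx.
have mA3 : measurable A3 by exact: mnorm.
have mA4 : measurable A4 by apply: mnorm; exact: random_mxB.
have mA5 : measurable A5.
  apply: (@measurable_lt_fun (fun w => `|(r T)^-1 * amax (fun j => kappa T j w)|)).
  apply: measurableT_comp => //; apply: measurable_funM => //.
  by apply: measurable_bigmaxr.
have mA6 : measurable A6.
  rewrite -[X in measurable X]setTI; apply: emeasurable_fun_le => //.
  by apply: emeasurable_funM => //; exact: measurable_bmin.
apply: (@probability_ae_le _ (A1 `|` (A2 `|` (A3 `|` (A4 `|` (A5 `|` A6))))) N).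
- apply: mnorm; apply: random_mxB; last exact: random_mx_cst.
  apply: random_mxB.
    by apply: random_mxZ; apply: random_usubmx; apply: random_mxB => //; exact: random_mx_cst.
  by apply: random_mxM => //; exact: random_frakG.
- by do 5! (apply: measurableU => //).
- by [].
- move=> w ew; apply: contrapT => /not_orP[/contrapT [Ghp Gp thmin]].
  move=> /not_orP[/negP a1 /not_orP[/negP a2 /not_orP[/negP a3 /not_orP[/negP a4 /not_orP[/negP a5 /negP a6]]]]].
  rewrite -!leNgt in a1 a2 a3 a4 a5; rewrite -ltNge in a6.
  move: ew; rewrite /= subr0 ltNge => /negP; apply.
  apply: (unif (r T) (thetat T w) (thetah T w) (G w) (Ghat T w) (fun j => kappa T j w)) => //.
  + by near: T.
  + exact: le_trans M1M.
  + exact: le_trans M2M.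
  + exact: le_trans M3M.
have -> : eps = eps / 6 + (eps / 6 + (eps / 6 + (eps / 6 + (eps / 6 + eps / 6)))) by field.
do 2! (apply: measureU_le => //; first by do 4! (apply: measurableU => //)).
apply: measureU_le => //; [by do 4! (apply: measurableU => //) | by rewrite /A3; near: T; exact: PM3 |].
apply: measureU_le => //; [by do 4! (apply: measurableU => //) | by rewrite /A4; near: T; exact: PG |].
by apply: measureU_le => //; [rewrite /A5; near: T; exact: Pa | rewrite /A6; near: T; exact: Pb].
Unshelve. all: by end_near. Qed.

End PartOne.

End LimitsInProbability.

(** * Stable convergence *)

Section StableSlutsky.
Context {R : realType}.

(** Only [x] is confined to [K]; [y] may leave it, so uniform continuity on [K] alone would not
    do. *)
Lemma compact_unif_continuous (V : normedModType R) (f : V -> R) (K : set V) (e : R) :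
  compact K -> continuous f -> 0 < e ->
  exists2 delta : R, 0 < delta & forall x y, K x -> `|x - y| < delta -> `|f x - f y| <= e.
Proof.
move=> cK cf e0.
have := (iffLR (compact_near_coveringP _) cK) R (0^'+)
  (fun delta x => forall y, `|x - y| < delta -> `|f x - f y| <= e) _.
case=> [x Kx|delta].
  have e2 : 0 < e / 2 by rewrite divr_gt0.
  have /cvgrPdist_le /(_ _ e2) /nbhs_ballP[t /= t0 xt] := cf x.
  have t2 : 0 < t / 2 by rewrite divr_gt0.
  exists (ball x (t / 2), [set d | d < t / 2]) => /=.
    by split; [exact: nbhsx_ballx | exact: nbhs_right_lt].
  move=> [x' d] /= [xx' dt] y x'y.
  rewrite -ball_normE /= in xx'.
  have h1 : `|f x - f x'| <= e / 2.
    by apply: xt; rewrite -ball_normE /= (lt_trans xx')// ltr_pdivrMr// ltr_pMr// ltr1n.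
  have h2 : `|f x - f y| <= e / 2.
    apply: xt; rewrite -ball_normE /= -(subrKA x') (le_lt_trans (ler_normD _ _))//.
    by rewrite (splitr t) ltrD// (lt_trans x'y).
  by rewrite -(subrKA (f x)) (le_trans (ler_normD _ _))// (splitr e) lerD// distrC.
move=> /= d0 sub; have d2 : 0 < delta / 2 by rewrite divr_gt0.
exists (delta / 2) => // x y Kx xy; apply: (sub (delta / 2) _ d2 x Kx y xy).
by rewrite /ball_ /= sub0r normrN gtr0_norm// ltr_pdivrMr// ltr_pMr// ltr1n.
Qed.

Lemma bounded_integrable d (Omega : measurableType d) (P : probability Omega R)
    (f : Omega -> R) (C : R) : measurable_fun setT f -> (forall w, `|f w| <= C) ->
  P.-integrable setT (EFin \o f).
Proof.
move=> mf fC; apply: measurable_bounded_integrable => //.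
  by rewrite (le_lt_trans (probability_le1 P measurableT)) ?ltry.
by exists C; split; [exact: num_real | move=> M CM w _; rewrite /= (le_trans (fC w))// ltW].
Qed.

Lemma expectation_close d (Omega : measurableType d) (P : probability Omega R)
    (f g : Omega -> R) (A : set Omega) (C a b : R) :
  measurable_fun setT f -> measurable_fun setT g -> measurable A ->
  (forall w, `|f w| <= C) -> (forall w, `|g w| <= C) ->
  0 <= b -> (P A <= a%:E)%E -> (forall w, ~ A w -> `|f w - g w| <= b) ->
  `|\int[P]_w f w - \int[P]_w g w| <= b + 2 * C * a.
Proof.
move=> mf mg mA fC gC b0 PA fg.
have C0 : 0 <= C by have := fC point; exact: le_trans.
have intf := bounded_integrable P mf fC; have intg := bounded_integrable P mg gC.
have mfg : measurable_fun setT (fun w => f w - g w) by exact: measurable_funB.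
have fgC w : `|f w - g w| <= 2 * C.
  by rewrite (le_trans (ler_normB _ _))// mulr_natl mulr2n lerD.
have intfg := bounded_integrable P mfg fgC.
rewrite -RintegralB// (le_trans (le_normr_Rintegral _ intfg))//.
have ind01 w : 0 <= (\1_A w : R) <= 1 by rewrite indicE; case: (w \in A); rewrite ?lexx ler01.
have mh : measurable_fun setT (fun w => b + 2 * C * \1_A w : R).
  by apply: measurable_funD => //; apply: measurable_funM.
have inth : P.-integrable setT (EFin \o (fun w => b + 2 * C * \1_A w : R)).
  apply: (@bounded_integrable _ _ _ _ (b + 2 * C)) => // w.
  have /andP[i0 i1] := ind01 w.
  by rewrite ger0_norm ?addr_ge0 ?mulr_ge0// lerD2l ler_piMr ?mulr_ge0.
have intn : P.-integrable setT (EFin \o (fun w => `|f w - g w|)).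
  apply: (@bounded_integrable _ _ _ _ (2 * C)) => [|w]; last by rewrite normr_id.
  exact: measurableT_comp.
rewrite (@le_trans _ _ (\int[P]_w (b + 2 * C * \1_A w)))//.
  apply: le_Rintegral => // w _; rewrite indicE; have [wA|wA] := boolP (w \in A).
    by rewrite mulr1 (le_trans (fgC w))// lerDr.
  by rewrite mulr0 addr0; apply: fg => Aw; rewrite mem_set in wA.
have int1 : P.-integrable setT (EFin \o (\1_A : Omega -> R)).
  apply: (@bounded_integrable _ _ _ _ 1) => // w.
  by have /andP[i0 i1] := ind01 w; rewrite ger0_norm.
rewrite RintegralD//; last 2 first.
- by apply: (@bounded_integrable _ _ _ _ `|b|).
- apply: (@bounded_integrable _ _ _ _ (2 * C)) => [|w]; first exact: measurable_funM.
  have /andP[i0 i1] := ind01 w.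
  by rewrite ger0_norm ?mulr_ge0// ler_piMr ?mulr_ge0.
rewrite Rintegral_cst// RintegralZl//= probability_setT mulr1 lerD2l.
rewrite ler_wpM2l ?mulr_ge0// /Rintegral integral_indic// setIT.
by rewrite -lee_fin fineK// fin_num_measure.
Qed.


Lemma measurable_natmap d (Omega : measurableType d) (kap : Omega -> nat) :
  (forall k, measurable (kap @^-1` [set k])) ->
  measurable_fun setT (fun w => (kap w)%:R : R).
Proof.
move=> mk _ B mB; rewrite setTI.
rewrite (_ : _ @^-1` _ = \bigcup_(k in [set k | B k%:R]) (kap @^-1` [set k])).
  exact: bigcup_measurable.
apply/seteqP; split=> w /=; first by move=> Bw; exists (kap w).
by move=> [k Bk ->].
Qed.

(** [kap] is the first index, in an enumeration of rational matrices, of one within [h]; taking the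
    first makes its level sets differences of measurable sets. *)
Lemma random_mx_discretize d (Omega : measurableType d) m n (K : Omega -> 'M[R]_(m, n))
    (h : R) : random_mx K -> 0 < h ->
  exists (M_ : nat -> 'M[R]_(m, n)) (kap : Omega -> nat),
    (forall k, measurable (kap @^-1` [set k])) /\ forall w, `|K w - M_ (kap w)| < h.
Proof.
move=> rK h0; pose M_ k : 'M[R]_(m, n) :=
  map_mx ratr (odflt (0 : 'M[rat]_(m, n)) (unpickle k)).
have dense A : exists k, `|A - M_ k| < h.
  have hq (z : R) : exists r : rat, `|z - ratr r| < h / 2.
    have h2 : 0 < h / 2 by rewrite divr_gt0.
    have /rat_in_itvoo[r] : z - h / 2 < z + h / 2 by rewrite ltrBlDr -addrA ltrDl addr_gt0.
    by rewrite in_itv /= => /andP[r1 r2]; exists r; rewrite distrC ltr_distl r1 r2.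
  exists (pickle (\matrix_(i, j) xchoose (hq (A i j)))).
  rewrite (@le_lt_trans _ _ (h / 2))//; last by rewrite ltr_pdivrMr// ltr_pMr// ltr1n.
  apply: mx_norm_leP => [|i j]; first by rewrite divr_ge0// ltW.
  by rewrite /M_ pickleK /= !mxE ltW// (xchooseP (hq (A i j))).
pose kap w := ex_minn (dense (K w)).
exists M_, kap; split=> [k|w]; last by rewrite /kap; case: ex_minnP.
have mE l : measurable [set w | `|K w - M_ l| < h].
  rewrite -[X in measurable X]setTI.
  rewrite (_ : mkset _ = (fun w => `|K w - M_ l|) @^-1` `]-oo, h[%classic).
    by apply: random_mx_norm => //; apply: random_mxB => //; exact: random_mx_cst.
  by apply/seteqP; split=> w; rewrite /= in_itv.
rewrite (_ : _ @^-1` _ = [set w | `|K w - M_ k| < h] `\`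
    \bigcup_(l in [set l | (l < k)%N]) [set w | `|K w - M_ l| < h]).
  by apply: measurableD => //; exact: bigcup_measurable.
apply/seteqP; split=> w /=.
  rewrite /kap; case: ex_minnP => l Kl lmin <-; split=> // -[l' /= l'l /lmin].
  by rewrite leqNgt l'l.
move=> [Kk nK]; rewrite /kap; case: ex_minnP => l Kl lmin.
apply/eqP; rewrite eqn_leq (lmin _ Kk) leqNgt; apply/negP => lk.
by apply: nK; exists l.
Qed.

(** Each summand is an admissible test for stable convergence of [U]: the indicator goes into the
    bounded variable, the constant matrix [M_ k] into the continuous function. The cut at [N] leaves
    finitely many limits. *)
Definition discretized (Om : Type) m n (N : nat) (Y : Om -> R) (kap : Om -> nat)
    (M_ : nat -> 'M[R]_(m, n)) (U : Om -> 'cV[R]_n) (f : 'cV[R]_m -> R) (w : Om) : R :=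
  \sum_(k < N) (Y w * \1_(kap @^-1` [set nat_of_ord k]) w) * f (M_ k *m U w).

Lemma discretizedE (Om : Type) m n N (Y : Om -> R) kap (M_ : nat -> 'M[R]_(m, n)) U f w :
  discretized N Y kap M_ U f w =
  if (kap w < N)%N then Y w * f (M_ (kap w) *m U w) else 0.
Proof.
have ind (k : nat) : (\1_(kap @^-1` [set k]) w : R) = (kap w == k)%:R.
  rewrite indicE (_ : (w \in _) = (kap w == k))//.
  by apply/idP/eqP; rewrite inE.
rewrite /discretized; case: ltnP => kN.
  rewrite (bigD1 (Ordinal kN))//= ind eqxx mulr1 big1 ?addr0// => k kk.
  by rewrite ind eq_sym (negbTE (kk : (nat_of_ord k != kap w))) mulr0 mul0r.
rewrite big1// => k _; rewrite ind (_ : (kap w == k) = false) ?mulr0 ?mul0r//.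
by apply/negbTE; rewrite gtn_eqF// (leq_trans (ltn_ord k)).
Qed.

Section Closeness.
Context d (Omega : measurableType d) (P : probability Omega R) (m n : nat).
Variables (Y : Omega -> R) (kap : Omega -> nat) (K : Omega -> 'M[R]_(m, n)).
Variables (X : Omega -> 'cV[R]_m) (U : Omega -> 'cV[R]_n) (f : 'cV[R]_m -> R).
Variable M_ : nat -> 'M[R]_(m, n).
Hypotheses (mY : measurable_fun setT Y) (mk : forall k, measurable (kap @^-1` [set k])).
Hypotheses (rK : random_mx K) (rX : random_mx X) (rU : random_mx U) (cf : continuous f).

Lemma measurable_discretized_term k :
  measurable_fun setT (fun w => (Y w * \1_(kap @^-1` [set k]) w) * f (M_ k *m U w)).
Proof.
apply: measurable_funM; first by apply: measurable_funM.
apply: (continuous_random_mx (X := fun w => M_ k *m U w) cf).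
by apply: random_mxM => //; exact: random_mx_cst.
Qed.

Lemma measurable_discretized N : measurable_fun setT (discretized N Y kap M_ U f).
Proof. by apply: measurable_sum => k; exact: measurable_discretized_term. Qed.

Variables (CY Cf : R).
Hypotheses (YC : forall w, `|Y w| <= CY) (fC : forall x, `|f x| <= Cf).

Lemma expectation_discretized N : \int[P]_w discretized N Y kap M_ U f w =
  \sum_(k < N) \int[P]_w ((Y w * \1_(kap @^-1` [set nat_of_ord k]) w) * f (M_ k *m U w)).
Proof.
have CY0 : 0 <= CY by apply: le_trans (YC point).
have Cf0 : 0 <= Cf by apply: le_trans (fC 0).
have intk k : P.-integrable setT
    (EFin \o (fun w => (Y w * \1_(kap @^-1` [set k]) w) * f (M_ k *m U w))).
  apply: (@bounded_integrable _ _ _ _ (CY * Cf)) => [|w].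
    exact: measurable_discretized_term.
  rewrite normrM ler_pM// normrM -[leRHS]mulr1 ler_pM// indicE.
  by case: (w \in _); rewrite ?normr1 ?normr0.
rewrite /Rintegral sum_fine => [|k _]; last exact: (integrable_fin_num measurableT (intk k)).
congr fine; rewrite -integral_sum//; last by move=> k; exact: intk.
by apply: eq_integral => w _; rewrite /discretized sumEFin.
Qed.

(** Serves both sides of the limit: before it with [X] close to [K *m U], and at the limit with
    equality and [t = 0]. *)
Lemma discretized_close N (M h t delta eta a : R) :
  0 <= M -> 0 <= eta ->
  (forall x y, `|x| <= n%:R * M * M -> `|x - y| < delta -> `|f x - f y| <= eta) ->
  (forall w, `|K w - M_ (kap w)| < h) -> n%:R * h * M < delta -> t < delta ->
  (P [set w | (N%:R < (kap w).+1%:R :> R)%R] <= a%:E)%E ->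
  (P [set w | (M < `|K w|)%R] <= a%:E)%E ->
  (P [set w | (M < `|U w|)%R] <= a%:E)%E ->
  (P [set w | (t < `|X w - K w *m U w|)%R] <= a%:E)%E ->
  `|\int[P]_w (Y w * f (X w)) - \int[P]_w discretized N Y kap M_ U f w| <=
  CY * (eta + eta) + 2 * (CY * Cf) * (a + (a + (a + a))).
Proof.
move=> M0 eta0 fU Kh hd td P1 P2 P3 P4.
have CY0 : 0 <= CY by apply: le_trans (YC point).
have Cf0 : 0 <= Cf by apply: le_trans (fC 0).
pose A := [set w | N%:R < (kap w).+1%:R :> R] `|` ([set w | M < `|K w|] `|`
  ([set w | M < `|U w|] `|` [set w | t < `|X w - K w *m U w|])).
have m1 : measurable [set w | N%:R < (kap w).+1%:R :> R].
  apply: (@measurable_lt_fun _ _ _ (fun w => (kap w).+1%:R)).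
  under eq_fun do rewrite -natr1; apply: measurable_funD => //.
  exact: measurable_natmap.
have m2 : measurable [set w | M < `|K w|].
  by apply: (@measurable_lt_fun _ _ _ (fun w => `|K w|)); exact: random_mx_norm.
have m3 : measurable [set w | M < `|U w|].
  by apply: (@measurable_lt_fun _ _ _ (fun w => `|U w|)); exact: random_mx_norm.
have m4 : measurable [set w | t < `|X w - K w *m U w|].
  apply: (@measurable_lt_fun _ _ _ (fun w => `|X w - K w *m U w|)).
  by apply: random_mx_norm; apply: random_mxB => //; exact: random_mxM.
apply: (@expectation_close _ _ P _ _ A).
- by apply: measurable_funM => //; exact: (continuous_random_mx cf rX).
- exact: measurable_discretized.
- by do 3! (apply: measurableU => //).
- by move=> w; rewrite normrM ler_pM.
- move=> w; rewrite discretizedE; case: ifP => _; last by rewrite normr0 mulr_ge0.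
  by rewrite normrM ler_pM.
- by rewrite mulr_ge0 ?addr_ge0.
- apply: measureU_le => //; first by do 2! (apply: measurableU => //).
  apply: measureU_le => //; first by apply: measurableU.
  exact: measureU_le.
move=> w /not_orP[/negP a1 /not_orP[/negP a2 /not_orP[/negP a3 /negP a4]]].
(* The successor in the first bad event makes its complement exactly [kap w < N]. *)
rewrite -!leNgt in a1 a2 a3 a4; rewrite ler_nat in a1.
rewrite discretizedE a1 -mulrBr normrM ler_pM//.
have KU : `|K w *m U w| <= n%:R * M * M.
  by rewrite (le_trans (mx_norm_mul _ _))// ler_pM ?mulr_ge0// ler_wpM2l.
rewrite -(subrKA (f (K w *m U w))) (le_trans (ler_normD _ _))// lerD//.
  by rewrite distrC fU// distrC (le_lt_trans a4).
apply: fU => //; rewrite -mulmxBl (le_lt_trans (mx_norm_mul _ _))//.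
rewrite (le_lt_trans _ hd)// ler_pM ?mulr_ge0// ler_wpM2l// ltW//.
Qed.

End Closeness.

Context {d : measure_display} {Omega : measurableType d} (P : probability Omega R).
Context {I : Type} (F : set_system I) {FF : ProperFilter F}.
Context (GG : set_system Omega) (sGG : sigma_algebra setT GG) (GGm : GG `<=` measurable).
Context {d' : measure_display} {Omega' : measurableType d'} (P' : probability Omega' R).
Context (proj : Omega' -> Omega) (pe : prob_extension P P' proj).
Local Notation T1 := (g_sigma_algebraType GG).

Let mT1 A : @measurable _ T1 A -> GG A.
Proof. by apply: smallest_sub. Qed.

Let mT1fun (Y : Omega -> R) : measurable_fun setT (Y : T1 -> R) -> measurable_fun setT Y.
Proof. by move=> mY _ B mB; rewrite setTI; apply/GGm/mT1; rewrite -[_ @^-1` _]setTI; exact: mY. Qed.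

Let mproj : measurable_fun setT proj.
Proof. by case: pe. Qed.

Let cvg_fineP (a : I -> \bar R) (l : \bar R) : (forall T, a T \is a fin_num) -> l \is a fin_num ->
  (a @ F --> l) <-> (forall e : R, 0 < e -> \forall T \near F, `|fine (a T) - fine l| <= e).
Proof.
move=> afin lfin; rewrite -{1}(fineK lfin); split.
  move=> /fine_cvgP[_ /cvgrPdist_le h] e e0; have := h e e0.
  by apply: filterS => T; rewrite distrC.
move=> h; apply/fine_cvgP; split; first exact: nearW.
apply/cvgrPdist_le => e e0; have := h e e0.
by apply: filterS => T; rewrite distrC.
Qed.

Let integral_fin d0 (Om : measurableType d0) (Q : probability Om R) k
    (f : 'cV[R]_k -> R) (Y : Om -> R) (X : Om -> 'cV[R]_k) :
  continuous f -> (exists M, forall x, `|f x| <= M) ->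
  measurable_fun setT Y -> (exists M, forall w, `|Y w| <= M) -> random_mx X ->
  (\int[Q]_w (Y w * f (X w))%:E)%E \is a fin_num.
Proof.
move=> cf [Cf fC] mY [CY YC] rX; apply: integrable_fin_num => //.
apply: (@bounded_integrable _ _ _ _ (CY * Cf)) => [|w]; last by rewrite normrM ler_pM.
by apply: measurable_funM => //; exact: (continuous_random_mx cf rX).
Qed.

Lemma stable_cvgP k (X : I -> Omega -> 'cV[R]_k) (Z : Omega' -> 'cV[R]_k) :
  (forall T, random_mx (X T)) -> random_mx Z ->
  stable_cvg F P GG P' proj X Z <->
  forall (f : 'cV[R]_k -> R) (Y : Omega -> R),
    continuous f -> (exists M, forall x, `|f x| <= M) ->
    measurable_fun setT (Y : T1 -> R) -> (exists M, forall w, `|Y w| <= M) ->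
    forall e : R, 0 < e -> \forall T \near F,
    `|\int[P]_w (Y w * f (X T w)) - \int[P']_w (Y (proj w) * f (Z w))| <= e.
Proof.
move=> rX rZ; split=> h f Y cf fC mY YC.
  apply/(cvg_fineP (a := fun T => \int[P]_w (Y w * f (X T w))%:E)%E).
  - by move=> T; apply: integral_fin => //; exact: mT1fun.
  - apply: (@integral_fin _ _ P' _ f (Y \o proj) Z) => //; last by case: YC => M YM; exists M => w; exact: YM.
    by apply: measurableT_comp => //; exact: mT1fun.
  - by apply: h => // B mB; apply: mT1; rewrite -[_ @^-1` _]setTI; exact: mY.
have mY1 : measurable_fun setT (Y : T1 -> R).
  by move=> _ B mB; rewrite setTI; apply: sub_sigma_algebra; exact: mY.
apply/cvg_fineP; last exact: h.
- by move=> T; apply: integral_fin => //; exact: mT1fun.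
- apply: (@integral_fin _ _ P' _ f (Y \o proj) Z) => //; last by case: YC => M YM; exists M => w; exact: YM.
  by apply: measurableT_comp => //; exact: mT1fun.
Qed.

(** Three errors of [e / 3]: from [X T] to the discretization in [U T], from there to the
    discretization in [Z], and from there to the limit. *)
Lemma stable_slutsky m n (K : Omega -> 'M[R]_(m, n)) (X : I -> Omega -> 'cV[R]_m)
    (U : I -> Omega -> 'cV[R]_n) (Z : Omega' -> 'cV[R]_n) :
  random_mx (K : T1 -> _) -> (forall T, random_mx (X T)) -> (forall T, random_mx (U T)) ->
  random_mx Z -> Op1 F P U -> cvg_prob F P (fun T w => X T w - K w *m U T w) (fun _ => 0) ->
  stable_cvg F P GG P' proj U Z ->
  stable_cvg F P GG P' proj X (fun w => K (proj w) *m Z w).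
Proof.
move=> rK1 rX rU rZ tU XKU /(stable_cvgP rU rZ) UZ.
have rK : random_mx K by move=> B BB; apply: GGm; apply: mT1; exact: rK1.
have rKp : random_mx (fun w => K (proj w)).
  by move=> B BB; rewrite -[X in measurable X]setTI; exact: (mproj measurableT (rK _ BB)).
apply: (iffRL (stable_cvgP rX (random_mxM rKp rZ))).
move=> f Y cf [Cf0 fC0] mY1 [CY0 YC0] e e0.
pose Cf := Num.max 1 Cf0; pose CY := Num.max 1 CY0.
have fC x : `|f x| <= Cf by rewrite le_max fC0 orbT.
have YC w : `|Y w| <= CY by rewrite le_max YC0 orbT.
have Cf1 : 0 < Cf by rewrite lt_max ltr01.
have CY1 : 0 < CY by rewrite lt_max ltr01.
have mY := mT1fun mY1.
(* In [budget], the two [eta] and the four [a] contribute [e / 6] each. *)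
pose eta := e / (12 * CY); have eta0 : 0 < eta by rewrite divr_gt0 ?mulr_gt0.
pose a := e / (48 * (CY * Cf)); have a0 : 0 < a by rewrite divr_gt0 ?mulr_gt0.
have budget : CY * (eta + eta) + 2 * (CY * Cf) * (a + (a + (a + a))) = e / 3.
  by rewrite /eta /a; field; rewrite !gt_eqF.
have [M1 M10 PM1] := tight_fun P (random_mx_norm rK) a0.
have [M2 PM2] := tU a a0.
have [M3 M30 PM3] := tight_fun P' (random_mx_norm rZ) a0.
pose M := Num.max M1 (Num.max M2 M3).
have [M1M M2M M3M] : [/\ M1 <= M, M2 <= M & M3 <= M].
  by split; rewrite !le_max lexx ?orbT.
have M0 : 0 <= M by apply: le_trans M1M.
have cball : compact [set x : 'cV[R]_m | `|x| <= n%:R * M * M].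
  apply: closed_bounded_compact.
    exists (n%:R * M * M); split; first exact: num_real.
    by move=> C MC x /= xM; rewrite (le_trans xM)// ltW.
  apply: (@closed_comp _ _ (fun x : 'cV[R]_m => `|x|) [set t | t <= n%:R * M * M]).
    by move=> x _; exact: (@norm_continuous R 'cV[R]_m x).
  exact: closed_le.
have [delta delta0 fU] := compact_unif_continuous cball cf eta0.
pose h := delta / (n%:R * M + 1).
have nM1 : 0 < n%:R * M + 1 by rewrite ltr_wpDl// mulr_ge0.
have h0 : 0 < h by rewrite divr_gt0.
have hd : n%:R * h * M < delta.
  rewrite /h [ltLHS](_ : _ = delta * (n%:R * M / (n%:R * M + 1))); last first.
    by field; rewrite gt_eqF.
  by rewrite gtr_pMr// ltr_pdivrMr// mul1r ltrDl.
(* Discretizing over [T1] makes the level sets of [kap] belong to [GG], as the test variables of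
   stable convergence require. *)
have [M_ [kap0 [mkap Kh]]] := random_mx_discretize rK1 h0.
pose kap : Omega -> nat := kap0.
have mk k : @measurable _ Omega (kap @^-1` [set k]) by apply: GGm; apply: mT1; exact: mkap.
have Kh' w := ltW (Kh w).
have mkS : measurable_fun setT (fun w => (kap w).+1%:R : R).
  by under eq_fun do rewrite -natr1; apply: measurable_funD => //; exact: measurable_natmap.
have [N0 N00 PN0] := tight_fun P mkS a0.
pose N := (Num.trunc N0).+1.
have PN : (P [set w | (N%:R < (kap w).+1%:R :> R)%R] <= a%:E)%E.
  apply: le_trans PN0; apply: le_measure; rewrite ?inE.
  - exact: (@measurable_lt_fun _ _ _ (fun w => (kap w).+1%:R)).
  - exact: (@measurable_lt_fun _ _ _ (fun w => (kap w).+1%:R)).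
  - by move=> w /=; apply: lt_trans; exact: truncnS_gt.
have PE A : measurable A -> P' (proj @^-1` A) = P A by case: pe => _; apply.
have mlt (g : Omega -> R) (t : R) : measurable_fun setT g -> measurable [set w | t < g w].
  exact: measurable_lt_fun.
have mlt' (g : Omega' -> R) (t : R) : measurable_fun setT g -> measurable [set w | t < g w].
  exact: measurable_lt_fun.
have mkp k : measurable ((kap \o proj) @^-1` [set k]).
  by rewrite -[X in measurable X]setTI; exact: (mproj measurableT (mk k)).
have YCp w : `|(Y \o proj) w| <= CY by exact: YC.
have rU0 := rU.
have lim_close : `|\int[P']_w (Y (proj w) * f (K (proj w) *m Z w)) -
    \int[P']_w discretized N (Y \o proj) (kap \o proj) M_ Z f w| <= e / 3.
  rewrite -budget; apply: (@discretized_close _ _ P' m n (Y \o proj) (kap \o proj)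
    (K \o proj) (fun w => K (proj w) *m Z w) Z f M_ _ _ _ _ _ cf CY Cf _ _ N M h 0 delta eta a) => //.
  - exact: measurableT_comp.
  - exact: random_mxM.
  - exact: ltW.
  - by move=> w /=; exact: Kh.
  - by rewrite -[leLHS](PE [set w | (N%:R < (kap w).+1%:R :> R)%R]) in PN *; [exact: PN | exact: mlt].
  - rewrite (_ : mkset _ = proj @^-1` [set w | M < `|K w|])// PE; last first.
      by apply: (mlt (fun w => `|K w|)); exact: random_mx_norm.
    apply: le_trans PM1; apply: le_measure; rewrite ?inE.
    + by apply: (mlt (fun w => `|K w|)); exact: random_mx_norm.
    + by apply: (mlt (fun w => `|K w|)); exact: random_mx_norm.
    + by move=> w /=; apply: le_lt_trans.
  - apply: le_trans PM3; apply: le_measure; rewrite ?inE.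
    + by apply: (mlt' (fun w => `|Z w|)); exact: random_mx_norm.
    + by apply: (mlt' (fun w => `|Z w|)); exact: random_mx_norm.
    + by move=> w /=; apply: le_lt_trans.
  - rewrite (_ : mkset _ = set0) ?measure0 ?lee_fin ?ltW//.
    by apply/seteqP; split=> // w /=; rewrite subrr normr0 ltxx.
have term k : \forall T \near F,
    `|\int[P]_w (Y w * \1_(kap @^-1` [set k]) w * f (M_ k *m U T w)) -
      \int[P']_w (Y (proj w) * \1_(kap @^-1` [set k]) (proj w) * f (M_ k *m Z w))| <= e / 3 / N%:R.
  apply: (UZ (fun x => f (M_ k *m x)) (fun w => Y w * \1_(kap @^-1` [set k]) w)).
  - have cM : continuous (fun x : 'cV[R]_n => M_ k *m x).
      by apply: (@mulmx_continuous _ _ _ _ _ (fun=> M_ k) id); [exact: cst_continuous | move=> ?].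
    by move=> x; apply: (@cvg_comp _ _ _ (fun x => M_ k *m x) f); [exact: cM | exact: cf].
  - by exists Cf.
  - by apply: measurable_funM.
  - exists CY => w; rewrite normrM -[leRHS]mulr1 ler_pM// indicE.
    by case: (w \in _); rewrite ?normr1 ?normr0.
  - by rewrite !divr_gt0.
have d2 : delta / 2 < delta by rewrite ltr_pdivrMr// ltr_pMr// ltr1n.
have PX : \forall T \near F,
    (P [set w | (delta / 2 < `|X T w - K w *m U T w - 0|)%R] <= a%:E)%E.
  by apply: (cvg_prob_le XKU) => //; rewrite divr_gt0.
have terms : \forall T \near F, forall k : 'I_N,
    `|\int[P]_w (Y w * \1_(kap @^-1` [set nat_of_ord k]) w * f (M_ k *m U T w)) -
      \int[P']_w (Y (proj w) * \1_(kap @^-1` [set nat_of_ord k]) (proj w) * f (M_ k *m Z w))|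
      <= e / 3 / N%:R.
  by apply: filter_forall => k; exact: term.
near=> T.
have T_close : `|\int[P]_w (Y w * f (X T w)) - \int[P]_w discretized N Y kap M_ (U T) f w| <= e / 3.
  rewrite -budget; apply: (@discretized_close _ _ P m n Y kap
    K (X T) (U T) f M_ _ _ _ _ _ cf CY Cf _ _ N M h (delta / 2) delta eta a) => //.
  - exact: ltW.
  - apply: le_trans PM1; apply: le_measure; rewrite ?inE.
    + by apply: (mlt (fun w => `|K w|)); exact: random_mx_norm.
    + by apply: (mlt (fun w => `|K w|)); exact: random_mx_norm.
    + by move=> w /=; apply: le_lt_trans.
  - apply: (@le_trans _ _ (P [set w | M2 < `|U T w|])); last by near: T.
    apply: le_measure; rewrite ?inE.
    + by apply: (mlt (fun w => `|U T w|)); exact: random_mx_norm.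
    + by apply: (mlt (fun w => `|U T w|)); exact: random_mx_norm.
    + by move=> w /=; apply: le_lt_trans.
  - rewrite (_ : mkset _ = [set w | delta / 2 < `|X T w - K w *m U T w - 0|]).
      by near: T.
    by apply/seteqP; split=> w /=; rewrite subr0.
have D_close : `|\int[P]_w discretized N Y kap M_ (U T) f w -
    \int[P']_w discretized N (Y \o proj) (kap \o proj) M_ Z f w| <= e / 3.
  rewrite (expectation_discretized P M_ mY mk (rU T) cf YC fC).
  rewrite (expectation_discretized P' M_ (measurableT_comp mY mproj) mkp rZ cf YCp fC).
  rewrite -sumrB (le_trans (ler_norm_sum _ _ _))//.
  have -> : e / 3 = \sum_(k < N) (e / 3 / N%:R).
    by rewrite sumr_const card_ord -[RHS]mulr_natr divfK// pnatr_eq0.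
  apply: ler_sum => k _; have : forall k : 'I_N,
    `|\int[P]_w (Y w * \1_(kap @^-1` [set nat_of_ord k]) w * f (M_ k *m U T w)) -
      \int[P']_w (Y (proj w) * \1_(kap @^-1` [set nat_of_ord k]) (proj w) * f (M_ k *m Z w))|
      <= e / 3 / N%:R by near: T.
  by move=> /(_ k).
have -> : e = e / 3 + (e / 3 + e / 3) by field.
set D1 := \int[P]_w discretized _ _ _ _ _ _ _ in T_close D_close.
set D2 := \int[P']_w discretized _ _ _ _ _ _ _ in lim_close D_close.
rewrite -(subrKA D1) (le_trans (ler_normD _ _))// lerD//.
by rewrite -(subrKA D2) (le_trans (ler_normD _ _))// lerD// distrC.
Unshelve. all: by end_near. Qed.

End StableSlutsky.

(** * Almost sure modifications, and the theorem *)

Section AlmostEverywhere.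
Context {R : realType} {d : measure_display} {Omega : measurableType d}.
Variable P : probability Omega R.

Lemma ae_eq_same_law m n (X Y : Omega -> 'M[R]_(m, n)) :
  random_mx X -> random_mx Y -> {ae P, forall w, X w = Y w} -> same_law P P X Y.
Proof.
move=> rX rY XY B BB; have mX := rX B BB; have mY := rY B BB.
have Pfin A : measurable A -> (fine (P A))%:E = P A.
  by move=> mA; rewrite fineK// fin_num_measure.
apply/eqP; rewrite eq_le; apply/andP; split.
  rewrite -[leRHS]Pfin//; apply: (probability_ae_le mX mY XY) => [w /= Xw|]; last by rewrite Pfin.
  by have [XYw|] := pselect (X w = Y w); [right; rewrite /preimage /= -XYw | left].
rewrite -[leRHS]Pfin//; apply: (probability_ae_le mY mX XY) => [w /= Yw|]; last by rewrite Pfin.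
by have [XYw|] := pselect (X w = Y w); [right; rewrite /preimage /= XYw | left].
Qed.

Lemma cvg_prob_ae (I : Type) (F : set_system I) {FF : Filter F} m n
    (X Y : I -> Omega -> 'M[R]_(m, n)) (Z : Omega -> 'M[R]_(m, n)) :
  (forall T, random_mx (X T)) -> (forall T, random_mx (Y T)) -> random_mx Z ->
  (forall T, {ae P, forall w, X T w = Y T w}) ->
  cvg_prob F P X Z -> cvg_prob F P Y Z.
Proof.
move=> rX rY rZ XY XZ e e0; apply/cvge0P => [T|a a0]; first exact: measure_ge0.
have h := (iffLR (cvge0P (fun _ => measure_ge0 _ _)) (XZ e e0)) a a0.
have mE (V : I -> Omega -> 'M[R]_(m, n)) T : random_mx (V T) ->
    measurable [set w | e < `|V T w - Z w|].
  move=> rV; apply: (@measurable_lt_fun _ _ _ (fun w => `|V T w - Z w|)).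
  by apply: random_mx_norm; exact: random_mxB.
apply: filterS (h FF) => T; apply: probability_ae_le (XY T) _; [exact: mE|exact: mE|].
move=> w /= Yw; have [XYw|] := pselect (X T w = Y T w); last by left.
by right; rewrite /= XYw.
Qed.

Lemma ae_extension d' (Omega' : measurableType d') (P' : probability Omega' R)
    (proj : Omega' -> Omega) (Q : Omega -> Prop) :
  prob_extension P P' proj -> {ae P, forall w, Q w} -> {ae P', forall w, Q (proj w)}.
Proof.
move=> [mproj PE] [N [mN N0 QN]]; exists (proj @^-1` N); split.
- by rewrite -[X in measurable X]setTI; exact: mproj.
- by rewrite PE.
- by move=> w /= nQ; apply: QN.
Qed.

End AlmostEverywhere.

Theorem theorem3
    (R : realType) (d : measure_display) (Omega : measurableType d)
    (P : probability Omega R)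
    (I : Type) (F : set_system I) (FF : ProperFilter F)
    (p0 p1 : nat) (p_gt0 : (0 < p0 + p1)%N)
    (q : R) (q_gt0 : 0 < q) (q_le1 : q <= 1)
    (r : I -> R) (r_gt0 : forall T, 0 < r T) (r_cvg0 : r T @[T --> F] --> 0)
    (thetas : 'cV[R]_(p0 + p1))
    (thetas_neq0 : forall j : 'I_p0, thetas (lshift p1 j) 0 != 0)
    (thetas_eq0 : forall j : 'I_p1, thetas (rshift p0 j) 0 = 0)
    (thetat : I -> Omega -> 'cV[R]_(p0 + p1))
    (thetat_rv : forall T, random_mx (thetat T))
    (Ghat : I -> Omega -> 'M[R]_(p0 + p1))
    (Ghat_rv : forall T, random_mx (Ghat T))
    (Ghat_posdef : forall T, {ae P, forall w, sym_posdef (Ghat T w)})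
    (kappa : I -> 'I_(p0 + p1) -> Omega -> R)
    (kappa_rv : forall T j, measurable_fun setT (kappa T j))
    (kappa_ge0 : forall T j w, 0 <= kappa T j w)
    (thetah : I -> Omega -> 'cV[R]_(p0 + p1))
    (thetah_rv : forall T, random_mx (thetah T))
    (thetah_min : forall T, {ae P, forall w, forall theta : 'cV[R]_(p0 + p1),
        QLSA q (Ghat T w) (thetat T w) (fun j => kappa T j w) (thetah T w) <=
        QLSA q (Ghat T w) (thetat T w) (fun j => kappa T j w) theta})
    (G : Omega -> 'M[R]_(p0 + p1))
    (G_rv : random_mx G)
    (G_posdef : {ae P, forall w, sym_posdef (G w)})
    (Ghat_cvg : cvg_prob F P Ghat G)
    (thetat_Op1 : Op1 F P (fun T w => (r T)^-1 *: (thetat T w - thetas)))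
    (a_op1 : op1 F P (fun T w => (r T)^-1 * amax (fun j => kappa T j w)))
    (b_infty : cvg_prob_pinfty F P (fun T w =>
        ((r T `^ (- (2 - q)))%:E * bmin (fun j => kappa T j w))%E)) :
  cvg_prob F P
    (fun T w => (r T)^-1 *: usubmx (thetah T w - thetas)
                - frakG (G w) *m ((r T)^-1 *: (thetat T w - thetas)))
    (fun _ => 0)
  /\
  (forall (d' : measure_display) (Omega' : measurableType d')
      (P' : probability Omega' R) (proj : Omega' -> Omega)
      (GG : set_system Omega)
      (Gamma : Omega -> 'M[R]_(p0 + p1)) (zeta : Omega' -> 'cV[R]_(p0 + p1)),
    prob_extension P P' proj ->
    sigma_algebra setT GG -> GG `<=` measurable ->
    {ae P, forall w, sym_posdef (Gamma w)} ->
    sigma_mx Gamma `<=` GG ->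
    std_gaussian P' zeta ->
    indep_sigma P' (sigma_mx zeta) (preimage_set_system setT proj GG) ->
    stable_cvg F P GG P' proj
      (fun T w => (r T)^-1 *: (thetat T w - thetas))
      (fun w' => invsqrtmx (Gamma (proj w')) *m zeta w') ->
    {ae P, forall w, G w = Gamma w} ->
    stable_cvg F P GG P' proj
      (fun T w => (r T)^-1 *: usubmx (thetah T w - thetas))
      (fun w' => frakG (G (proj w')) *m (invsqrtmx (Gamma (proj w')) *m zeta w'))
    /\
    mixed_normal P' P
      (fun w' => frakG (G (proj w')) *m (invsqrtmx (Gamma (proj w')) *m zeta w'))
      (fun w => invmx (ulsubmx (Gamma w)))).
Proof.
have part1 := lsa_oracle_cvg FF q_gt0 q_le1 r_gt0 r_cvg0 thetas_neq0 thetas_eq0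
  thetat_rv Ghat_rv Ghat_posdef kappa_rv kappa_ge0 thetah_rv thetah_min G_rv G_posdef
  Ghat_cvg thetat_Op1 a_op1 b_infty.
split=> // d' Omega' P' proj GG Gamma zeta pe sGG GGm Gamma_pd GammaGG gzeta zetaI UZ GGamma.
have [mproj PE] := pe.
have rGammaT : random_mx (Gamma : g_sigma_algebraType GG -> _).
  move=> B BB; apply: sub_sigma_algebra; apply: GammaGG; exists B => //.
  by rewrite setTI.
have GGsig : @measurable _ (g_sigma_algebraType GG) `<=` GG by apply: smallest_sub.
have rGamma : random_mx Gamma by move=> B BB; apply: GGm; apply: GGsig; exact: rGammaT.
have rproj m n (X : Omega -> 'M[R]_(m, n)) : random_mx X -> random_mx (X \o proj).
  by move=> rX B BB; rewrite -[X in measurable X]setTI; exact: (mproj measurableT _ (rX _ BB)).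
have rzeta : random_mx zeta by case: gzeta.
have rZ : random_mx (fun w' => invsqrtmx (Gamma (proj w')) *m zeta w').
  apply: random_mxM => //; apply: (random_mx_comp (g := @invsqrtmx R (p0 + p1))).
    exact: random_invsqrtmx.
  exact: rproj.
have rU T : random_mx (fun w => (r T)^-1 *: (thetat T w - thetas)).
  by apply: random_mxZ; apply: random_mxB => //; exact: random_mx_cst.
have rX T : random_mx (fun w => (r T)^-1 *: usubmx (thetah T w - thetas)).
  by apply: random_mxZ; apply: random_usubmx; apply: random_mxB => //; exact: random_mx_cst.
have rKG := random_frakG G_rv; have rKGamma := random_frakG rGamma.
have GGamma' := ae_extension pe GGamma.
have rlim : random_mx (fun w' => frakG (G (proj w')) *m (invsqrtmx (Gamma (proj w')) *m zeta w')).
  by apply: random_mxM => //; exact: (rproj _ _ _ rKG).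
have rlim' : random_mx (fun w' => frakG (Gamma (proj w')) *m (invsqrtmx (Gamma (proj w')) *m zeta w')).
  by apply: random_mxM => //; exact: (rproj _ _ _ rKGamma).
split.
  (* [G] is only almost surely equal to [Gamma] and may fail to be [GG]-measurable, so the Slutsky
     argument runs with [Gamma]; the limit is converted back afterwards. *)
  have XKU : cvg_prob F P (fun T w => (r T)^-1 *: usubmx (thetah T w - thetas)
      - frakG (Gamma w) *m ((r T)^-1 *: (thetat T w - thetas))) (fun _ => 0).
    apply: cvg_prob_ae part1; [| |exact: random_mx_cst|].
    - by move=> T; apply: random_mxB => //; exact: random_mxM.
    - by move=> T; apply: random_mxB => //; exact: random_mxM.
    - by move=> T; apply: filterS GGamma => w ->.
  have := stable_slutsky sGG GGm pe (random_frakG rGammaT) rX rU rZ thetat_Op1 XKU UZ.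
  move=> h f Y cf fC mY YC; have := h FF f Y cf fC mY YC.
  have mYp : measurable_fun setT (Y \o proj).
    by apply: measurableT_comp => // _ B mB; rewrite setTI; apply: GGm; exact: mY.
  have -> : (\int[P']_w (Y (proj w) * f (frakG (Gamma (proj w)) *m
        (invsqrtmx (Gamma (proj w)) *m zeta w)))%:E =
      \int[P']_w (Y (proj w) * f (frakG (G (proj w)) *m
        (invsqrtmx (Gamma (proj w)) *m zeta w)))%:E)%E; last by [].
  apply: ae_eq_integral => //.
  - by apply/measurable_EFinP; apply: measurable_funM => //; exact: (continuous_random_mx cf rlim').
  - by apply/measurable_EFinP; apply: measurable_funM => //; exact: (continuous_random_mx cf rlim).
  - by apply: filterS GGamma' => w -> _.
have rV : random_mx (fun w => invmx (ulsubmx (Gamma w))).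
  by apply: random_invmx; exact: random_ulsubmx.
split=> //; split=> //.
pose Wh w := whitening (Gamma w).
have rWh : random_mx (Wh : g_sigma_algebraType GG -> _).
  apply: (random_mx_comp (g := @whitening R p0 p1)) => //; exact: random_whitening.
(* Orthonormality holds only almost surely for [Wh], but the mixture lemmas ask for it everywhere.
   The test is a measurable function of [Wh], so [W] remains [GG]-measurable. *)
pose W w : 'M[R]_(p0, p0 + p1) :=
  if `|Wh w *m (Wh w)^T - 1%:M| == 0 then Wh w else row_mx 1%:M 0.
have rW : random_mx (W : g_sigma_algebraType GG -> _).
  apply: random_mx_ifT => //; last exact: random_mx_cst.
  apply: measurable_fun_eqr => //; apply: random_mx_norm.
  apply: random_mxB; last exact: random_mx_cst.
  by apply: random_mxM => //; exact: random_trmx.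
have WW w : W w *m (W w)^T = 1%:M.
  rewrite /W; case: ifPn => [|_]; last exact: row_mx10_unitary.
  by rewrite normr_eq0 subr_eq0 => /eqP.
have mprojGG A : GG A -> measurable (proj @^-1` A).
  by move=> /GGm mA; rewrite -[X in measurable X]setTI; exact: mproj.
(* The extension itself carries the copy of [V] and the Gaussian vector; the required equality of
   laws then follows from an almost sure equality. *)
exists d', Omega', P', (fun w => invmx (ulsubmx (Gamma (proj w)))),
  (fun w => W (proj w) *m zeta w); split.
- exact: (rproj _ _ _ rV).
- by move=> B BB; rewrite -(PE _ (rV _ BB)).
- exact: (gaussian_mixture_std sGG mprojGG gzeta zetaI rW WW).
- move=> A _ xiA [B BB <-].
  apply: (gaussian_mixture_indep_sigma sGG mprojGG gzeta zetaI rW WW) => //.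
  exists ((fun w => invmx (ulsubmx (Gamma w))) @^-1` B) => //.
  by apply: GGsig; apply: (random_invmx (random_ulsubmx rGammaT)).
apply: ae_eq_same_law => //.
  apply: random_mxM; last exact: (random_gaussian_mixture sGG mprojGG gzeta rW).
  apply: (random_mx_comp (g := @sqrtmx R p0)); first exact: random_sqrtmx.
  exact: (rproj _ _ _ rV).
have Gamma_pd' := ae_extension pe Gamma_pd.
apply: filterS2 GGamma' Gamma_pd' => w -> pd.
have -> : W (proj w) = Wh (proj w).
  by rewrite /W /Wh whitening_unitary// subrr normr0 eqxx.
by rewrite /Wh [RHS]mulmxA whiteningK// -mulmxA.
Qed.
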